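(* Let $g\in K[x,y]$ be an irreducible polynomial defining a curve in $(K^* )^2$, let $l\in\mathbb{Q}$ and let $\zeta\in\mathbb{C}\{\!\{t\}\!\}$ with $\operatorname{val}(\zeta)=0$. The linear re-embedding $\operatorname{Trop}(I_{g,x+\zeta t^{-l}})$ in the modification of $\mathbb{R}^2$ along the linear tropical polynomial $F=\max\{X,l\}$ is completely determined (as a weighted tropical curve) by the two tropical plane curves $\operatorname{Trop}(g)$ and $\operatorname{Trop}(\tilde g)$, where $\tilde g(z,y)=g(z-\zeta t^{-l},y)$. In particular, the vertices of $\operatorname{Trop}(I_{g,x+\zeta t^{-l}})$ along the line $\{X=Z=l\}$ are the endpoints of the connected components of $(\operatorname{Trop}(g)\times\mathbb{R})\cap(\mathbb{R}\times\operatorname{Trop}(\tilde g))\cap\{X=Z=l\}$.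
   Context: $K=\mathbb{C}\{\!\{t^{\mathbb{R}}\}\!\}$ is the field of generalized Puiseux series, with $\operatorname{val}$ the leading exponent; it contains the Puiseux series field $\mathbb{C}\{\!\{t\}\!\}$. Tropicalizations $\operatorname{Trop}(\cdot)$ are taken with the max-convention (coordinatewise $-\operatorname{val}$) of the part of the variety in the algebraic torus, and carry tropical multiplicities on edges. $I_{g,f}=\langle g,z-f\rangle\subset K[x,y,z]$. Algebraic coordinates $x,y,z$ correspond to tropical coordinates $X,Y,Z$. The modification of $\mathbb{R}^2$ along $F=\max\{X,l\}$ is the tropical surface in $\mathbb{R}^3$ with maximal cells $\sigma_1=\{X\le l,Z=l\}$, $\sigma_2=\{X\ge l,Z=X\}$, $\sigma_3=\{X=l,Z\le l\}$; it contains $\operatorname{Trop}(I_{g,x+\zeta t^{-l}})$. $\operatorname{Trop}(g)$ lives in the $(X,Y)$-plane and $\operatorname{Trop}(\tilde g)$ in the $(Z,Y)$-plane; in $\mathbb{R}^3$ with coordinates $(X,Y,Z)$, $\operatorname{Trop}(g)\times\mathbb{R}=\{(X,Y)\in\operatorname{Trop}(g)\}$ and $\mathbb{R}\times\operatorname{Trop}(\tilde g)=\{(Z,Y)\in\operatorname{Trop}(\tilde g)\}$.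
   Formalization: The vertices on {X=Z=l} are the endpoints of components together with the points of the intersection over a vertex of Trop(g) or Trop(g̃); the literal claim fails for l=0, ζ=1, g=(x-2)(y-1)+t, where the intersection is the full line but the origin is a vertex. *)

(* Defs.v *)
From HB Require Import structures.
From mathcomp Require Import all_boot all_order all_algebra.
(* [mpoly] has to be imported before mathcomp-analysis: in the other order the
   notations of the two libraries clash. *)
From mathcomp Require Import complex mpoly.
From mathcomp Require Import all_classical all_reals all_analysis.

Set Implicit Arguments.
Unset Strict Implicit.
Unset Printing Implicit Defensive.

Import Order.TTheory GRing.Theory Num.Theory.
Import numFieldNormedType.Exports.

Local Open Scope classical_set_scope.
Local Open Scope ring_scope.

(** * The field C{{t^R}} of generalized Puiseux series *)

(* A generalized Puiseux series is a formal sum of terms c_a t^a, a real, whose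
   exponents form a finite set or a sequence increasing to +oo; equivalently,
   only finitely many exponents lie below any given bound. *)
Definition left_finite (R : realType) (f : R -> R[i]) : Prop :=
  forall b : R, finite_set [set a | a <= b /\ f a <> 0].

Record gpuiseux (R : realType) := GPuiseux {
  gcoef : R -> R[i];
  gcoef_finite : left_finite gcoef }.

HB.instance Definition _ (R : realType) := gen_eqMixin (gpuiseux R).
HB.instance Definition _ (R : realType) := gen_choiceMixin (gpuiseux R).

Lemma gcoef_inj (R : realType) (f g : gpuiseux R) :
  (forall a, gcoef f a = gcoef g a) -> f = g.
Proof.
case: f g => [f hf] [g hg] /= /funext fg; case: _ / fg in hg *.
by congr GPuiseux; exact: Prop_irrelevance.
Qed.

Lemma gp_bounded_seq (R : realType) (f : gpuiseux R) (b : R) :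
  exists2 s : seq R, uniq s & forall a, a <= b -> gcoef f a <> 0 -> a \in s.
Proof.
have fin := gcoef_finite f b.
exists (finmap.enum_fset (fset_set [set a | a <= b /\ gcoef f a <> 0]));
  first exact: finmap.fset_uniq.
by move=> a ab fa; rewrite in_fset_set// inE.
Qed.

Lemma seq_has_min (R : realType) (s : seq R) : s <> [::] ->
  exists2 v, v \in s & forall a, a \in s -> v <= a.
Proof.
elim: s => // x [|y s] IH _.
  by exists x; rewrite ?inE// => a; rewrite inE => /eqP ->.
have [|v vs vmin] := IH; first by [].
have [xv|vx] := leP x v.
  exists x; first by rewrite inE eqxx.
  by move=> a; rewrite inE => /orP[/eqP ->//|/vmin]; exact: le_trans.
exists v; first by rewrite inE vs orbT.
by move=> a; rewrite inE => /orP[/eqP ->|/vmin//]; exact: ltW.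
Qed.

Lemma gp_lead_exists (R : realType) (f : gpuiseux R) (a0 : R) :
  gcoef f a0 <> 0 ->
  exists2 v, gcoef f v <> 0 & forall a, gcoef f a <> 0 -> v <= a.
Proof.
move=> fa0; have [s us hs] := gp_bounded_seq f a0.
pose s' := [seq a <- s | gcoef f a != 0].
have a0s' : a0 \in s' by rewrite mem_filter hs// andbT; exact/eqP.
have [|v vs' vmin] := @seq_has_min _ s'; first by move=> e; rewrite e in a0s'.
exists v; first by move: vs'; rewrite mem_filter => /andP[/eqP].
move=> a fa; have [aa0|/ltW a0a] := leP a a0.
  by apply: vmin; rewrite mem_filter hs// andbT; exact/eqP.
exact: le_trans (vmin _ a0s') a0a.
Qed.

Lemma gp_lower_bound (R : realType) (f : gpuiseux R) :
  exists m, forall a, gcoef f a <> 0 -> m <= a.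
Proof.
have [[a0 /gp_lead_exists[v _ hv]]|h] := pselect (exists a, gcoef f a <> 0).
  by exists v.
by exists 0 => a fa; exfalso; apply: h; exists a.
Qed.

Section Ring.
Variable R : realType.
Implicit Types f g h : gpuiseux R.

Fact left_finite0 : @left_finite R (fun=> 0).
Proof. by move=> b; apply: (sub_finite_set _ (finite_set0 _)) => a [_]; exact. Qed.
Definition gp_zero : gpuiseux R := GPuiseux left_finite0.

Fact left_finiteD f g : left_finite (fun a => gcoef f a + gcoef g a).
Proof.
move=> b; have := conj (gcoef_finite f b) (gcoef_finite g b).
rewrite -finite_setU; apply: sub_finite_set => a [ab fga].
have [fa0|fa0] := pselect (gcoef f a = 0); last by left.
by right; split=> // ga0; apply: fga; rewrite fa0 ga0 addr0.
Qed.
Definition gp_add f g : gpuiseux R := GPuiseux (left_finiteD f g).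

Fact left_finiteN f : left_finite (fun a => - gcoef f a).
Proof.
move=> b; apply: sub_finite_set (gcoef_finite f b) => a [ab fa]; split=> // e.
by apply: fa; rewrite e oppr0.
Qed.
Definition gp_opp f : gpuiseux R := GPuiseux (left_finiteN f).

Fact left_finite_mono (c : R[i]) (a : R) :
  left_finite (fun x => if x == a then c else 0).
Proof.
move=> b; apply: (sub_finite_set _ (finite_set1 a)) => x [_] /=.
by case: eqP.
Qed.
(* c t^a *)
Definition gp_mono (c : R[i]) (a : R) : gpuiseux R :=
  GPuiseux (left_finite_mono c a).

(* The sum has finite support, as f and g have only finitely many terms whose
   exponents a and c - a are both bounded below. *)
Definition gp_conv f g (c : R) : R[i] :=
  \sum_(a \in [set: R]) gcoef f a * gcoef g (c - a).

Lemma gp_convE f g (c : R) (s : seq R) : uniq s ->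
  (forall a, gcoef f a <> 0 -> gcoef g (c - a) <> 0 -> a \in s) ->
  gp_conv f g c = \sum_(a <- s) gcoef f a * gcoef g (c - a).
Proof.
move=> us hs; rewrite /gp_conv (fsbigE s)//=; last first.
  move=> a _ /negP as_; have [->|/eqP fa] := eqVneq (gcoef f a) 0.
    by rewrite mul0r.
  have [->|/eqP ga] := eqVneq (gcoef g (c - a)) 0; first by rewrite mulr0.
  by exfalso; apply: as_; exact: hs.
by apply: eq_bigl => a; rewrite in_setT.
Qed.

Lemma gp_conv_seq f g (c : R) : exists2 s : seq R, uniq s &
  forall c' a, c' <= c -> gcoef f a <> 0 -> gcoef g (c' - a) <> 0 -> a \in s.
Proof.
have [m hm] := gp_lower_bound g.
have [s us hs] := gp_bounded_seq f (c - m); exists s => // c' a c'c fa ga.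
apply: hs => //; have := hm _ ga.
by rewrite !lerBrDr addrC => h; exact: le_trans h c'c.
Qed.

Lemma gp_convC f g (c : R) : gp_conv f g c = gp_conv g f c.
Proof.
have [s us hs] := gp_conv_seq f g c.
rewrite (@gp_convE f g c s)//; last by move=> a; exact: hs.
rewrite (@gp_convE g f c [seq c - a | a <- s]).
- by rewrite big_map; apply: eq_bigr => a _; rewrite mulrC subKr.
- by rewrite map_inj_uniq// => x y /(congr1 (fun z => c - z)); rewrite !subKr.
- move=> a ga fa; apply/mapP; exists (c - a); last by rewrite subKr.
  by apply: (hs c) => //; rewrite subKr.
Qed.

Fact left_finiteM f g : left_finite (gp_conv f g).
Proof.
move=> b.
have [s us hs] := gp_conv_seq f g b.
have [s' us' hs'] := gp_conv_seq g f b.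
apply: (sub_finite_set _ (finite_seq (allpairs +%R s s'))) => c [cb hc].
have [a fga] : exists a, gcoef f a * gcoef g (c - a) <> 0.
  apply: contrapT => /forallNP h; apply: hc; rewrite /gp_conv fsbig1// => a _.
  by apply: contrapT; exact: h.
have fa : gcoef f a <> 0 by move=> e; apply: fga; rewrite e mul0r.
have ga : gcoef g (c - a) <> 0 by move=> e; apply: fga; rewrite e mulr0.
apply/allpairsP; exists (a, c - a); split=> /=; last by rewrite subrKC.
  exact: (hs c a cb fa ga).
by apply: (hs' c (c - a) cb ga); rewrite subKr.
Qed.
Definition gp_mul f g : gpuiseux R := GPuiseux (left_finiteM f g).

Fact gp_addA : associative gp_add.
Proof. by move=> f g h; apply: gcoef_inj => a /=; rewrite addrA. Qed.
Fact gp_addC : commutative gp_add.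
Proof. by move=> f g; apply: gcoef_inj => a /=; rewrite addrC. Qed.
Fact gp_add0 : left_id gp_zero gp_add.
Proof. by move=> f; apply: gcoef_inj => a /=; rewrite add0r. Qed.
Fact gp_addN : left_inverse gp_zero gp_opp gp_add.
Proof. by move=> f; apply: gcoef_inj => a /=; rewrite addNr. Qed.

HB.instance Definition _ :=
  GRing.isZmodule.Build (gpuiseux R) gp_addA gp_addC gp_add0 gp_addN.

Fact gp_mulC : commutative gp_mul.
Proof. by move=> f g; apply: gcoef_inj => a /=; exact: gp_convC. Qed.

Lemma gp_conv_lower f g (mf mg c : R) :
  (forall a, gcoef f a <> 0 -> mf <= a) ->
  (forall a, gcoef g a <> 0 -> mg <= a) -> gp_conv f g c <> 0 -> mf + mg <= c.
Proof.
move=> hf hg hc; have [a fga] : exists a, gcoef f a * gcoef g (c - a) <> 0.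
  apply: contrapT => /forallNP H; apply: hc; rewrite /gp_conv fsbig1// => a _.
  by apply: contrapT; exact: H.
have fa : gcoef f a <> 0 by move=> e; apply: fga; rewrite e mul0r.
have ga : gcoef g (c - a) <> 0 by move=> e; apply: fga; rewrite e mulr0.
by have := lerD (hf _ fa) (hg _ ga); rewrite subrKC.
Qed.

Fact gp_mulA : associative gp_mul.
Proof.
move=> f g h; apply: gcoef_inj => d /=.
have [m hm] := gp_lower_bound f.
have [mg hmg] := gp_lower_bound g.
have [mh hmh] := gp_lower_bound h.
have [sf usf hsf] := gp_bounded_seq f (d - (mg + mh)).
have [sh ush hsh] := gp_bounded_seq h (d - (m + mg)).
rewrite (@gp_convE f (gp_mul g h) d sf)//; last first.
  move=> a fa gha; apply: hsf => //.
  by have := gp_conv_lower hmg hmh gha; rewrite !lerBrDr addrC.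
rewrite gp_convC (@gp_convE h (gp_mul f g) d sh)//; last first.
  move=> a ha fga; apply: hsh => //.
  by have := gp_conv_lower hm hmg fga; rewrite !lerBrDr addrC.
transitivity (\sum_(a <- sf) \sum_(b <- sh)
    gcoef f a * gcoef h b * gcoef g (d - a - b)).
  apply: eq_bigr => a _; have [->|/eqP fa] := eqVneq (gcoef f a) 0.
    by rewrite mul0r big1// => b _; rewrite !mul0r.
  rewrite /= gp_convC (@gp_convE h g (d - a) sh)//.
    by rewrite mulr_sumr; apply: eq_bigr => b _; rewrite mulrA.
  move=> b hb gb; apply: hsh => //.
  have := lerD (hm _ fa) (hmg _ gb).
  by rewrite addrAC subrKC lerBrDr addrC -lerBrDr.
rewrite exchange_big; apply: eq_bigr => b _ /=.
have [->|/eqP hb] := eqVneq (gcoef h b) 0.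
  by rewrite mul0r big1// => a _; rewrite mulr0 mul0r.
rewrite (@gp_convE f g (d - b) sf)//.
  rewrite mulr_sumr; apply: eq_bigr => a _.
  by rewrite mulrA (mulrC (gcoef h b)) addrAC.
move=> a fa ga; apply: hsf => //.
have := lerD (hmh _ hb) (hmg _ ga).
by rewrite addrAC subrKC lerBrDr addrC -lerBrDr (addrC mg).
Qed.

Definition gp_one : gpuiseux R := gp_mono 1 0.

Lemma gp_conv_mono (c : R[i]) (v : R) f (d : R) :
  gp_conv (gp_mono c v) f d = c * gcoef f (d - v).
Proof.
rewrite (@gp_convE _ _ _ [:: v])//=; first by rewrite big_seq1 eqxx.
by move=> a; case: eqP => // ->; rewrite inE.
Qed.

Fact gp_mul1 : left_id gp_one gp_mul.
Proof.
by move=> f; apply: gcoef_inj => a /=; rewrite gp_conv_mono mul1r subr0.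
Qed.

Fact gp_mulD : left_distributive gp_mul gp_add.
Proof.
move=> f g h; apply: gcoef_inj => d /=.
have [m hm] := gp_lower_bound h.
have [sf usf hsf] := gp_bounded_seq f (d - m).
have [sg usg hsg] := gp_bounded_seq g (d - m).
pose s := undup (sf ++ sg).
have us : uniq s by exact: undup_uniq.
have hh a : gcoef h (d - a) <> 0 -> a <= d - m.
  by move=> /hm; rewrite !lerBrDr addrC.
rewrite (@gp_convE f h d s)//; last first.
  by move=> a fa /hh ha; rewrite mem_undup mem_cat hsf.
rewrite (@gp_convE g h d s)//; last first.
  by move=> a ga /hh ha; rewrite mem_undup mem_cat hsg// orbT.
rewrite (@gp_convE (gp_add f g) h d s)//=; last first.
  move=> a fga /hh ha; rewrite mem_undup mem_cat.
  have [fa|/eqP fa] := eqVneq (gcoef f a) 0; last by rewrite hsf.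
  by rewrite hsg ?orbT// => ga; apply: fga; rewrite fa ga addr0.
by rewrite -big_split; apply: eq_bigr => a _; rewrite mulrDl.
Qed.

Fact gp_one_neq0 : gp_one != gp_zero.
Proof.
apply/eqP => /(congr1 (fun f => gcoef f 0)) /=.
by rewrite eqxx => /eqP; rewrite oner_eq0.
Qed.

HB.instance Definition _ := GRing.Zmodule_isComNzRing.Build (gpuiseux R)
  gp_mulA gp_mulC gp_mul1 gp_mulD gp_one_neq0.

Lemma gcoefM f g : gcoef (f * g) = gp_conv f g. Proof. by []. Qed.
Lemma gcoefD f g a : gcoef (f + g) a = gcoef f a + gcoef g a. Proof. by []. Qed.
Lemma gcoefN f a : gcoef (- f) a = - gcoef f a. Proof. by []. Qed.
Lemma gcoef0 a : gcoef (0 : gpuiseux R) a = 0. Proof. by []. Qed.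
Lemma gcoef1 a : gcoef (1 : gpuiseux R) a = if a == 0 then 1 else 0.
Proof. by []. Qed.

Lemma gp_lowerX f (m : R) n : (forall a, gcoef f a <> 0 -> m <= a) ->
  forall a, gcoef (f ^+ n) a <> 0 -> m *+ n <= a.
Proof.
move=> hm; elim: n => [|n IH] a.
  by rewrite expr0 gcoef1; case: eqP => // ->.
by rewrite exprS gcoefM mulrS; exact: gp_conv_lower.
Qed.

(* The geometric series sum_n h^n converges if h has positive valuation. *)
Lemma gp_inv_geometric h (m : R) : 0 < m ->
  (forall a, gcoef h a <> 0 -> m <= a) -> exists g, g * (1 - h) = 1.
Proof.
move=> m0 hm; pose N (a : R) := (Num.truncn (`|a| / m)).+1.
have hN a n : (N a <= n)%N -> a < m *+ n.
  move=> Nn; rewrite -mulr_natr mulrC -ltr_pdivrMr//.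
  apply: le_lt_trans (_ : `|a| / m < _).
    by rewrite ler_pM2r ?invr_gt0// ler_norm.
  apply: lt_le_trans (truncnS_gt _) _.
  by rewrite ler_nat.
pose P n := \sum_(i < n) h ^+ i.
have PE n n' a : (N a <= n)%N -> (n <= n')%N -> gcoef (P n') a = gcoef (P n) a.
  move=> Nn; elim: n' => [|n' IH]; first by rewrite leqn0 => /eqP ->.
  rewrite leq_eqVlt => /orP[/eqP -> //|]; rewrite ltnS => nn'.
  rewrite /P big_ord_recr gcoefD -/(P n') IH//.
  have [->|/eqP] := eqVneq (gcoef (h ^+ n') a) 0; first by rewrite addr0.
  move=> /(gp_lowerX hm); rewrite leNgt hN//; exact: leq_trans Nn nn'.
have Ploc (b : R) : exists n, forall a, a <= b -> gcoef (P (N a)) a = gcoef (P n) a.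
  have hN' a n : (N b <= n)%N -> a <= b -> gcoef (h ^+ n) a = 0.
    move=> Nn ab; apply: contrapT => /(gp_lowerX hm); rewrite leNgt.
    by rewrite (le_lt_trans ab)// hN.
  have PE' n a : (N b <= n)%N -> a <= b -> gcoef (P n) a = gcoef (P (N b)) a.
    move=> + ab; elim: n => [|n IH]; first by rewrite leqn0 => /eqP <-.
    rewrite leq_eqVlt => /orP[/eqP -> //|]; rewrite ltnS => Nn.
    by rewrite /P big_ord_recr gcoefD -/(P n) IH// hN'// addr0.
  exists (N b) => a ab.
  by rewrite -(PE (N a) (maxn (N a) (N b)))// ?leq_maxl// PE'// leq_maxr.
have Gfin : left_finite (fun a => gcoef (P (N a)) a).
  move=> b; have [n hn] := Ploc b.
  by apply: sub_finite_set (gcoef_finite (P n) b) => a [ab]; rewrite hn.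
pose G := GPuiseux Gfin.
have h0 a : gcoef (1 - h) a <> 0 -> 0 <= a.
  rewrite gcoefD gcoefN gcoef1; case: eqP => [-> //|_]; rewrite add0r.
  move=> /eqP; rewrite oppr_eq0 => /eqP /hm; exact/le_trans/ltW.
exists G; apply: gcoef_inj => c.
have [n hn] := Ploc c.
pose n' := maxn n (N c).
have {}hn a : a <= c -> gcoef G a = gcoef (P (maxn n (N c))) a.
  have [n0 hn0] := Ploc c; move=> ac /=.
  have hN' k : (N c <= k)%N -> gcoef (h ^+ k) a = 0.
    move=> Nn; apply: contrapT => /(gp_lowerX hm); rewrite leNgt.
    by rewrite (le_lt_trans ac)// hN.
  have PE' k : (N c <= k)%N -> gcoef (P k) a = gcoef (P (N c)) a.
    elim: k => [|k IH]; first by rewrite leqn0 => /eqP <-.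
    rewrite leq_eqVlt => /orP[/eqP -> //|]; rewrite ltnS => Nn.
    by rewrite /P big_ord_recr gcoefD -/(P k) IH// hN'// addr0.
  rewrite -(PE (N a) (maxn (N a) (N c)))// ?leq_maxl//.
  by rewrite PE' ?leq_maxr// PE'// leq_maxr.
have -> : gcoef (G * (1 - h)) c = gcoef (P n' * (1 - h)) c.
  rewrite !gcoefM gp_convC [RHS]gp_convC; apply: eq_fsbigr => a _.
  have [->|/eqP /h0 a0] := eqVneq (gcoef (1 - h) a) 0; first by rewrite !mul0r.
  by rewrite hn// gerBl.
have -> : P n' * (1 - h) = 1 - h ^+ n'.
  by rewrite mulrC -[RHS]opprB subrX1 -mulNr opprB.
rewrite gcoefD gcoefN.
have [->|/eqP] := eqVneq (gcoef (h ^+ n') c) 0; first by rewrite oppr0 addr0.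
by move=> /(gp_lowerX hm); rewrite leNgt hN// leq_maxr.
Qed.

Lemma gp_inv_exists f : f != 0 -> exists g, g * f = 1.
Proof.
move=> f0; have [a0 fa0] : exists a, gcoef f a <> 0.
  apply: contrapT => /forallNP H; move/eqP: f0; apply.
  by apply: gcoef_inj => a; rewrite gcoef0; by apply: contrapT; exact: H.
have [v fv vmin] := gp_lead_exists fa0.
pose u := gp_mono (gcoef f v)^-1 (- v).
pose h := 1 - u * f.
have uf0 : gcoef (u * f) 0 = 1.
  by rewrite gcoefM gp_conv_mono sub0r opprK mulVf//; exact/eqP.
have [m m0 hm] : exists2 m : R, 0 < m & forall a, gcoef h a <> 0 -> m <= a.
  have [[b hb]|H] := pselect (exists a, gcoef h a <> 0); last first.
    by exists 1 => // a ha; exfalso; apply: H; exists a.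
  have [m hm mmin] := gp_lead_exists hb; exists m => //.
  rewrite lt_neqAle; apply/andP; split.
    apply/eqP => e; move: hm.
    by rewrite -e gcoefD gcoefN uf0 gcoef1 eqxx subrr.
  apply: contrapT => /negP; rewrite -ltNge => mlt0; apply: hm.
  rewrite gcoefD gcoefN gcoef1 lt_eqF// add0r gcoefM gp_conv_mono opprK.
  have [->|/eqP/vmin] := eqVneq (gcoef f (m + v)) 0; first by rewrite mulr0 oppr0.
  by rewrite lerDr leNgt mlt0.
have [g gh] := gp_inv_geometric m0 hm.
by exists (g * u); rewrite -mulrA -gh /h opprB subrKC.
Qed.

Definition gp_inv f : gpuiseux R :=
  if pselect (f != 0) is left f0 then sval (cid (gp_inv_exists f0)) else 0.

Fact gp_mulV f : f != 0 -> gp_inv f * f = 1.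
Proof. by rewrite /gp_inv; case: pselect => // f0 _; case: cid. Qed.

Fact gp_inv0 : gp_inv 0 = 0.
Proof. by rewrite /gp_inv; case: pselect => // h; exfalso; rewrite eqxx in h. Qed.

HB.instance Definition _ :=
  GRing.ComNzRing_isField.Build (gpuiseux R) gp_mulV gp_inv0.

End Ring.

(* The valuation is the least exponent (the infimum is attained on c <> 0). *)
Definition gp_val (R : realType) (c : gpuiseux R) : R :=
  inf [set a | gcoef c a <> 0].

Definition gp_lead (R : realType) (c : gpuiseux R) : R[i] := gcoef c (gp_val c).

(* The subfield C{{t}} of Puiseux series: exponents in (1/N)Z for some N > 0. *)
Definition is_puiseux (R : realType) (c : gpuiseux R) : Prop :=
  exists2 N : nat, (0 < N)%N &
    forall a, gcoef c a <> 0 -> exists k : int, a = k%:~R / N%:R.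

(** * Ideals *)

Definition irreducible_elt (A : idomainType) (a : A) : Prop :=
  [/\ a != 0, a \isn't a GRing.unit &
      forall b c, a = b * c -> b \is a GRing.unit \/ c \is a GRing.unit].

Section Ideals.
Variable A : comNzRingType.
Implicit Types I J P Q : set A.

(* The unit ideal is allowed. *)
Definition is_ideal J : Prop :=
  [/\ J 0, forall a b, J a -> J b -> J (a + b) & forall c a, J a -> J (c * a)].

Definition ideal_gen (S : set A) : set A := smallest is_ideal S.

Definition is_prime_ideal P : Prop :=
  [/\ is_ideal P, ~ P 1 & forall a b, P (a * b) -> P a \/ P b].

(* J is the contraction of an ideal of the localization of A at P. *)
Definition saturated P J : Prop := forall s a, ~ P s -> J (s * a) -> J a.

(* The length of the ring A_P / Q A_P as a module over A_P: the supremum of the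
   lengths m of the strict chains J_0 < ... < J_m of ideals of A_P containing
   Q A_P, which are in order-preserving bijection with the saturated ideals of
   A containing Q. *)
Definition local_length (R : realType) P Q : \bar R :=
  ereal_sup [set m%:R%:E | m in [set m : nat |
    exists J : nat -> set A,
      (forall i, (i <= m)%N -> [/\ is_ideal (J i), Q `<=` J i & saturated P (J i)])
      /\ forall i, (i < m)%N -> J i `<` J i.+1]].

End Ideals.

(** * Tropicalization, with the max-convention *)

Section Tropical.
Variables (R : realType) (n : nat).
Let K := gpuiseux R.
Let k := R[i].
Implicit Types (I : set {mpoly K[n]}) (w : 'rV[R]_n) (f : {mpoly K[n]}).
Implicit Types (C : set 'rV[R]_n).

Definition Trop I : set 'rV[R]_n := [set w | exists p : 'I_n -> K,
  [/\ forall i, p i != 0, forall f, I f -> f.@[p] = 0 &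
      w = \row_i - gp_val (p i)]].

Definition trop_term w f (u : 'X_{1..n}) : R :=
  \sum_i w 0 i *+ u i - gp_val f@_u.

(* The initial form collects the terms c_u x^u of f for which
   <w, u> - val(c_u) is maximal; the residue of t^(- val(c_u)) c_u is the
   leading coefficient of c_u. *)
Definition init_form w f : {mpoly k[n]} :=
  \sum_(u <- msupp f | all (fun v => trop_term w f v <= trop_term w f u) (msupp f))
    gp_lead f@_u *: 'X_[u].

Definition init_ideal w I : set {mpoly k[n]} :=
  ideal_gen [set init_form w f | f in I].

(* Primes without variables correspond to the primes of the ring of Laurent
   polynomials, and localizing at them does not see the monomials; so these are
   the minimal primes of the initial ideal in the Laurent polynomial ring. *)
Definition torus_prime (P : set {mpoly k[n]}) : Prop :=
  is_prime_ideal P /\ forall i, ~ P 'X_i.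

Definition torus_minimal_prime (Q P : set {mpoly k[n]}) : Prop :=
  [/\ torus_prime P, Q `<=` P &
      forall P', torus_prime P' -> Q `<=` P' -> P' `<=` P -> P' = P].

(* The tropical multiplicity at w: the number of components of the initial
   degeneration at w in the torus, counted with multiplicity. *)
Definition trop_mult I w : \bar R :=
  \esum_(P in torus_minimal_prime (init_ideal w I))
    local_length R P (init_ideal w I).

(* Near w, the set C is a straight line. *)
Definition locally_line C w : Prop := exists2 v : 'rV[R]_n, v != 0 &
  \forall u \near w, C u <-> exists s : R, u = w + s *: v.

(* For a tropical curve C: the vertices of its coarsest polyhedral structure;
   all other points are in the relative interior of an edge. *)
Definition vertices C : set 'rV[R]_n := [set w | C w /\ ~ locally_line C w].

(* Trop(I) = Trop(J) as weighted tropical curves. *)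
Definition same_weighted_curve (I J : set {mpoly K[n]}) : Prop :=
  Trop I = Trop J /\
  forall w, Trop I w -> locally_line (Trop I) w -> trop_mult I w = trop_mult J w.

(* For a connected subset D of a line this is the usual notion. *)
Definition endpoint (D : set 'rV[R]_n) w : Prop :=
  D w /\ forall a b : 'rV[R]_n, D a -> D b -> a != b ->
    ~ exists2 s : R, 0 < s < 1 & w = (1 - s) *: a + s *: b.

End Tropical.

(** * Linear re-embeddings *)

Section Reembedding.
Variable R : realType.
Let K := gpuiseux R.

(* Coordinates of the plane, and coordinates X, Y, Z of 3-space. *)
Definition i0 : 'I_2 := @Ordinal 2 0 isT.
Definition i1 : 'I_2 := @Ordinal 2 1 isT.
Definition iX : 'I_3 := @Ordinal 3 0 isT.
Definition iY : 'I_3 := @Ordinal 3 1 isT.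
Definition iZ : 'I_3 := @Ordinal 3 2 isT.

(* The polynomial g defines a curve in (K^* )^2: for an irreducible g, this
   means that g vanishes at some point of the torus. *)
Definition torus_curve (g : {mpoly K[2]}) : Prop :=
  exists p : 'I_2 -> K, (forall i, p i != 0) /\ g.@[p] = 0.

(* z t^(-l) *)
Definition shift_term (l : rat) (z : K) : K := z * gp_mono 1 (- ratr l).

(* In the result, the variables 0 and 1 are z and y. *)
Definition tilde (l : rat) (z : K) (g : {mpoly K[2]}) : {mpoly K[2]} :=
  g \mPo [tuple 'X_i0 - (shift_term l z)%:MP; 'X_i1].

(* The ideal < g, z - (x + zeta t^(-l)) > of K[x, y, z]. *)
Definition reembedding (l : rat) (z : K) (g : {mpoly K[2]}) : set {mpoly K[3]} :=
  ideal_gen [set g \mPo [tuple 'X_iX; 'X_iY];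
                 'X_iZ - ('X_iX + (shift_term l z)%:MP)].

Definition principal (g : {mpoly K[2]}) : set {mpoly K[2]} := ideal_gen [set g].

Definition projXY (w : 'rV[R]_3) : 'rV[R]_2 :=
  \row_i (if i == i0 then w 0 iX else w 0 iY).
Definition projZY (w : 'rV[R]_3) : 'rV[R]_2 :=
  \row_i (if i == i0 then w 0 iZ else w 0 iY).

Definition modification (l : R) : set 'rV[R]_3 :=
  [set w | [\/ w 0 iX <= l /\ w 0 iZ = l,
               l <= w 0 iX /\ w 0 iZ = w 0 iX
             | w 0 iX = l /\ w 0 iZ <= l]].

Definition lineXZ (l : R) : set 'rV[R]_3 := [set w | w 0 iX = l /\ w 0 iZ = l].

(* (C x R) /\ (R x C') /\ {X = Z = l} for C in the (X,Y)-plane and C' in the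
   (Z,Y)-plane. *)
Definition line_trace (C C' : set 'rV[R]_2) (l : R) : set 'rV[R]_3 :=
  projXY @^-1` C `&` projZY @^-1` C' `&` lineXZ l.

(* The endpoints of the components of the trace, for the polyhedral structure
   that it inherits from C and C': the topological components are cut at the
   points lying over a vertex of C or C'. Without the cuts the vertices of the
   re-embedded curve would be missed, for instance, for l = 0, zeta = 1 and
   g = (x - 2)(y - 1) + t: both plane curves are the cross XY = 0, so the trace
   is the whole line, but the origin is a vertex of valency five. *)
Definition trace_endpoints (C C' : set 'rV[R]_2) (l : R) : set 'rV[R]_3 :=
  let S := line_trace C C' l in
  [set w | S w /\ [\/ endpoint (connected_component S w) w,
                      vertices C (projXY w) | vertices C' (projZY w)]].

End Reembedding.

(* Main.v *)
Require Import Defs.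
From HB Require Import structures.
From mathcomp Require Import all_boot all_order all_algebra.
From mathcomp Require Import complex mpoly.
From mathcomp Require Import all_classical all_reals all_analysis.
From mathcomp Require Import ring lra zify.

Set Implicit Arguments.
Unset Strict Implicit.
Unset Printing Implicit Defensive.

Import Order.TTheory GRing.Theory Num.Theory.
Import numFieldNormedType.Exports.

Local Open Scope classical_set_scope.
Local Open Scope ring_scope.

(* Away from the line X = Z = l the re-embedded curve is the graph of a tropical
   function over Trop(g) or over Trop(tilde g), and the initial ideals correspond
   accordingly. At a point of the line near which Trop(g), say, is not a vertical
   line, lifting a suitable root of the initial form gives a zero (x, y) of g for
   which the leading terms of x and zeta t^(-l) do not cancel; so the point lies
   on the re-embedded curve, and it is a vertex.
   Where both plane curves are vertical, in_w(g) is a monomial times a polynomial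
   h(x): the multiplicity of the re-embedded curve is deg h minus the
   multiplicity of the root -zeta of h, and the latter is the lowest exponent of
   z in in_w(tilde g). The multiplicities of Trop(tilde g) determine this
   exponent: along a generic horizontal line the slope of the tropical polynomial
   of tilde g is 0 near -oo, as z does not divide tilde g, and its jumps are given
   by the multiplicities. *)

(** * Valuation bounds, completeness and Hensel lifting of simple roots *)

Section GeneralizedPuiseux.
Variable R : realType.
Local Notation K := (gpuiseux R).
Implicit Types (f g x y : K) (a b m n : R).

(** That the two plane curves determine the third one is proved by comparing data (g1, zeta1) and
    (g2, zeta2) with equal plane curves, so every invariant has to be read off from supports and
    multiplicities. The obstacle is that the multiplicity of Trop(tilde g) at a vertical point is
    only the difference of the extreme exponents of z in its initial form, whereas the lowest
    exponent counts the lost root -zeta; hence the global argument along a horizontal line. At a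
    generic height this line meets the curves only inside non-horizontal edges, where the slope
    jumps by the multiplicity times the first coordinate of the primitive direction of the dual
    Newton segment. Multiplicities are lengths at minimal primes. They are computed only for initial
    forms supported on a segment, which split into binomials; away from the line X = Z = l they are
    merely transported along surjections of polynomial rings. Of the algebraic closedness of K only
    one consequence enters: a root of a residue polynomial lifts to a root. *)

Definition vge m f := forall a, gcoef f a <> 0 -> m <= a.

Lemma vge_coef0 m f a : vge m f -> a < m -> gcoef f a = 0.
Proof. by move=> fm am; apply: contrapT => /fm; rewrite leNgt am. Qed.

Lemma vgeP m f : (forall a, a < m -> gcoef f a = 0) -> vge m f.
Proof. by move=> h a fa; rewrite leNgt; apply/negP => /h. Qed.

Lemma vgeW m n f : n <= m -> vge m f -> vge n f.
Proof. by move=> nm fm a /fm; exact: le_trans. Qed.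

Lemma vge0 m : vge m 0.
Proof. by move=> a; rewrite gcoef0. Qed.

Lemma vgeD m f g : vge m f -> vge m g -> vge m (f + g).
Proof.
by move=> fm gm; apply: vgeP => a am; rewrite gcoefD !(@vge_coef0 m)// addr0.
Qed.

Lemma vgeN m f : vge m f -> vge m (- f).
Proof.
by move=> fm; apply: vgeP => a am; rewrite gcoefN (@vge_coef0 m)// oppr0.
Qed.

Lemma vgeB m f g : vge m f -> vge m g -> vge m (f - g).
Proof. by move=> fm /vgeN; exact: vgeD. Qed.

Lemma vgeM m n f g : vge m f -> vge n g -> vge (m + n) (f * g).
Proof. by move=> fm gn a; exact: gp_conv_lower. Qed.

Lemma vge_sum m (I : Type) (r : seq I) (P : pred I) (F : I -> K) :
  (forall i, P i -> vge m (F i)) -> vge m (\sum_(i <- r | P i) F i).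
Proof. move=> h; elim/big_ind: _ => [|f g|i]; [exact: vge0|exact: vgeD|exact: h]. Qed.

Lemma vgeMn m f k : vge m f -> vge m (f *+ k).
Proof.
by move=> fm; elim: k => [|k IH]; rewrite ?mulr0n ?mulrS; [exact: vge0|exact: vgeD].
Qed.

Lemma vge1 : vge 0 (1 : K).
Proof. by move=> a; rewrite gcoef1; case: eqP => // ->. Qed.

Lemma vge_mono (c : R[i]) a : vge a (gp_mono c a).
Proof. by move=> b /=; case: eqP => // ->. Qed.

Lemma gcoefMn f k a : gcoef (f *+ k) a = gcoef f a *+ k.
Proof. by elim: k => [|k IH]; [rewrite !mulr0n|rewrite !mulrS gcoefD IH]. Qed.

Lemma gcoef_sum (I : Type) (r : seq I) (P : pred I) (F : I -> K) a :
  gcoef (\sum_(i <- r | P i) F i) a = \sum_(i <- r | P i) gcoef (F i) a.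
Proof. by elim/big_rec2: _ => [//|i y1 y2 _ <-]; rewrite gcoefD. Qed.

(** Exponents a >= m and b >= n with a + b = m + n are a = m and b = n, so one term of the
    convolution survives. *)
Lemma gcoefM_min m n f g : vge m f -> vge n g ->
  gcoef (f * g) (m + n) = gcoef f m * gcoef g n.
Proof.
move=> fm gn; rewrite gcoefM (@gp_convE _ _ _ _ [:: m])//; last first.
  move=> a /fm ma /gn; rewrite inE eq_le ma andbT.
  by rewrite lerBrDr addrC lerD2r.
by rewrite big_seq1 addrAC subrr add0r.
Qed.

Lemma gcoef_mono_mul (c : R[i]) v f a :
  gcoef (gp_mono c v * f) a = c * gcoef f (a - v).
Proof. exact: gp_conv_mono. Qed.

Lemma gp_monoM (c d : R[i]) a b :
  gp_mono c a * gp_mono d b = gp_mono (c * d) (a + b).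
Proof.
apply: gcoef_inj => e; rewrite gcoef_mono_mul /= subr_eq addrC.
by case: eqP => // _; rewrite mulr0.
Qed.

Lemma gp_mono10 : gp_mono 1 0 = 1 :> K. Proof. by []. Qed.

Lemma gp_mono_neq0 (c : R[i]) a : c != 0 -> gp_mono c a != 0.
Proof.
by move=> c0; apply/eqP => /(congr1 (fun f => gcoef f a)) /=; rewrite eqxx;
  exact/eqP.
Qed.

(** At 0 the valuation is the infimum of the empty set, a default value. Bounds are therefore stated
    with [vge], which 0 satisfies for every m. *)
Lemma gp_val_spec f : f != 0 -> gcoef f (gp_val f) <> 0 /\ vge (gp_val f) f.
Proof.
move=> f0; have [a0 fa0] : exists a, gcoef f a <> 0.
  apply: contrapT => /forallNP H; move/eqP: f0; apply.
  by apply: gcoef_inj => a; rewrite gcoef0; apply: contrapT; exact: H.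
have [v fv vmin] := gp_lead_exists fa0.
suff -> : gp_val f = v by [].
apply/eqP; rewrite eq_le; apply/andP; split.
  by apply: ge_inf => //; exists v => a; exact: vmin.
by apply: lb_le_inf => [|a]; [exists v|exact: vmin].
Qed.

Lemma gp_val_eq f v : gcoef f v <> 0 -> vge v f -> gp_val f = v.
Proof.
move=> fv vf; have f0 : f != 0 by apply: contra_notN fv => /eqP ->.
have [h1 h2] := gp_val_spec f0.
by apply/eqP; rewrite eq_le (h2 _ fv) (vf _ h1).
Qed.

Lemma gp_lead_neq0 f : f != 0 -> gp_lead f != 0.
Proof. by move=> /gp_val_spec[/eqP]. Qed.

Lemma gp_val_mono (c : R[i]) a : c != 0 -> gp_val (gp_mono c a) = a.
Proof.
by move=> c0; apply: gp_val_eq; [rewrite /= eqxx; exact/eqP|exact: vge_mono].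
Qed.

Lemma gp_lead_mono (c : R[i]) a : c != 0 -> gp_lead (gp_mono c a) = c.
Proof. by move=> c0; rewrite /gp_lead gp_val_mono//= eqxx. Qed.

Lemma gp_valM f g : f != 0 -> g != 0 -> gp_val (f * g) = gp_val f + gp_val g.
Proof.
move=> /gp_val_spec[f1 f2] /gp_val_spec[g1 g2]; apply: gp_val_eq.
  by rewrite gcoefM_min//; apply/eqP; rewrite mulf_neq0//; exact/eqP.
exact: vgeM.
Qed.

Lemma gp_leadM f g : f != 0 -> g != 0 -> gp_lead (f * g) = gp_lead f * gp_lead g.
Proof.
move=> f0 g0; rewrite /gp_lead gp_valM// gcoefM_min//.
  by case: (gp_val_spec f0).
by case: (gp_val_spec g0).
Qed.

Lemma gp_valN f : gp_val (- f) = gp_val f.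
Proof.
rewrite /gp_val; congr inf; apply: eq_set => a; rewrite gcoefN.
apply/propext; split=> h e; apply: h; first by rewrite e oppr0.
by move/eqP: e; rewrite oppr_eq0 => /eqP.
Qed.

Lemma gp_leadN f : gp_lead (- f) = - gp_lead f.
Proof. by rewrite /gp_lead gp_valN gcoefN. Qed.

Lemma vge_unitV f : vge 0 f -> gcoef f 0 <> 0 ->
  vge 0 f^-1 /\ gcoef f^-1 0 = (gcoef f 0)^-1.
Proof.
move=> f1 f2; have f0 : f != 0 by apply: contra_notN f2 => /eqP ->.
have fv : gp_val f = 0 by exact: gp_val_eq.
have fi : f^-1 != 0 by rewrite invr_eq0.
have iv : gp_val f^-1 = 0.
  have := gp_valM f0 fi; rewrite divff// fv add0r => <-.
  by apply: gp_val_eq; [rewrite gcoef1 eqxx; apply/eqP; rewrite oner_eq0|exact: vge1].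
have [h1 h2] := gp_val_spec fi; rewrite iv in h1 h2; split=> //.
have := gcoefM_min f1 h2; rewrite divff// addr0 gcoef1 eqxx.
move=> e; apply: (mulfI (x := gcoef f 0)); first exact/eqP.
by rewrite -e divff//; apply/eqP.
Qed.

Definition vpos f := forall a, gcoef f a <> 0 -> 0 < a.

Lemma vposE f : vpos f <-> vge 0 f /\ gcoef f 0 = 0.
Proof.
split=> [h|[h1 h2] a fa].
  split; first by move=> a /h /ltW.
  by apply: contrapT => /h; rewrite ltxx.
by rewrite lt_neqAle h1// andbT; apply/eqP => e; rewrite -e in fa.
Qed.

(** The support has a least element, so positivity of all exponents gives a uniform gap d; this is
    the contraction rate of the Newton iteration. *)
Lemma vpos_vge f : vpos f -> exists2 d, 0 < d & vge d f.
Proof.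
move=> fp; have [->|f0] := eqVneq f 0; first by exists 1 => //; exact: vge0.
by have [/fp h1 h2] := gp_val_spec f0; exists (gp_val f).
Qed.

(** The coefficient at exponent a no longer changes from stage [N a] on, and the limit takes it
    there. Up to a bound b the limit agrees with [u (N b)], which makes its support left-finite. *)
Lemma gp_complete (u : nat -> K) d : 0 < d ->
  (forall k, vge (d *+ k) (u k.+1 - u k)) ->
  exists x, forall k, vge (d *+ k) (x - u k).
Proof.
move=> d0 hu; pose N a := (Num.truncn (`|a| / d)).+1.
have hN a : a < d *+ N a.
  rewrite -mulr_natr mulrC -ltr_pdivrMr//.
  apply: le_lt_trans (_ : `|a| / d < _); last exact: truncnS_gt.
  by rewrite ler_pM2r ?invr_gt0// ler_norm.
have st a k k' : a < d *+ k -> (k <= k')%N -> gcoef (u k') a = gcoef (u k) a.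
  move=> ak; elim: k' => [|k' IH]; first by rewrite leqn0 => /eqP ->.
  rewrite leq_eqVlt => /orP[/eqP -> //|]; rewrite ltnS => kk'.
  have := vge_coef0 (hu k') (lt_le_trans ak (ler_wpMn2l (ltW d0) kk')).
  by rewrite gcoefD gcoefN => /eqP; rewrite subr_eq0 => /eqP ->; exact: IH.
have st2 a k : a < d *+ k -> gcoef (u (N a)) a = gcoef (u k) a.
  move=> ak; rewrite -(st a (N a) (maxn (N a) k))// ?leq_maxl//.
  by rewrite (st a k)// leq_maxr.
have fin : left_finite (fun a => gcoef (u (N a)) a).
  move=> b; apply: sub_finite_set (gcoef_finite (u (N b)) b) => a [ab].
  by rewrite (st2 a (N b)) ?(le_lt_trans ab)//.
exists (GPuiseux fin) => k; apply: vgeP => a ak.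
by rewrite gcoefD gcoefN/= (st2 a k)// subrr.
Qed.

Local Notation intp p := (forall i : nat, vge 0 (p : {poly K})`_i).

Lemma intp_horner (p : {poly K}) x : intp p -> vge 0 x -> vge 0 p.[x].
Proof.
move=> hp hx; rewrite horner_coef; apply: vge_sum => i _.
rewrite -[0]addr0; apply: vgeM => //.
elim: (nat_of_ord i) => [|j IH]; first by rewrite expr0; exact: vge1.
by rewrite exprS -[0]addr0; exact: vgeM.
Qed.

(** Divided differences of an integral polynomial are integral; they replace the derivative in the
    contraction estimate. *)
Lemma intp_diff (p : {poly K}) x y : intp p -> vge 0 x -> vge 0 y ->
  exists2 s, vge 0 s & p.[x] - p.[y] = (x - y) * s.
Proof.
move=> + hx hy; elim/poly_ind: p => [|p c IH] hp.
  by exists 0; [exact: vge0|rewrite !horner0 subrr mulr0].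
have hp' : intp p.
  by move=> i; have := hp i.+1; rewrite coefD coefMX coefC/= addr0.
have [s hs e] := IH hp'.
exists (s * x + p.[y]).
  by apply: vgeD; [rewrite -[0]addr0; exact: vgeM|exact: intp_horner].
by rewrite !hornerMXaddC mulrDr mulrA -e; ring.
Qed.

(* Newton iteration with a frozen derivative contracts by the factor [t^d]. *)
Lemma hensel_simple (p : {poly K}) : intp p ->
  gcoef p`_0 0 = 0 -> gcoef p`_1 0 <> 0 -> exists2 x, vpos x & root p x.
Proof.
move=> hp p0 p1.
pose q := drop_poly 2 p.
have pE z : p.[z] = p`_0 + p`_1 * z + q.[z] * z ^+ 2.
  rewrite -[in LHS](poly_take_drop 2 p) hornerD hornerM hornerXn; congr (_ + _).
  rewrite (@horner_coef_wide _ 2); last exact: size_take_poly.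
  by rewrite !big_ord_recl big_ord0 !coef_take_poly/= expr0 expr1 mulr1 addr0.
have hq : intp q by move=> i; rewrite coef_drop_poly.
have [u1 u2] := vge_unitV (hp 1) p1.
have p1n : p`_1 != 0 by apply: contra_notN p1 => /eqP ->.
have [d d0 hd] : exists2 d, 0 < d & vge d p`_0.
  by apply: vpos_vge; apply/vposE; split.
pose F z := z - p.[z] / p`_1.
have FE z : F z = - (p`_0 + q.[z] * z ^+ 2) / p`_1.
  rewrite /F pE; apply: (mulIf p1n); rewrite mulfVK// mulrBl mulfVK//; ring.
have dge z : vge d z -> vge 0 z by apply: vgeW; exact: ltW.
have Fd z : vge d z -> vge d (F z).
  move=> hz; rewrite FE -[d]addr0; apply: vgeM => //; apply: vgeN; apply: vgeD => //.
  rewrite -[d]add0r; apply: vgeM; first by apply: intp_horner => //; exact: dge.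
  by rewrite expr2 -[d]addr0; apply: vgeM => //; exact: dge.
have Fc z z' m : vge d z -> vge d z' -> vge m (z - z') -> vge (d + m) (F z - F z').
  move=> hz hz' hzz'.
  have [s hs se] := intp_diff hq (dge _ hz) (dge _ hz').
  (* Besides z - z', each summand keeps a factor z or z + z' of valuation at least d: this is the
     gain d. *)
  have -> : F z - F z' =
      (z * (- (s * z) / p`_1) + (z + z') * (- q.[z'] / p`_1)) * (z - z').
    rewrite !FE.
    have -> : q.[z] = q.[z'] + (z - z') * s by rewrite -se; ring.
    ring.
  apply: vgeM => //; apply: vgeD; rewrite -[d]addr0; apply: vgeM => //.
  - rewrite -[0]addr0; apply: vgeM => //; apply: vgeN.
    by rewrite -[0]addr0; apply: vgeM => //; exact: dge.
  - exact: vgeD.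
  - rewrite -[0]addr0; apply: vgeM => //; apply: vgeN.
    by apply: intp_horner => //; exact: dge.
pose u k := iter k F 0.
have ud k : vge d (u k) by elim: k => [|k IH]; [exact: vge0|exact: Fd].
have [|x hx] := @gp_complete u d d0.
  elim=> [|k IH].
    by rewrite mulr0n; exact: vgeB (dge _ (ud 1%N)) (dge _ (ud 0%N)).
  by rewrite mulrS; apply: Fc => //; exact: (ud k.+1).
have xd : vge d x.
  have := hx 1%N; rewrite mulr1n => h.
  by rewrite -(subrK (u 1%N) x); apply: vgeD.
exists x; first by move=> a /xd; exact: lt_le_trans.
(* [F x - F (u k)] and [x - u k.+1] both have valuation at least d k, for every k. *)
have Fx : F x = x.
  apply/eqP; rewrite -subr_eq0; apply/eqP; apply: gcoef_inj => a; rewrite gcoef0.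
  pose k := (Num.truncn (`|a| / d)).+1.
  have ak : a < d *+ k.
    rewrite -mulr_natr mulrC -ltr_pdivrMr//.
    apply: le_lt_trans (_ : `|a| / d < _); last exact: truncnS_gt.
    by rewrite ler_pM2r ?invr_gt0// ler_norm.
  apply: (@vge_coef0 (d *+ k)) => //.
  have -> : F x - x = (F x - F (u k)) - (x - u k.+1) by rewrite /=; ring.
  apply: vgeB.
    by apply: (@vgeW (d + d *+ k)); [rewrite lerDr ltW|exact: Fc].
  by apply: vgeW (hx k.+1); rewrite [leRHS]mulrS lerDr ltW.
apply/rootP; move/eqP: Fx; rewrite /F subr_eq addrC -subr_eq subrr eq_sym.
by rewrite mulf_eq0 invr_eq0 (negPf p1n) orbF => /eqP.
Qed.

End GeneralizedPuiseux.

(** * Lifting roots of residue polynomials by a Newton-Puiseux argument *)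

Section ResidueRoots.
Variable R : realType.
Local Notation K := (gpuiseux R).
Local Notation k := R[i].
Implicit Types (p q : {poly K}) (x : K).

(** Taylor's formula, with derivatives divided by factorials, so that it holds over any commutative
    ring. *)
Lemma coef_shift (A : comNzRingType) (f : {poly A}) (a : A) i :
  (f \Po ('X + a%:P))`_i = f^`N(i).[a].
Proof.
have -> : f \Po ('X + a%:P) = \sum_(j < size f) (f^`N(j).[a]) *: 'X^j.
  rewrite /comp_poly addrC nderiv_taylor; last exact: mulrC.
  rewrite size_map_polyC; apply: eq_bigr => j _.
  by rewrite nderivn_map horner_map mul_polyC.
rewrite coef_sum; under eq_bigr do rewrite coefZ coefXn.
have [isz|szi] := ltnP i (size f).
  rewrite (bigD1 (Ordinal isz))//= eqxx mulr1 big1 ?addr0// => j ji.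
  by move: ji; rewrite -val_eqE /= eq_sym => /negPf ->; rewrite mulr0.
rewrite big1 ?nderivn_poly0 ?horner0// => j _.
by rewrite gtn_eqF ?mulr0// (leq_trans (ltn_ord j)).
Qed.

Definition intp p := forall i : nat, vge 0 p`_i.

(** For integral p, the reduction modulo the maximal ideal of the valuation ring. The leading
    coefficient may reduce to 0, so the degree can drop. *)
Definition resp p : {poly k} := \poly_(i < size p) gcoef p`_i 0.

Lemma coef_resp p i : (resp p)`_i = gcoef p`_i 0.
Proof. by rewrite coef_poly; case: ltnP => // h; rewrite nth_default. Qed.

Lemma intpD p q : intp p -> intp q -> intp (p + q).
Proof. by move=> hp hq i; rewrite coefD; exact: vgeD. Qed.

Lemma intpM p q : intp p -> intp q -> intp (p * q).
Proof.
by move=> hp hq i; rewrite coefM; apply: vge_sum => j _; rewrite -[0]addr0;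
  exact: vgeM.
Qed.

Lemma intpC x : vge 0 x -> intp x%:P.
Proof. by move=> hx i; rewrite coefC; case: eqP => // _; exact: vge0. Qed.

Lemma intpX : intp 'X.
Proof. by move=> i; rewrite coefX; case: eqP => _; [exact: vge1|exact: vge0]. Qed.

Lemma respD p q : resp (p + q) = resp p + resp q.
Proof. by apply/polyP => i; rewrite coefD !coef_resp coefD gcoefD. Qed.

Lemma respM p q : intp p -> intp q -> resp (p * q) = resp p * resp q.
Proof.
move=> hp hq; apply/polyP => i; rewrite coef_resp !coefM gcoef_sum.
apply: eq_bigr => j _; rewrite !coef_resp -[in LHS](addr0 (0 : R)).
by rewrite (gcoefM_min (hp _) (hq _)).
Qed.

Lemma respC x : resp x%:P = (gcoef x 0)%:P.
Proof. by apply/polyP => i; rewrite coef_resp !coefC; case: eqP. Qed.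

Lemma respX : resp 'X = 'X.
Proof. by apply/polyP => i; rewrite coef_resp !coefX; case: eqP => //= _; rewrite eqxx. Qed.

Lemma intp_comp p q : intp p -> intp q -> intp (p \Po q).
Proof.
move=> + hq; elim/poly_ind: p => [|p c IH] hp.
  by rewrite comp_poly0 => i; rewrite coef0; exact: vge0.
have hc : vge 0 c by have := hp 0%N; rewrite coefD coefMX coefC/= add0r.
have hp' : intp p by move=> i; have := hp i.+1; rewrite coefD coefMX coefC/= addr0.
rewrite comp_polyD comp_polyM comp_polyX comp_polyC.
by apply: intpD; [apply: intpM => //; exact: IH|exact: intpC].
Qed.

Lemma resp_comp p q : intp p -> intp q -> resp (p \Po q) = resp p \Po resp q.
Proof.
move=> + hq; elim/poly_ind: p => [|p c IH] hp.
  by rewrite comp_poly0 respC gcoef0 comp_poly0.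
have hp' : intp p by move=> i; have := hp i.+1; rewrite coefD coefMX coefC/= addr0.
rewrite comp_polyD comp_polyM comp_polyX comp_polyC !respD respC.
rewrite (respM _ hq); last exact: intp_comp hp' hq.
by rewrite IH// (respM hp' intpX) respX comp_polyD comp_polyM comp_polyX comp_polyC.
Qed.

Lemma intp_shift x : vge 0 x -> intp ('X + x%:P).
Proof. by move=> hx; apply: intpD; [exact: intpX|exact: intpC]. Qed.

Lemma resp_shift p x : intp p -> vge 0 x ->
  resp (p \Po ('X + x%:P)) = resp p \Po ('X + (gcoef x 0)%:P).
Proof.
move=> hp hx; rewrite resp_comp//; last exact: intp_shift.
by rewrite respD respX respC.
Qed.

(* Subtracting a root of [p^`N(m-1)] kills the coefficient of degree [m-1];
   after rescaling, the residue polynomial has degree [m], is not a monomial and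
   has no term of degree [m-1], so all its roots have multiplicity < m. *)
Lemma lift_root0 m p : (0 < m)%N -> intp p ->
  (forall i, (i < m)%N -> gcoef p`_i 0 = 0) -> gcoef p`_m 0 <> 0 ->
  exists2 x, vpos x & root p x.
Proof.
elim/ltn_ind: m p => -[//|[|n]] IH p _ hp plt pm.
  by apply: hensel_simple => //; exact: plt.
set m := n.+2 in IH plt pm.
have k0 (c : k) j : (0 < j)%N -> c <> 0 -> c *+ j <> 0.
  by move=> j0 c0; apply/eqP; rewrite mulrn_eq0 -leqn0 leqNgt j0; exact/eqP.
(* The constant coefficient of this divided derivative is p_(m-1), with residue 0, and the linear
   one is m p_m, a unit in residue characteristic 0. *)
have [||| a apos /rootP aroot] := @hensel_simple _ p^`N(n.+1).
- by move=> i; rewrite coef_nderivn; apply: vgeMn.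
- by rewrite coef_nderivn addn0 gcoefMn plt ?mul0rn// /m.
- by rewrite coef_nderivn addn1 gcoefMn; apply: k0 => //; rewrite bin_gt0.
have [a0 ares] : vge 0 a /\ gcoef a 0 = 0 by apply/vposE.
set q := p \Po ('X + a%:P).
have hq : intp q by apply: intp_comp => //; exact: intp_shift.
have qres i : gcoef q`_i 0 = gcoef p`_i 0.
  by rewrite -!coef_resp resp_shift// ares polyC0 addr0 comp_polyXr.
have qm1 : q`_n.+1 = 0 by rewrite coef_shift.
have qroot y : root q y -> root p (y + a).
  by rewrite /root horner_comp !hornerE.
have [q0|q0] := eqVneq q`_0 0.
  exists (0 + a); first by rewrite add0r.
  by apply: qroot; rewrite /root horner_coef0 q0.
have q0' : q`_(@ord0 n.+1) != 0 by [].
(* The least slope s = val(q_i)/(m - i) is that of the edge of the Newton polygon of q ending at m.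
   Substituting t^s x and dividing by t^(ms) turns this edge into the residue polynomial [r]. *)
have [i0 qi0 i0min] := @arg_minP _ R 'I_m ord0 (fun i => q`_i != 0)
  (fun i => gp_val q`_i / (m - i)%:R) q0'.
set s := gp_val q`_i0 / (m - i0)%:R in i0min.
have mi (i : 'I_m) : 0 < (m - i)%:R :> R by rewrite ltr0n subn_gt0.
have spos : 0 < s.
  apply: divr_gt0 (mi _); have [h1 h2] := gp_val_spec qi0.
  rewrite lt_neqAle (hq _ _ h1) andbT; apply/eqP => e; apply: h1.
  by rewrite -e qres plt.
pose q' := \poly_(i < size q) (q`_i * gp_mono 1 ((i%:R - m%:R) * s)).
have q'E i : q'`_i = q`_i * gp_mono 1 ((i%:R - m%:R) * s).
  by rewrite coef_poly; case: ltnP => // h; rewrite nth_default// mul0r.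
have q'res i : gcoef q'`_i 0 = gcoef q`_i ((m%:R - i%:R) * s).
  by rewrite q'E mulrC gcoef_mono_mul mul1r sub0r -mulNr opprB.
have hq' : intp q'.
  move=> i; rewrite q'E; have [im|mi'] := ltnP i m.
    have [->|qi] := eqVneq q`_i 0; first by rewrite mul0r; exact: vge0.
    have [_ h2] := gp_val_spec qi.
    apply: (vgeW _ (vgeM h2 (@vge_mono R 1 _))).
    have := i0min (Ordinal im) qi; rewrite -/s/= ler_pdivlMr; last exact: (mi (Ordinal im)).
    by rewrite natrB 1?ltnW//; nra.
  apply: (vgeW _ (vgeM (hq _) (@vge_mono R 1 _))); rewrite add0r; apply: mulr_ge0; last exact: ltW.
  by rewrite subr_ge0 ler_nat.
set r := resp q'.
have rm : r`_m != 0.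
  by rewrite coef_resp q'res subrr mul0r qres; exact/eqP.
have rgt i : (m < i)%N -> r`_i = 0.
  move=> mi'; rewrite coef_resp q'res; apply: (vge_coef0 (hq _)).
  by rewrite nmulr_rlt0// subr_lt0 ltr_nat.
have rm1 : r`_n.+1 = 0 by rewrite coef_resp q'E qm1 mul0r gcoef0.
have ri0 : r`_i0 != 0.
  rewrite coef_resp q'res -natrB 1?ltnW// mulrC /s divfK; last by rewrite gt_eqF.
  by have [/eqP h _] := gp_val_spec qi0.
have szr : size r = m.+1.
  apply/eqP; rewrite eqn_leq; apply/andP; split.
    by apply/leq_sizeP => i; exact: rgt.
  by rewrite ltnNge; apply/negP => /leq_sizeP/(_ m (leqnn _)) rm0; rewrite rm0 eqxx in rm.
have /closed_rootP[e re] : size r != 1%N by rewrite szr.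
pose q2 := q' \Po ('X + (gp_mono e 0)%:P).
have hq2 : intp q2 by apply: intp_comp => //; apply: intp_shift; exact: vge_mono.
have q2res i : gcoef q2`_i 0 = r^`N(i).[e].
  rewrite -coef_resp resp_shift//; last exact: vge_mono.
  by rewrite -coef_shift /= eqxx.
have q2m : gcoef q2`_m 0 <> 0.
  rewrite q2res; apply/eqP.
  rewrite (@size1_polyC _ r^`N(m)).
    by rewrite hornerC coef_nderivn addn0 binn mulr1n.
  by apply/leq_sizeP => -[//|j] _; rewrite coef_nderivn rgt ?mul0rn// addnS ltnS leq_addr.
have [j q2j jmin] := @ex_minnP (fun j => gcoef q2`_j 0 != 0)
  (ex_intro _ m (introN eqP q2m)).
have jpos : (0 < j)%N.
  rewrite lt0n; apply: contraNN q2j => /eqP ->.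
  by rewrite q2res nderivn0; exact: re.
(* j is the multiplicity of the root e of [r]. If it were m, the vanishing coefficient of degree m-1
   would give e = 0 and make [r] a monomial, against its nonzero coefficient at i0 < m. *)
have jm : (j < m)%N.
  rewrite ltn_neqAle jmin ?andbT; last exact/eqP.
  apply/eqP => jm.
  have low i : (i < m)%N -> gcoef q2`_i 0 = 0.
    by move=> im; apply/eqP; apply: contraTT im => /jmin; rewrite jm -leqNgt.
  have := low n.+1 (ltnSn _); rewrite q2res.
  rewrite (@horner_coef_wide _ 2); last first.
    by apply/leq_sizeP => -[|[|i]]// _; rewrite coef_nderivn rgt ?mul0rn// !addnS !ltnS leq_addr.
  rewrite !big_ord_recl big_ord0 !coef_nderivn addn0 rm1 mul0rn mul0r add0r addr0 expr1.
  rewrite addn1 => /eqP; rewrite mulf_eq0 mulrn_eq0 (negPf rm) orbF.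
  rewrite -leqn0 leqNgt bin_gt0 leqnSn/= => /eqP e0.
  have := low i0 (ltn_ord _); rewrite q2res e0 horner_coef0 coef_nderivn addn0 binn mulr1n.
  by apply/eqP.
have [|x xpos xroot] := IH j jm q2 jpos hq2 _ (elimN eqP q2j).
  by move=> i ij; apply/eqP; apply: contraTT ij => /jmin; rewrite -leqNgt.
pose y := x + gp_mono e 0.
have yroot : root q' y by move: xroot; rewrite /root horner_comp !hornerE.
have yge : vge 0 y by apply: vgeD; [move=> b /xpos/ltW|exact: vge_mono].
exists (gp_mono 1 s * y + a).
  apply/vposE; split; first by apply: vgeD => //; apply: (vgeW _ (vgeM (@vge_mono R 1 _) yge)); rewrite addr0 ltW.
  rewrite gcoefD ares addr0 gcoef_mono_mul mul1r sub0r (vge_coef0 yge)//.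
  by rewrite oppr_lt0.
apply: qroot; move/rootP: yroot => yroot.
apply/rootP; rewrite horner_coef.
transitivity (gp_mono 1 (m%:R * s) * q'.[y]); last by rewrite yroot mulr0.
rewrite (@horner_coef_wide _ (size q)); last exact: size_poly.
rewrite mulr_sumr; apply: eq_bigr => i _; rewrite q'E exprMn.
have -> : gp_mono 1 s ^+ i = gp_mono 1 (i%:R * s) :> K.
  elim: (nat_of_ord i) => [|j' IH']; first by rewrite expr0 mul0r gp_mono10.
  by rewrite exprS IH' gp_monoM mul1r -[j'.+1]add1n natrD mulrDl mul1r.
have -> : gp_mono 1 (i%:R * s) = gp_mono 1 (m%:R * s) * gp_mono 1 ((i%:R - m%:R) * s) :> K.
  by rewrite gp_monoM mul1r; congr gp_mono; ring.
ring.
Qed.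

(** Translating e to 0 and taking for m its multiplicity as a residue root reduces to
    [lift_root0]. *)
Lemma lift_root p (e : k) : intp p -> resp p != 0 -> root (resp p) e ->
  exists x, [/\ vge 0 x, gcoef x 0 = e & root p x].
Proof.
move=> hp p0 pe.
have me : vge 0 (gp_mono e 0 : K) by exact: vge_mono.
pose q := p \Po ('X + (gp_mono e 0)%:P).
have hq : intp q by apply: intp_comp => //; exact: intp_shift.
have qE : resp q = resp p \Po ('X + e%:P) by rewrite resp_shift// /= eqxx.
have q0 : resp q != 0.
  by rewrite qE comp_poly2_eq0// size_XaddC.
have exj : exists j, gcoef q`_j 0 != 0.
  exists (size (resp q)).-1; rewrite -coef_resp -lead_coefE lead_coef_eq0.
  by apply: q0.
have [j qj jmin] := ex_minnP exj.
have jpos : (0 < j)%N.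
  rewrite lt0n; apply: contraNN qj => /eqP ->.
  rewrite -coef_resp qE -horner_coef0 horner_comp !hornerE.
  by move: pe; rewrite /root.
have [|x /vposE[x0 xr] xroot] := lift_root0 jpos hq _ (elimN eqP qj).
  by move=> i ij; apply/eqP; apply: contraTT ij => /jmin; rewrite -leqNgt.
exists (x + gp_mono e 0); split; first exact: vgeD.
  by rewrite gcoefD xr add0r /= eqxx.
by move: xroot; rewrite /root horner_comp !hornerE.
Qed.

End ResidueRoots.

(** * Weight filtrations, initial forms and their behaviour under substitution *)

Lemma mcoeff_sumX (n : nat) (A : nzRingType) (s : seq 'X_{1..n})
    (P : pred 'X_{1..n}) (c : 'X_{1..n} -> A) v : uniq s ->
  (\sum_(u <- s | P u) c u *: 'X_[u])@_v = if (v \in s) && P v then c v else 0.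
Proof.
move=> us; rewrite raddf_sum/= -big_filter.
under eq_bigr do rewrite mcoeffZ mcoeffX.
case: ifPn => [/andP[vs Pv]|vs].
  rewrite (bigD1_seq v) ?filter_uniq ?mem_filter ?Pv//= eqxx mulr1.
  by rewrite big1 ?addr0// => u /negPf ->; rewrite mulr0.
rewrite big_seq big1// => u; rewrite mem_filter => /andP[Pu uss].
by case: eqP => [e|_]; rewrite ?mulr0//; rewrite -e uss Pu in vs.
Qed.

Section Weights.
Variables (R : realType).
Local Notation K := (gpuiseux R).
Local Notation k := R[i].

Section Defs.
Variables (n : nat) (w : 'rV[R]_n).
Implicit Types (f g : {mpoly K[n]}) (u v : 'X_{1..n}) (M N : R).

Definition mwt u : R := \sum_i w 0 i *+ u i.

Lemma mwtD u v : mwt (u + v)%MM = mwt u + mwt v.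
Proof. by rewrite -big_split; apply: eq_bigr => i _; rewrite mnmDE mulrnDr. Qed.

(** The tropical polynomial of f is at most M at w. [wle] is a filtration and [wtop] its symbol map;
    both are compatible with sums and products for arbitrary bounds M, while initial forms require
    the bound to be attained. *)
Definition wle M f := forall u, vge (mwt u - M) f@_u.

Definition wtop M f : {mpoly k[n]} :=
  \sum_(u <- msupp f) gcoef f@_u (mwt u - M) *: 'X_[u].

Lemma mcoeff_wtop M f u : (wtop M f)@_u = gcoef f@_u (mwt u - M).
Proof.
rewrite mcoeff_sumX// andbT; case: ifPn => // uf.
by rewrite memN_msupp_eq0// gcoef0.
Qed.

Lemma wle0 M : wle M 0.
Proof. by move=> u; rewrite mcoeff0; exact: vge0. Qed.

Lemma wleD M f g : wle M f -> wle M g -> wle M (f + g).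
Proof. by move=> hf hg u; rewrite mcoeffD; exact: vgeD. Qed.

Lemma wtop0 M : wtop M 0 = 0.
Proof. by apply/mpolyP => u; rewrite mcoeff_wtop !mcoeff0 gcoef0. Qed.

Lemma wtopD M f g : wtop M (f + g) = wtop M f + wtop M g.
Proof. by apply/mpolyP => u; rewrite mcoeffD !mcoeff_wtop mcoeffD gcoefD. Qed.

Lemma wleM M N f g : wle M f -> wle N g -> wle (M + N) (f * g).
Proof.
move=> hf hg u; rewrite mcoeffM; apply: vge_sum => -[v1 v2] /= /eqP/(congr1 mwt).
rewrite mwtD => ->; by apply: (vgeW _ (vgeM (hf _) (hg _))); rewrite opprD addrACA.
Qed.

Lemma wtopM M N f g : wle M f -> wle N g ->
  wtop (M + N) (f * g) = wtop M f * wtop N g.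
Proof.
move=> hf hg; apply/mpolyP => u; rewrite mcoeff_wtop.
rewrite (mcoeff_poly_mul f g (ltnSn (mdeg u))).
rewrite (mcoeff_poly_mul (wtop M f) (wtop N g) (ltnSn (mdeg u))) gcoef_sum.
apply: eq_bigr => -[v1 v2] /= /eqP/(congr1 mwt); rewrite mwtD => ->.
by rewrite !mcoeff_wtop -(gcoefM_min (hf _) (hg _)) opprD addrACA.
Qed.

Lemma wleC M (c : K) : vge (- M) c -> wle M c%:MP.
Proof.
move=> hc u; rewrite mcoeffC; case: eqP => [->|_]; last first.
  by rewrite mulr0; exact: vge0.
by rewrite mulr1 /mwt big1 ?add0r// => i _; rewrite mnm0E mulr0n.
Qed.

Lemma wtopC M (c : K) : wtop M c%:MP = (gcoef c (- M))%:MP.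
Proof.
apply/mpolyP => u; rewrite mcoeff_wtop !mcoeffC; case: eqP => [->|_].
  by rewrite !mulr1 /mwt big1 ?add0r// => i _; rewrite mnm0E mulr0n.
by rewrite !mulr0 gcoef0.
Qed.

Lemma mwtU i : mwt U_(i)%MM = w 0 i.
Proof.
rewrite /mwt (bigD1 i)//= mnm1E eqxx mulr1n big1 ?addr0// => j ji.
by rewrite mnm1E eq_sym (negPf ji) mulr0n.
Qed.

Lemma wleX i : wle (w 0 i) 'X_i.
Proof.
move=> u; rewrite mcoeffX; case: eqP => [<-|_]; last exact: vge0.
by rewrite mwtU subrr; exact: vge1.
Qed.

Lemma wtopX i : wtop (w 0 i) 'X_i = 'X_i.
Proof.
apply/mpolyP => u; rewrite mcoeff_wtop !mcoeffX; case: eqP => [<-|_].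
  by rewrite mwtU subrr gcoef1 eqxx.
by rewrite gcoef0.
Qed.

(* Sealed, as failing unifications of two tropical terms would otherwise unfold
   the valuation. *)
Definition tterm f u := locked (@trop_term R n) w f u.

Lemma tterm_trop f u : tterm f u = trop_term w f u.
Proof. by rewrite /tterm -lock. Qed.

Lemma ttermE f u : tterm f u = mwt u - gp_val f@_u.
Proof. by rewrite tterm_trop. Qed.

Definition maxterm f u :=
  u \in msupp f /\ forall v, v \in msupp f -> tterm f v <= tterm f u.

Lemma mcoeff_init_form f u : (init_form w f)@_u =
  if (u \in msupp f) && all (fun v => tterm f v <= tterm f u) (msupp f)
  then gp_lead f@_u else 0.
Proof.
rewrite /init_form mcoeff_sumX//; congr (if _ && _ then _ else _).
by apply: eq_all => v; rewrite !tterm_trop.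
Qed.

Lemma maxtermP f u : reflect (maxterm f u) (u \in msupp (init_form w f)).
Proof.
rewrite mcoeff_msupp mcoeff_init_form; case: ifPn => [/andP[uf /allP h]|h].
  by rewrite gp_lead_neq0 -?mcoeff_msupp//; apply: ReflectT; split.
by rewrite eqxx; apply: ReflectF => -[uf hu]; move: h; rewrite uf/= => /allP.
Qed.

Lemma maxterm_exists f : f != 0 -> exists u, maxterm f u.
Proof.
rewrite -msupp_eq0 => f0.
have [|M Ms hM] := @seq_has_min _ [seq - tterm f u | u <- msupp f].
  by case: (msupp f) f0.
have /mapP[u uf Mu] := Ms; exists u; split; [exact: uf|move=> v vf].
have := hM _ (map_f (fun u => - tterm f u) vf).
by rewrite Mu lerN2.
Qed.

Lemma maxterm_eq f u v : maxterm f u -> maxterm f v ->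
  tterm f u = tterm f v.
Proof. by move=> [u1 u2] [v1 v2]; apply: le_anti; rewrite (u2 _ v1) (v2 _ u1). Qed.

Lemma wle_maxterm f u : maxterm f u -> wle (tterm f u) f.
Proof.
move=> [uf hu] v; have [vf|vf] := boolP (v \in msupp f); last first.
  by rewrite memN_msupp_eq0//; exact: vge0.
have fv : f@_v != 0 by rewrite -mcoeff_msupp.
have [_ h] := gp_val_spec fv.
by apply: (vgeW _ h); have := hu v vf; rewrite [tterm f v]ttermE; lra.
Qed.

Lemma wtop_maxterm f u : maxterm f u -> wtop (tterm f u) f = init_form w f.
Proof.
move=> mu; apply/mpolyP => v; rewrite mcoeff_wtop mcoeff_init_form.
have [vf|vf] := boolP (v \in msupp f); last by rewrite memN_msupp_eq0// gcoef0.
have fv : f@_v != 0 by rewrite -mcoeff_msupp.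
case: ifPn => [/andP[_ /allP hv]|/negP hv].
  have mv : maxterm f v by split; [exact: vf|exact: hv].
  rewrite (maxterm_eq mu mv) ttermE /gp_lead; congr (gcoef _ _).
  by rewrite opprB addrCA subrr addr0.
have [_ h] := gp_val_spec fv; apply: (vge_coef0 h).
rewrite ltNge; apply/negP => huv; apply: hv => /=; apply/allP => v' v'f.
apply: le_trans (mu.2 _ v'f) _; rewrite [leRHS]ttermE; lra.
Qed.

Lemma init_form_neq0 f : f != 0 -> init_form w f != 0.
Proof.
move=> /maxterm_exists[u /maxtermP uf]; apply/eqP => e.
by rewrite e msupp0 in uf.
Qed.

Lemma init_form0 : init_form w (0 : {mpoly K[n]}) = 0.
Proof. by rewrite /init_form msupp0 big_nil. Qed.

(** If M exceeds the maximal weight, no term has weight M; otherwise M is the maximum. To recognize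
    a symbol as an initial form it thus suffices to see that it is nonzero. *)
Lemma wtop_init_form M f : wle M f -> wtop M f = 0 \/ wtop M f = init_form w f.
Proof.
move=> hf; have [->|f0] := eqVneq f 0; first by left; rewrite wtop0.
have [u mu] := maxterm_exists f0.
have fu : f@_u != 0 by rewrite -mcoeff_msupp; case: mu.
have uM : tterm f u <= M.
  by have [h _] := gp_val_spec fu; have := hf u _ h; rewrite ttermE; lra.
have [<-|uM'] := eqVneq (tterm f u) M; first by right; exact: wtop_maxterm.
left; apply/mpolyP => v; rewrite mcoeff_wtop mcoeff0.
apply: (@vge_coef0 R (mwt v - tterm f u)); first exact: wle_maxterm.
by rewrite ltrD2l ltrN2 lt_neqAle uM' uM.
Qed.

End Defs.

Section Substitution.
Variables (n : nat) (w : 'rV[R]_n) (B : comNzRingType) (B' : comNzRingType).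
Variables (i : {rmorphism K -> B}) (i' : {rmorphism k -> B'}).
Variables (bge : R -> B -> Prop) (btop : R -> B -> B').
Hypothesis bge0 : forall M, bge M 0.
Hypothesis bgeD : forall M a b, bge M a -> bge M b -> bge M (a + b).
Hypothesis btop0 : forall M, btop M 0 = 0.
Hypothesis btopD : forall M a b, btop M (a + b) = btop M a + btop M b.
Hypothesis bgeM : forall M N a b, bge M a -> bge N b -> bge (M + N) (a * b).
Hypothesis btopM : forall M N a b, bge M a -> bge N b ->
  btop (M + N) (a * b) = btop M a * btop N b.
Hypothesis bgeC : forall M c, vge (- M) c -> bge M (i c).
Hypothesis btopC : forall M c, vge (- M) c -> btop M (i c) = i' (gcoef c (- M)).
Variables (h : 'I_n -> B) (h' : 'I_n -> B').
Hypothesis hge : forall j, bge (w 0 j) (h j).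
Hypothesis htop : forall j, btop (w 0 j) (h j) = h' j.

Let bgeX M b j : bge M b ->
  bge (M *+ j) (b ^+ j) /\ btop (M *+ j) (b ^+ j) = btop M b ^+ j.
Proof.
move=> hb; elim: j => [|j [IH1 IH2]].
  rewrite !expr0 mulr0n -(rmorph1 i) -(rmorph1 i').
  have v1 : vge (- 0) (1 : K) by rewrite oppr0; exact: vge1.
  by split; [exact: bgeC|rewrite btopC// oppr0 gcoef1 eqxx].
rewrite !exprS mulrS; split; first exact: bgeM.
by rewrite btopM// IH2.
Qed.

Let bge_mon u : bge (mwt w u) (mmap1 h u) /\
  btop (mwt w u) (mmap1 h u) = mmap1 h' u.
Proof.
rewrite /mwt /mmap1; elim: (index_enum _) => [|j s [IH1 IH2]].
  rewrite !big_nil -(rmorph1 i) -(rmorph1 i').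
  have v1 : vge (- 0) (1 : K) by rewrite oppr0; exact: vge1.
  by split; [exact: bgeC|rewrite btopC// oppr0 gcoef1 eqxx].
rewrite !big_cons; have [h1 h2] := bgeX (u j) (hge j).
by split; [exact: bgeM|rewrite btopM// IH2 h2 htop].
Qed.

(** A substitution that respects the filtrations commutes with symbols. The target is abstract, as
    this is applied to points of K, to univariate polynomials and to polynomials in several
    variables. *)
Lemma bge_subst M f : wle w M f ->
  bge M (mmap i h f) /\ btop M (mmap i h f) = mmap i' h' (wtop w M f).
Proof.
move=> hf.
have -> : mmap i' h' (wtop w M f) =
    \sum_(u <- msupp f) i' (gcoef f@_u (mwt w u - M)) * mmap1 h' u.
  by rewrite raddf_sum; apply: eq_bigr => u _; rewrite /= mmapZ mmapX.
rewrite /mmap.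
elim: (msupp f) => [|u s [IH1 IH2]].
  by rewrite !big_nil; split; [exact: bge0|rewrite btop0].
rewrite !big_cons.
have e : M = (M - mwt w u) + mwt w u by rewrite subrK.
have hc : vge (- (M - mwt w u)) f@_u by rewrite opprB; exact: hf.
have [m1 m2] := bge_mon u.
have h1 : bge M (i f@_u * mmap1 h u) by rewrite [M in bge M]e; apply: bgeM => //; exact: bgeC.
split; first exact: bgeD.
rewrite btopD IH2; congr (_ + _).
by rewrite [in LHS]e btopM//; [rewrite btopC// opprB m2|exact: bgeC].
Qed.

End Substitution.

Section Instances.
Variables (n : nat) (w : 'rV[R]_n).
Implicit Types (f : {mpoly K[n]}) (M : R).

Lemma subst_point M f (p : 'I_n -> K) (c : 'I_n -> k) : wle w M f ->
  (forall j, vge (- w 0 j) (p j)) -> (forall j, gcoef (p j) (- w 0 j) = c j) ->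
  vge (- M) f.@[p] /\ gcoef f.@[p] (- M) = (wtop w M f).@[c].
Proof.
move=> hf hp hc.
apply: (@bge_subst n w K k idfun idfun (fun M => vge (- M))
  (fun M x => gcoef x (- M))) => //.
- by move=> ?; exact: vge0.
- by move=> ? ? ?; exact: vgeD.
- by move=> M1 M2 a b ha hb; rewrite opprD; exact: vgeM.
- by move=> M1 M2 a b ha hb; rewrite opprD gcoefM_min.
Qed.

Lemma subst_mpoly m (w' : 'rV[R]_m) M f (s : n.-tuple {mpoly K[m]})
    (s' : n.-tuple {mpoly k[m]}) : wle w M f ->
  (forall j, wle w' (w 0 j) (tnth s j)) ->
  (forall j, wtop w' (w 0 j) (tnth s j) = tnth s' j) ->
  wle w' M (f \mPo s) /\ wtop w' M (f \mPo s) = wtop w M f \mPo s'.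
Proof.
move=> hf hs hs'.
apply: (@bge_subst n w _ _ (@mpolyC m K) (@mpolyC m k) (wle w') (wtop w')) => //.
- by move=> ?; exact: wle0.
- by move=> ? ? ?; exact: wleD.
- by move=> ?; exact: wtop0.
- by move=> ? ? ?; exact: wtopD.
- by move=> M1 M2 a b; exact: wleM.
- by move=> M1 M2 a b; exact: wtopM.
- by move=> ? ?; exact: wleC.
- by move=> ? ? _; exact: wtopC.
Qed.

Definition pge M (p : {poly K}) := forall i : nat, vge (- M) p`_i.
Definition ptop M (p : {poly K}) : {poly k} := \poly_(i < size p) gcoef p`_i (- M).

Lemma coef_ptop M p i : (ptop M p)`_i = gcoef p`_i (- M).
Proof. by rewrite coef_poly; case: ltnP => // h; rewrite nth_default. Qed.

Lemma subst_poly M f (s : 'I_n -> {poly K}) (s' : 'I_n -> {poly k}) : wle w M f ->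
  (forall j, pge (w 0 j) (s j)) -> (forall j, ptop (w 0 j) (s j) = s' j) ->
  pge M (mmap (@polyC K) s f) /\
  ptop M (mmap (@polyC K) s f) = mmap (@polyC k) s' (wtop w M f).
Proof.
move=> hf hs hs'.
apply: (@bge_subst n w _ _ (@polyC K) (@polyC k) pge ptop) => //.
- by move=> ? ?; rewrite coef0; exact: vge0.
- by move=> ? ? ? h1 h2 ?; rewrite coefD; exact: vgeD.
- by move=> ?; apply/polyP => i; rewrite coef_ptop !coef0 gcoef0.
- by move=> ? ? ?; apply/polyP => i; rewrite coefD !coef_ptop coefD gcoefD.
- move=> ? ? ? ? h1 h2 i; rewrite coefM; apply: vge_sum => j _.
  by rewrite opprD; exact: vgeM.
- move=> M1 M2 a b h1 h2; apply/polyP => i; rewrite coef_ptop !coefM gcoef_sum.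
  by apply: eq_bigr => j _; rewrite !coef_ptop opprD (gcoefM_min (h1 _) (h2 _)).
- by move=> ? ? h i; rewrite coefC; case: eqP => // _; exact: vge0.
- by move=> ? ? _; apply/polyP => i; rewrite coef_ptop !coefC; case: eqP.
Qed.

End Instances.

Lemma ideal_gen_ideal (A : comNzRingType) (S : set A) : is_ideal (ideal_gen S).
Proof.
split=> [I [[]]//|a b ha hb I hI|c a ha I hI]; case: (hI) => -[_ hD hM] hS.
  by apply: hD; [exact: ha|exact: hb].
by apply: hM; exact: ha.
Qed.

Lemma sub_ideal_gen (A : comNzRingType) (S : set A) : S `<=` ideal_gen S.
Proof. exact: sub_gen_smallest. Qed.

Lemma ideal_gen_min (A : comNzRingType) (S J : set A) :
  is_ideal J -> S `<=` J -> ideal_gen S `<=` J.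
Proof. exact: smallest_sub. Qed.

Lemma ideal_gen1P (A : comNzRingType) (g a : A) :
  ideal_gen [set g] a <-> exists b, a = b * g.
Proof.
split=> [h|[b ->]].
  have : [set a | exists b, a = b * g] a.
    apply: ideal_gen_min h; first split.
    - by exists 0; rewrite mul0r.
    - by move=> _ _ [b1 ->] [b2 ->]; exists (b1 + b2); rewrite mulrDl.
    - by move=> c _ [b ->]; exists (c * b); rewrite mulrA.
    - by move=> _ ->; exists 1; rewrite mul1r.
  by [].
have [_ _ hM] := ideal_gen_ideal [set g].
by apply: hM; exact: sub_ideal_gen.
Qed.

(** Symbols multiply, and polynomials over k form a domain: the product of the two initial forms is
    a nonzero symbol. *)
Lemma init_formM n (w : 'rV[R]_n) (f g : {mpoly K[n]}) :
  init_form w (f * g) = init_form w f * init_form w g.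
Proof.
have [->|f0] := eqVneq f 0; first by rewrite mul0r init_form0 mul0r.
have [->|g0] := eqVneq g 0; first by rewrite mulr0 init_form0 mulr0.
have [[u hu] [v hv]] := (maxterm_exists w f0, maxterm_exists w g0).
have hf := wle_maxterm hu; have hg := wle_maxterm hv.
have := wtopM hf hg; rewrite (wtop_maxterm hu) (wtop_maxterm hv) => e.
have [e'|<-//] := wtop_init_form (wleM hf hg).
exfalso; move/eqP: e; rewrite e' eq_sym mulf_eq0.
by rewrite !(negPf (init_form_neq0 _ _)).
Qed.

Lemma init_ideal_principal n (w : 'rV[R]_n) (g : {mpoly K[n]}) :
  init_ideal w (ideal_gen [set g]) = ideal_gen [set init_form w g].
Proof.
apply/seteqP; split; apply: ideal_gen_min; try exact: ideal_gen_ideal.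
  move=> _ [_ /ideal_gen1P[b ->] <-]; rewrite init_formM.
  by apply/ideal_gen1P; exists (init_form w b).
by move=> _ ->; apply: sub_ideal_gen; exists g => //; exact: sub_ideal_gen.
Qed.

End Weights.

(** * Kapranov's theorem for hypersurfaces, with control of leading coefficients *)

Section Kapranov.
Variables (R : realType).
Local Notation K := (gpuiseux R).
Local Notation k := R[i].

Lemma big_ord2 (A : Type) (x0 : A) (op : Monoid.law x0) (F : 'I_2 -> A) :
  \big[op/x0]_(i < 2) F i = op (F i0) (F i1).
Proof.
rewrite !big_ord_recl big_ord0 Monoid.mulm1; congr (op (F _) (F _)); exact: val_inj.
Qed.

Lemma ord2P (P : 'I_2 -> Prop) : P i0 -> P i1 -> forall i, P i.
Proof.
move=> h0 h1 [[|[|//]] hi].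
  by have -> : Ordinal hi = i0 by exact: val_inj.
by have -> : Ordinal hi = i1 by exact: val_inj.
Qed.

Lemma mnm2P (u v : 'X_{1..2}) : u i0 = v i0 -> u i1 = v i1 -> u = v.
Proof. by move=> h0 h1; apply/mnmP => i; move: i; exact: ord2P. Qed.

Lemma TropP n (f : {mpoly K[n]}) (w : 'rV[R]_n) : Trop (ideal_gen [set f]) w <->
  exists p : 'I_n -> K, [/\ forall i, p i != 0, f.@[p] = 0 &
    forall i, w 0 i = - gp_val (p i)].
Proof.
split=> [[p [p0 fp ->]]|[p [p0 fp wp]]]; exists p; split=> //.
- by apply: fp; exact: sub_ideal_gen.
- by move=> i; rewrite mxE.
- by move=> _ /ideal_gen1P[b ->]; rewrite mevalM fp mulr0.
- by apply/rowP => i; rewrite mxE wp.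
Qed.

(** The easy half of Kapranov's theorem: for M the maximal weight, the coefficient of f(p) at
    exponent -M is the initial form evaluated at the leading coefficients. *)
Lemma init_form_root n (f : {mpoly K[n]}) (w : 'rV[R]_n) (p : 'I_n -> K) :
  (forall i, p i != 0) -> f.@[p] = 0 -> (forall i, w 0 i = - gp_val (p i)) ->
  (init_form w f).@[fun i => gp_lead (p i)] = 0.
Proof.
move=> p0 fp wp; have [->|f0] := eqVneq f 0; first by rewrite init_form0 meval0.
have [u mu] := maxterm_exists w f0; rewrite -(wtop_maxterm mu).
have [||_ <-] := @subst_point R n w _ f p (fun i => gp_lead (p i)) (wle_maxterm mu).
- by move=> j; rewrite wp opprK; have [] := gp_val_spec (p0 j).
- by move=> j; rewrite wp opprK.
by rewrite fp gcoef0.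
Qed.

Lemma meval_two_terms n (q : {mpoly k[n]}) (e : 'I_n -> k) : q != 0 ->
  (forall i, e i != 0) -> q.@[e] = 0 ->
  exists u v, [/\ u \in msupp q, v \in msupp q & u != v].
Proof.
rewrite -msupp_eq0 => q0 e0 qe.
case E: (msupp q) q0 => [//|u [|v s]] _; last first.
  have := msupp_uniq q; rewrite E /= inE negb_or => /andP[/andP[uv _] _].
  by exists u, v; rewrite !inE !eqxx ?orbT.
move: qe; rewrite mevalE E big_seq1 => /eqP; rewrite mulf_eq0 => /orP[].
  by rewrite mcoeff_eq0 E inE eqxx.
by move/prodf_eq0 => [i _]; rewrite expf_eq0 (negPf (e0 i)) andbF.
Qed.

Lemma horner_mmap n (A : comNzRingType) (s : 'I_n -> {poly A}) (q : {mpoly A[n]}) y :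
  (mmap (@polyC A) s q).[y] = q.@[fun i => (s i).[y]].
Proof.
rewrite mevalE /mmap horner_sum; apply: eq_bigr => u _.
rewrite hornerM hornerC; congr (_ * _); rewrite /mmap1 horner_prod.
by apply: eq_bigr => i _; rewrite horner_exp.
Qed.

(** The hard half. All coordinates but the j-th are frozen at e_i t^(-w_i); the remaining univariate
    polynomial, scaled by t^M, has as residue the restriction of the initial form. The value c
    witnesses that this restriction is not zero, as [lift_root] requires. *)
Lemma lift_init_root n (f : {mpoly K[n]}) (w : 'rV[R]_n) (e : 'I_n -> k) j c :
  f != 0 -> (forall i, e i != 0) -> (init_form w f).@[e] = 0 ->
  (init_form w f).@[fun i => if i == j then c else e i] != 0 ->
  exists p : 'I_n -> K, [/\ forall i, p i != 0, f.@[p] = 0,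
    forall i, w 0 i = - gp_val (p i) & forall i, gp_lead (p i) = e i].
Proof.
move=> f0 e0 qe qc; have [u mu] := maxterm_exists w f0.
set M := tterm w f u in mu; have hM := wle_maxterm mu.
pose S i : {poly K} := if i == j then gp_mono 1 (- w 0 i) *: 'X
  else (gp_mono (e i) (- w 0 i))%:P.
pose s i : {poly k} := if i == j then 'X else (e i)%:P.
have [||Gge Gtop] := @subst_poly R n w _ f S s hM.
- move=> i d; rewrite /S; case: eqP => _.
    rewrite coefZ coefX; case: eqP => _; last by rewrite mulr0; exact: vge0.
    by rewrite mulr1; exact: vge_mono.
  by rewrite coefC; case: eqP => _; [exact: vge_mono|exact: vge0].
- move=> i; apply/polyP => d; rewrite coef_ptop /S /s; case: eqP => _.
    rewrite coefZ !coefX; case: eqP => _; last by rewrite mulr0 gcoef0.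
    by rewrite mulr1/= eqxx.
  by rewrite !coefC; case: eqP => _; rewrite ?gcoef0//= eqxx.
rewrite (wtop_maxterm mu) in Gtop.
set G := mmap _ S f in Gge Gtop.
have Gint : intp (gp_mono 1 M *: G).
  by move=> d; rewrite coefZ -(subrr M); apply: vgeM; [exact: vge_mono|exact: Gge].
have Gres : resp (gp_mono 1 M *: G) = mmap (@polyC k) s (init_form w f).
  rewrite -Gtop; apply/polyP => d.
  by rewrite coef_resp coef_ptop coefZ gcoef_mono_mul mul1r sub0r.
have [||y [y0 ye]] := @lift_root R _ (e j) Gint.
- rewrite Gres; apply: contraNneq qc => /(congr1 (fun r => r.[c])).
  rewrite horner_mmap horner0 => <-; apply/eqP; apply: meval_eq => i.
  by rewrite /s; case: eqP; rewrite !hornerE.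
- rewrite Gres /root horner_mmap; apply/eqP.
  rewrite -qe; apply: meval_eq => i.
  by rewrite /s; case: eqP => [->|_]; rewrite !hornerE.
rewrite /root hornerZ mulf_eq0 (negPf (gp_mono_neq0 _ _)) ?oner_eq0//=.
rewrite horner_mmap => /eqP fy.
have yv : gp_val y = 0 by apply: gp_val_eq => //; rewrite ye; exact/eqP.
have yn : y != 0 by apply: contraNneq (e0 j) => y'; rewrite -ye y' gcoef0.
have t0 a : gp_mono 1 a != 0 :> K by apply: gp_mono_neq0; rewrite oner_eq0.
exists (fun i => (S i).[y]); split=> // i; rewrite /S; case: (i =P j) => [->|_];
  rewrite !hornerE.
- by rewrite mulf_neq0.
- exact: gp_mono_neq0.
- by rewrite gp_valM// yv gp_val_mono ?oner_eq0// addr0 opprK.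
- by rewrite gp_val_mono ?opprK.
- by rewrite gp_leadM// gp_lead_mono ?oner_eq0// mul1r /gp_lead yv.
- by rewrite gp_lead_mono.
Qed.

(** After removal of the power of X, two nonzero coefficients leave a non-constant polynomial that
    does not vanish at 0. *)
Lemma poly_nonzero_root (p : {poly k}) i j : i != j -> p`_i != 0 -> p`_j != 0 ->
  exists2 e, e != 0 & root p e.
Proof.
move=> ij pi pj; have p0 : p != 0 by apply: contraNneq pi => ->; rewrite coef0.
have [m [r rn pE]] := multiplicity_XsubC p 0.
rewrite p0/= polyC0 subr0 in rn pE.
have coefp d : p`_d = if (d < m)%N then 0 else r`_(d - m) by rewrite pE coefMXn.
have sz : size r != 1%N.
  apply: contra_neq ij => /eqP/size_poly1P[c c0 rc].
  have im d : p`_d != 0 -> d = m.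
    rewrite coefp rc; case: ltnP => [|md]; first by rewrite eqxx.
    rewrite coefC subn_eq0; case: leqP => [dm _|]; last by rewrite eqxx.
    by apply/eqP; rewrite eqn_leq dm.
  by rewrite (im _ pi) (im _ pj).
have /closed_rootP[e re] := sz.
exists e; first by apply: contraNneq rn => <-.
by rewrite pE rootM re.
Qed.

Definition ycoef (q : {mpoly k[2]}) d : {poly k} :=
  \sum_(u <- msupp q | (u : 'X_{1..2}) i1 == d) q@_u *: 'X^(u i0).

Lemma coef_ycoef q (u : 'X_{1..2}) : (ycoef q (u i1))`_(u i0) = q@_u.
Proof.
rewrite /ycoef coef_sum; under eq_bigr do rewrite coefZ coefXn.
have [uq|uq] := boolP (u \in msupp q).
  rewrite -big_filter (bigD1_seq u) ?filter_uniq ?mem_filter ?eqxx//= ?eqxx mulr1.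
  rewrite big_filter_cond big1 ?addr0// => v /andP[/eqP v1 vu].
  case: eqP => [v0|_]; last by rewrite mulr0.
  by case/eqP: vu; apply: mnm2P.
rewrite memN_msupp_eq0// big_seq_cond big1// => v /andP[vq /eqP v1].
case: eqP => [v0|_]; last by rewrite mulr0.
by case/negP: uq; rewrite (@mnm2P u v).
Qed.

Lemma ycoef_neq0 q (u : 'X_{1..2}) : u \in msupp q -> ycoef q (u i1) != 0.
Proof.
rewrite mcoeff_msupp -coef_ycoef => h; apply: contraNneq h => ->.
by rewrite coef0.
Qed.

(** Two different powers of y leave x free: x is taken outside 0, a and the zeros of two
    coefficients, and the equation is then solved for a nonzero y. *)
Lemma init_root_avoiding (q : {mpoly k[2]}) (u v : 'X_{1..2}) a :
  u \in msupp q -> v \in msupp q -> u i1 != v i1 ->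
  exists (e : 'I_2 -> k) c, [/\ forall i, e i != 0, e i0 != a, q.@[e] = 0 &
    q.@[fun i => if i == i1 then c else e i] != 0].
Proof.
move=> uq vq uv.
pose N := ycoef q (u i1) * ycoef q (v i1) * 'X * ('X - a%:P).
have N0 : N != 0.
  by rewrite !mulf_neq0 ?ycoef_neq0// -size_poly_gt0 ?size_polyX ?size_XsubC.
have /closed_nonrootP[x] := N0.
rewrite !rootM !negb_or root_XsubC rootX => /andP[/andP[/andP[xu xv] x0] xa].
pose p := \sum_(w <- msupp q) (q@_w * x ^+ w i0) *: 'X^(w i1).
have pE y : p.[y] = q.@[fun i => if i == i1 then y else x].
  rewrite mevalE horner_sum; apply: eq_bigr => w _.
  by rewrite hornerZ hornerXn big_ord2/= mulrA.
have coefp d : p`_d = (ycoef q d).[x].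
  rewrite /p /ycoef coef_sum horner_sum [RHS]big_mkcond.
  apply: eq_bigr => w _; rewrite coefZ coefXn eq_sym; case: eqP => _.
    by rewrite mulr1 hornerZ hornerXn.
  by rewrite mulr0.
have [||y y0 py] := @poly_nonzero_root p _ _ uv; try by rewrite coefp.
have p0 : p != 0 by apply: contraNneq xu => p0; rewrite /root -coefp p0 coef0.
have /closed_nonrootP[c pc] := p0.
exists (fun i => if i == i1 then y else x), c; split=> //.
- by move=> i; case: (i =P i1).
- by rewrite -pE; exact/eqP.
- move: pc; rewrite /root pE; congr (_ != _); apply: meval_eq => i.
  by case: (i =P i1).
Qed.

Definition xpoly (q : {mpoly k[2]}) : {poly k} :=
  \sum_(u <- msupp q) q@_u *: 'X^(u i0).

(** q is y^b times a polynomial in x, namely [xpoly q]. For an initial form this is the case of a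
    horizontal Newton segment, dual to a vertical edge. *)
Definition yconst (q : {mpoly k[2]}) b := forall u : 'X_{1..2}, u \in msupp q -> u i1 = b.

Lemma meval_yconst q b (e : 'I_2 -> k) : yconst q b ->
  q.@[e] = (xpoly q).[e i0] * e i1 ^+ b.
Proof.
move=> hb; rewrite mevalE horner_sum mulr_suml big_seq [RHS]big_seq.
apply: eq_bigr => u uq.
by rewrite hornerZ hornerXn big_ord2/= mulrA hb.
Qed.

Lemma xpolyE q b : yconst q b -> xpoly q = ycoef q b.
Proof.
by move=> hb; rewrite /xpoly /ycoef big_seq [RHS]big_seq_cond;
  apply: eq_bigl => u; case: (boolP (_ \in _)) => //= /hb ->; rewrite eqxx.
Qed.

Lemma coef_xpoly q b (u : 'X_{1..2}) : yconst q b -> u i1 = b -> (xpoly q)`_(u i0) = q@_u.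
Proof. by move=> hb ub; rewrite (xpolyE hb) -ub coef_ycoef. Qed.

Lemma xpoly_neq0 q b : yconst q b -> q != 0 -> xpoly q != 0.
Proof.
move=> hb; rewrite -msupp_eq0; case E: (msupp q) => [//|u s] _.
have uq : u \in msupp q by rewrite E inE eqxx.
by rewrite (xpolyE hb) -(hb _ uq) ycoef_neq0.
Qed.

Section Plane.
Variables (f : {mpoly K[2]}) (w : 'rV[R]_2).
Hypothesis f0 : f != 0.

Definition zero_over (p : 'I_2 -> K) :=
  [/\ forall i, p i != 0, f.@[p] = 0 & forall i, w 0 i = - gp_val (p i)].

Lemma trop_two_terms : Trop (ideal_gen [set f]) w ->
  exists u v, [/\ maxterm w f u, maxterm w f v & u != v].
Proof.
move=> /TropP[p [p0 fp wp]].
have [||u [v [/maxtermP hu /maxtermP hv uv]]] :=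
    @meval_two_terms _ (init_form w f) _ _ _ (init_form_root p0 fp wp).
- exact: init_form_neq0.
- by move=> i; rewrite gp_lead_neq0.
by exists u, v.
Qed.

Lemma lift_avoiding u v a : maxterm w f u -> maxterm w f v -> u i1 != v i1 ->
  exists2 p, zero_over p & gp_lead (p i0) != a.
Proof.
move=> /maxtermP hu /maxtermP hv uv.
have [e [c [e0 ea qe qc]]] := init_root_avoiding a hu hv uv.
have [p [p0 fp wp pe]] := lift_init_root f0 e0 qe qc.
by exists p; rewrite ?pe.
Qed.

Lemma lift_xroot b x : yconst (init_form w f) b -> x != 0 ->
  root (xpoly (init_form w f)) x ->
  exists2 p, zero_over p & gp_lead (p i0) = x.
Proof.
move=> hb x0 rx.
have /closed_nonrootP[c pc] := xpoly_neq0 hb (init_form_neq0 w f0).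
pose e (i : 'I_2) := if i == i0 then x else 1.
have e0 i : e i != 0 by rewrite /e; case: (i =P i0); rewrite ?oner_eq0.
have [||p [p0 fp wp pe]] := @lift_init_root _ f w e i0 c f0 e0.
- by rewrite (meval_yconst _ hb)/= (rootP rx) mul0r.
- by rewrite (meval_yconst _ hb)/= expr1n mulr1.
by exists p; rewrite ?pe.
Qed.

Lemma zero_over_xroot b p : yconst (init_form w f) b -> zero_over p ->
  root (xpoly (init_form w f)) (gp_lead (p i0)).
Proof.
move=> hb [p0 fp wp]; have := init_form_root p0 fp wp.
rewrite (meval_yconst _ hb) => /eqP; rewrite mulf_eq0 expf_eq0.
by rewrite (negPf (gp_lead_neq0 (p0 i1))) andbF orbF.
Qed.

(** With two powers of y among the maximal terms one solves for y. Otherwise the initial form is y^b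
    times a polynomial in x with two terms, which has a nonzero root. *)
Lemma two_terms_trop u v : maxterm w f u -> maxterm w f v -> u != v ->
  Trop (ideal_gen [set f]) w.
Proof.
move=> mu mv uv; suff [p hp] : exists p, zero_over p by apply/TropP; exists p.
have [hb|/existsNP[v' /not_implyP[/maxtermP mv' /eqP uv']]] :=
    pselect (yconst (init_form w f) (u i1)); last first.
  by have [p hp _] := lift_avoiding 0 mv' mu uv'; exists p.
have mem z : maxterm w f z -> (xpoly (init_form w f))`_(z i0) != 0.
  by move=> /maxtermP mz; rewrite (coef_xpoly hb) ?hb// -mcoeff_msupp.
have uv0 : u i0 != v i0.
  apply: contra_neq uv => e; apply: mnm2P => //.
  by rewrite (hb v)//; exact/maxtermP.
have [x x0 rx] := poly_nonzero_root uv0 (mem _ mu) (mem _ mv).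
by have [p hp _] := lift_xroot hb x0 rx; exists p.
Qed.

End Plane.

End Kapranov.

(** * Local structure of plane tropical curves *)

Section LocalGeometry.
Variables (R : realType).
Local Notation K := (gpuiseux R).
Local Notation k := R[i].

Definition close n (e : R) (w w' : 'rV[R]_n) := forall i, `|w' 0 i - w 0 i| < e.

Lemma near_closeP n (w : 'rV[R]_n) (P : 'rV[R]_n -> Prop) :
  (\forall u \near w, P u) <-> exists2 e, 0 < e & forall u, close e w u -> P u.
Proof.
split=> [/nbhs_ballP[e e0 h]|[e e0 h]].
  exists e => // u hu; apply: h; split=> // i j.
  by rewrite (ord1 i) /ball/= distrC.
apply/nbhs_ballP; exists e => // u hu; apply: h => i.
by case: hu => _ /(_ 0 i); rewrite /ball/= distrC.
Qed.

Lemma closeW n (e e' : R) (w w' : 'rV[R]_n) : e <= e' -> close e w w' -> close e' w w'.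
Proof. by move=> ee' h i; exact: lt_le_trans (h i) ee'. Qed.

Lemma seq_argmax (T : eqType) (s : seq T) (F : T -> R) : s != [::] ->
  exists2 x, x \in s & forall y, y \in s -> F y <= F x.
Proof.
move=> s0; have [|M Ms hM] := @seq_has_min _ [seq - F x | x <- s].
  by case: s s0.
have /mapP[x xs Mx] := Ms; exists x => // y ys.
by have := hM _ (map_f (fun z => - F z) ys); rewrite Mx lerN2.
Qed.

Lemma mwt_linear n (w d : 'rV[R]_n) u : mwt (w + d) u = mwt w u + mwt d u.
Proof. by rewrite -big_split; apply: eq_bigr => i _; rewrite mxE mulrnDl. Qed.

Lemma tterm_add n (w d : 'rV[R]_n) (f : {mpoly K[n]}) u :
  tterm (w + d) f u = tterm w f u + mwt d u.
Proof. by rewrite !ttermE mwt_linear addrAC. Qed.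

Lemma mwt_bound n (d : 'rV[R]_n) (e : R) u : (forall i, `|d 0 i| <= e) ->
  `|mwt d u| <= e *+ mdeg u.
Proof.
move=> hd; apply: le_trans (ler_norm_sum _ _ _) _.
rewrite mdegE -sumrMnr; apply: ler_sum => i _.
by rewrite normrMn ler_wMn2r.
Qed.

(* Near w the initial form of f is an initial form of its initial form at w. *)
Lemma near_maxterm n (f : {mpoly K[n]}) (w : 'rV[R]_n) : exists2 e : R, 0 < e &
  forall d : 'rV[R]_n, (forall i, `|d 0 i| < e) -> forall u, maxterm (w + d) f u <->
    maxterm w f u /\ forall v, maxterm w f v -> mwt d v <= mwt d u.
Proof.
have [g g0 hg] : exists2 g : R, 0 < g & forall u v, u \in msupp f -> v \in msupp f ->
    tterm w f u < tterm w f v -> tterm w f u + g <= tterm w f v.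
  pose t := [seq x <- [seq tterm w f v - tterm w f u |
    u <- msupp f, v <- msupp f] | 0 < x].
  have ht u v : u \in msupp f -> v \in msupp f ->
      tterm w f u < tterm w f v -> tterm w f v - tterm w f u \in t.
    move=> uf vf uv; rewrite mem_filter subr_gt0 uv /=.
    by apply/allpairsP; exists (u, v).
  case E : t => [|x s].
    by exists 1 => // u v uf vf /(ht _ _ uf vf); rewrite E.
  have [|M Mt hM] := @seq_has_min _ t; first by rewrite E.
  exists M; first by move: Mt; rewrite mem_filter => /andP[].
  by move=> u v uf vf uv; have := hM _ (ht _ _ uf vf uv); rewrite lerBrDl.
pose D : R := (msize f).+1%:R.
have D0 : 0 < D by rewrite ltr0n.
(* D exceeds the degree of every exponent, so a displacement changes each term by at most g/3, and
   two such changes stay below the gap g. *)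
exists (g / (D *+ 3)); first by rewrite divr_gt0// pmulrn_lgt0.
move=> d hd.
have hu u : u \in msupp f -> `|mwt d u| <= g / 3.
  move=> uf; have le i : `|d 0 i| <= g / (D *+ 3) by exact: ltW.
  apply: le_trans (mwt_bound u le) _.
  have gD : 0 <= g / (D *+ 3) by rewrite ltW// divr_gt0// pmulrn_lgt0.
  apply: (@le_trans _ _ (g / (D *+ 3) *+ (msize f).+1)).
    by apply: ler_wpMn2l => //; apply/ltnW/ltnW; exact: msize_mdeg_lt.
  rewrite -mulr_natr -/D -[D *+ 3]mulr_natr invfM mulrA -!mulrA [3^-1 * D]mulrC.
  by rewrite mulKf ?gt_eqF.
have hu' u : u \in msupp f -> - (g / 3) <= mwt d u <= g / 3.
  by move=> /hu; rewrite ler_norml.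
move=> u; split=> [[uf humax]|[[uf humax] hv]].
  have [m [mf hm]] : exists m, maxterm w f m.
    by apply: maxterm_exists; rewrite -msupp_eq0; case: (msupp f) uf.
  have mu : tterm w f u = tterm w f m.
    apply: le_anti; rewrite hm//= leNgt; apply/negP => /(hg _ _ uf mf) h.
    move: h (humax _ mf) (hu' _ uf) (hu' _ mf); rewrite !tterm_add.
    move: (tterm w f u) (tterm w f m) (mwt d u) (mwt d m) g0.
    by clear; move=> *; lra.
  have um : maxterm w f u by split=> // v vf; rewrite mu; exact: hm.
  split=> // v vm; have := humax _ vm.1; rewrite !tterm_add.
  by rewrite (maxterm_eq um vm) lerD2l.
split=> // v vf; rewrite !tterm_add.
have [uv|uv] := ltP (tterm w f v) (tterm w f u).
  move: (hg _ _ vf uf uv) (hu' _ uf) (hu' _ vf).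
  move: (tterm w f u) (tterm w f v) (mwt d u) (mwt d v) g0.
  by clear; move=> *; lra.
have vu : tterm w f v = tterm w f u by apply: le_anti; rewrite humax.
rewrite vu lerD2l; apply: hv; split=> // v' v'f; rewrite vu; exact: humax.
Qed.

Lemma mwt2 (d : 'rV[R]_2) (u : 'X_{1..2}) :
  mwt d u = d 0 i0 * (u i0)%:R + d 0 i1 * (u i1)%:R.
Proof. by rewrite /mwt big_ord2 !mulr_natr. Qed.

Section Plane.
Variables (f : {mpoly K[2]}) (w : 'rV[R]_2).
Hypothesis f0 : f != 0.
Let C := Trop (ideal_gen [set f]).

(** The maximal exponents lie on a line of direction (p, q); dually, the curve near w is a line with
    normal (p, q). *)
Definition collin (p q : R) := forall u v : 'X_{1..2}, maxterm w f u -> maxterm w f v ->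
  ((u i0)%:R - (v i0)%:R) * q = ((u i1)%:R - (v i1)%:R) * p.

Lemma tropP w' : C w' <-> exists u v, [/\ maxterm w' f u, maxterm w' f v & u != v].
Proof.
split; first exact: trop_two_terms.
by move=> [u [v [mu mv uv]]]; exact: two_terms_trop mu mv uv.
Qed.

(** A displacement d separates two maximal terms by (u_0 - v_0)(p d_0 + q d_1)/p. Along the line all
    ties persist; off it none does, since maximal exponents with equal u_0 coincide. *)
Lemma collin_near p q : C w -> p != 0 -> collin p q ->
  exists2 e : R, 0 < e & forall d : 'rV[R]_2, (forall i, `|d 0 i| < e) ->
    (C (w + d) <-> p * d 0 i0 + q * d 0 i1 = 0) /\
    (p * d 0 i0 + q * d 0 i1 = 0 -> forall u, maxterm (w + d) f u <-> maxterm w f u).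
Proof.
move=> /tropP[u [v [mu mv uv]]] p0 pq; have [e e0 he] := near_maxterm f w.
exists e => // d /he {}he.
have key u' v' : maxterm w f u' -> maxterm w f v' ->
    p * (mwt d u' - mwt d v') =
    ((u' i0)%:R - (v' i0)%:R) * (p * d 0 i0 + q * d 0 i1).
  move=> mu' mv'; rewrite !mwt2.
  transitivity (p * d 0 i0 * ((u' i0)%:R - (v' i0)%:R) +
    d 0 i1 * (((u' i1)%:R - (v' i1)%:R) * p)); first by ring.
  by rewrite -(pq _ _ mu' mv'); ring.
have same : p * d 0 i0 + q * d 0 i1 = 0 ->
    forall u', maxterm (w + d) f u' <-> maxterm w f u'.
  move=> d0 u'; split; first by move=> /he[].
  move=> mu'; apply/he; split=> // v' mv'.
  have /eqP := key _ _ mv' mu'; rewrite d0 mulr0 mulf_eq0 (negPf p0)/= subr_eq0.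
  by move=> /eqP ->.
split=> //; split=> [/tropP[u' [v' [/he[mu' hu'] /he[mv' hv'] uv']]]|d0]; last first.
  by apply/tropP; exists u, v; split=> //; exact/same.
have e' : mwt d u' = mwt d v' by apply: le_anti; rewrite hv'// hu'.
have /esym/eqP := key _ _ mu' mv'; rewrite e' subrr mulr0 mulf_eq0.
case/orP => [|/eqP//]; rewrite subr_eq0 eqr_nat => /eqP u0.
exfalso; move/eqP: uv'; apply; apply: mnm2P => //.
have := pq _ _ mu' mv'; rewrite u0 subrr mul0r => /esym/eqP.
by rewrite mulf_eq0 (negPf p0) orbF subr_eq0 eqr_nat => /eqP.
Qed.

(** Vertical lines are distinguished because X = Z = l projects onto them in both planes. Taking v'
    = v, the condition includes that v lies on the set. *)
Definition locvert (C' : set 'rV[R]_2) (v : 'rV[R]_2) := exists2 e : R, 0 < e &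
  forall v', close e v v' -> (C' v' <-> v' 0 i0 = v 0 i0).

Lemma yconst_collin b : yconst (init_form w f) b -> collin 1 0.
Proof.
by move=> hb u v /maxtermP/hb -> /maxtermP/hb ->; rewrite subrr mulr0 mul0r.
Qed.

Lemma yconst_near b : C w -> yconst (init_form w f) b ->
  exists2 e : R, 0 < e & forall w', close e w w' ->
    (C w' <-> w' 0 i0 = w 0 i0) /\
    (w' 0 i0 = w 0 i0 -> forall u, maxterm w' f u <-> maxterm w f u).
Proof.
move=> Cw hb; have [e e0 he] := collin_near Cw (oner_neq0 _) (yconst_collin hb).
exists e => // w' cw'; have [|] := he (w' - w).
  by move=> i; have := cw' i; rewrite !mxE.
have -> : 1 * (w' - w) 0 i0 + 0 * (w' - w) 0 i1 = w' 0 i0 - w 0 i0.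
  by rewrite !mxE; ring.
have -> : w + (w' - w) = w' by rewrite addrC subrK.
move=> h1 h2; split; last by move=> e1; apply: h2; rewrite e1 subrr.
by rewrite h1; split=> [/eqP|->]; rewrite ?subrr// subr_eq0 => /eqP.
Qed.

Lemma yconst_locvert b : C w -> yconst (init_form w f) b -> locvert C w.
Proof.
by move=> Cw hb; have [e e0 he] := yconst_near Cw hb; exists e => // w' /he[].
Qed.

(** If several powers of y occurred, the vertex t of the Newton polygon, rightmost in its top row,
    would be an end of a non-horizontal edge to some x. Its outer normal (1, s) is a direction in
    which the curve leaves w, and X changes along it. *)
Lemma locvert_yconst : locvert C w -> exists b, yconst (init_form w f) b.
Proof.
move=> [e e0 he]; set S := msupp (init_form w f).
have S0 : S != [::] by rewrite msupp_eq0; exact: init_form_neq0.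
have [t1 t1S t1max] := seq_argmax (fun u : 'X_{1..2} => (u i1)%:R) S0.
exists (t1 i1); apply: contrapT => /existsNP[v /not_implyP[vS /eqP vt]].
pose S1 := [seq u : 'X_{1..2} <- S | u i1 == t1 i1].
have [|t] := @seq_argmax _ S1 (fun u : 'X_{1..2} => (u i0)%:R).
  have h : t1 \in S1 by rewrite mem_filter eqxx.
  by apply/negP => /eqP E; rewrite E in h.
rewrite mem_filter => /andP[/eqP tt1 tS] tmax.
pose S2 := [seq u : 'X_{1..2} <- S | u i1 != t1 i1].
pose F (u : 'X_{1..2}) : R := ((u i0)%:R - (t i0)%:R) / ((t i1)%:R - (u i1)%:R).
have [|x] := @seq_argmax _ S2 F.
  have h : v \in S2 by rewrite mem_filter vt.
  by apply/negP => /eqP E; rewrite E in h.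
rewrite mem_filter => /andP[xt xS] xmax; set s := F x in xmax.
have lt u : u \in S2 -> 0 < (t i1)%:R - (u i1)%:R :> R.
  rewrite mem_filter => /andP[u1 uS]; rewrite subr_gt0 tt1 lt_neqAle t1max// andbT.
  by rewrite eqr_nat.
have xS2 : x \in S2 by rewrite mem_filter xt.
have dom u : u \in S -> (u i0)%:R + s * (u i1)%:R <= (t i0)%:R + s * (t i1)%:R.
  move=> uS; have [u1|u1] := eqVneq (u i1) (t1 i1).
    by rewrite u1 tt1 lerD2r; apply: tmax; rewrite mem_filter u1 eqxx.
  have uS2 : u \in S2 by rewrite mem_filter u1.
  by have := xmax _ uS2; rewrite /F ler_pdivrMr ?lt//; lra.
have tie : (x i0)%:R + s * (x i1)%:R = (t i0)%:R + s * (t i1)%:R :> R.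
  have : s * ((t i1)%:R - (x i1)%:R) = (x i0)%:R - (t i0)%:R.
    by rewrite /s /F divfK// gt_eqF// lt.
  lra.
have [e1 e10 he1] := near_maxterm f w.
pose b : R := Num.min e e1 / (1 + `|s| + 1).
have s0 : 0 < 1 + `|s| + 1 by have := normr_ge0 s; lra.
have b0 : 0 < b by rewrite divr_gt0// lt_min e0.
pose d : 'rV[R]_2 := \row_i if i == i0 then b else b * s.
have dlt i : `|d 0 i| < Num.min e e1.
  have bs : b * (1 + `|s| + 1) = Num.min e e1 by rewrite /b divfK ?gt_eqF.
  rewrite -bs mxE; case: (i == i0).
    by rewrite gtr0_norm// ltr_pMr//; have := normr_ge0 s; lra.
  by rewrite normrM gtr0_norm// ltr_pM2l//; lra.
have Cd : C (w + d).
  have mwtd u : mwt d u = b * ((u i0)%:R + s * (u i1)%:R).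
    by rewrite mwt2 !mxE/=; ring.
  have d1 i : `|d 0 i| < e1 by have := dlt i; rewrite lt_min => /andP[].
  apply/tropP; exists t, x; split.
  - apply/(he1 _ d1); split; first exact/maxtermP.
    by move=> u /maxtermP uS; rewrite !mwtd ler_pM2l// dom.
  - apply/(he1 _ d1); split; first exact/maxtermP.
    by move=> u /maxtermP uS; rewrite !mwtd ler_pM2l// tie dom.
  - by apply: contraNneq xt => <-; rewrite tt1.
have /he[/(_ Cd) h _] : close e w (w + d).
  move=> i; rewrite !mxE addrAC subrr add0r; have := dlt i.
  by rewrite lt_min mxE => /andP[].
move: h; rewrite !mxE/= => h; have : b = 0 by lra.
by move=> b0'; rewrite b0' ltxx in b0.
Qed.

Lemma locvert_locally_line (C' : set 'rV[R]_2) v : locvert C' v -> locally_line C' v.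
Proof.
move=> [e e0 he]; exists (\row_i (i == i1)%:R).
  by apply/eqP => /rowP/(_ i1); rewrite !mxE eqxx => /eqP; rewrite oner_eq0.
apply/near_closeP; exists e => // u /he ->; split=> [u0|[s ->]]; last first.
  by rewrite !mxE/= mulr0 addr0.
exists (u 0 i1 - v 0 i1); apply/rowP; apply: ord2P; rewrite !mxE/=; first by rewrite u0; ring.
by ring.
Qed.

End Plane.

End LocalGeometry.

(** * Slopes of a tropical polynomial along horizontal lines *)

Section Slopes.
Variables (R : realType).
Local Notation K := (gpuiseux R).
Local Notation k := R[i].
Implicit Types (f : {mpoly K[2]}) (w : 'rV[R]_2).

Definition pt2 (x y : R) : 'rV[R]_2 := \row_i (if i == i0 then x else y).

Lemma pt20 x y : pt2 x y 0 i0 = x. Proof. by rewrite mxE. Qed.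
Lemma pt21 x y : pt2 x y 0 i1 = y. Proof. by rewrite mxE. Qed.

Lemma pt2_eta w : pt2 (w 0 i0) (w 0 i1) = w.
Proof. by apply/rowP; apply: ord2P; rewrite ?pt20 ?pt21. Qed.

Lemma pt2D x y x' y' : pt2 x y + pt2 x' y' = pt2 (x + x') (y + y').
Proof. by apply/rowP; apply: ord2P; rewrite mxE ?pt20 ?pt21. Qed.

Lemma mwt_pt2 x y u : mwt (pt2 x y) u = x * (u i0)%:R + y * (u i1)%:R.
Proof. by rewrite mwt2 pt20 pt21. Qed.

(** The left slope at w of the tropical polynomial of f in the direction of X; [isxhigh] is the
    right slope. Relations are used because the existence of either needs f nonzero. *)
Definition isxlow f w a := (exists2 u, maxterm w f u & u i0 = a) /\
  forall u : 'X_{1..2}, maxterm w f u -> (a <= u i0)%N.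

Definition isxhigh f w a := (exists2 u, maxterm w f u & u i0 = a) /\
  forall u : 'X_{1..2}, maxterm w f u -> (u i0 <= a)%N.

Lemma isxlow_uniq f w a b : isxlow f w a -> isxlow f w b -> a = b.
Proof.
move=> [[u hu <-] ha] [[v hv <-] hb].
by apply/eqP; rewrite eqn_leq ha// hb.
Qed.

Lemma isxhigh_exists f w : f != 0 -> exists a, isxhigh f w a.
Proof.
move=> f0; have [|u uS hu] := @seq_argmax R _ (msupp (init_form w f))
    (fun u : 'X_{1..2} => (u i0)%:R).
  by rewrite msupp_eq0; exact: init_form_neq0.
exists (u i0); split; first by exists u => //; exact/maxtermP.
by move=> v /maxtermP/hu; rewrite ler_nat.
Qed.

Lemma isxlow_exists f w : f != 0 -> exists a, isxlow f w a.
Proof.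
move=> f0; have [|u uS hu] := @seq_argmax R _ (msupp (init_form w f))
    (fun u : 'X_{1..2} => - (u i0)%:R).
  by rewrite msupp_eq0; exact: init_form_neq0.
exists (u i0); split; first by exists u => //; exact/maxtermP.
by move=> v /maxtermP/hu; rewrite lerN2 ler_nat.
Qed.

(** Moving left keeps the maximal terms of least x-exponent, moving right those of greatest
    x-exponent. *)
Lemma near_slopes f x y a b : isxlow f (pt2 x y) a -> isxhigh f (pt2 x y) b ->
  exists2 e : R, 0 < e & forall h, 0 < h < e ->
    isxlow f (pt2 (x - h) y) a /\ isxlow f (pt2 (x + h) y) b.
Proof.
move=> [[u hu ua] ha] [[v hv vb] hb].
have [e e0 he] := near_maxterm f (pt2 x y); exists e => // h /andP[h0 heq].
have h0' : 0 <= h by exact: ltW.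
have small s : `|s| = h -> forall i, `|pt2 s 0 0 i| < e.
  by move=> sh; apply: ord2P; rewrite ?pt20 ?pt21 ?sh ?normr0.
have l : `|- h| = h by rewrite normrN ger0_norm.
have r : `|h| = h by rewrite ger0_norm.
have := he _ (small _ l); have := he _ (small _ r); rewrite !pt2D !addr0 => hr hl.
split; split.
- exists u => //; apply/hl; split=> // u' /ha; rewrite !mwt_pt2 !mul0r !addr0.
  by rewrite !mulNr lerN2 -ua => ?; rewrite ler_wpM2l// ler_nat.
- by move=> u' /hl[/ha].
- exists v => //; apply/hr; split=> // u' /hb; rewrite !mwt_pt2 !mul0r !addr0.
  by rewrite -vb => ?; rewrite ler_wpM2l// ler_nat.
- move=> u' /hr[_ /(_ _ hv)]; rewrite !mwt_pt2 !mul0r !addr0 ler_pM2l// ler_nat.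
  by rewrite vb.
Qed.

(** The value of the term u0 does not depend on x. Left of all numbers -|c(u0) - c(v)|, every term
    with a positive x-exponent is smaller. *)
Lemma isxlow_left f y (u0 : 'X_{1..2}) : u0 \in msupp f -> u0 i0 = 0%N ->
  exists b, forall x, x < b -> isxlow f (pt2 x y) 0.
Proof.
move=> uf u00.
have f0 : f != 0 by apply: contraTneq uf => ->; rewrite msupp0.
pose c v := tterm (pt2 0 y) f v.
have tE x v : tterm (pt2 x y) f v = c v + x * (v i0)%:R.
  have -> : pt2 x y = pt2 0 y + pt2 x 0 by rewrite pt2D add0r addr0.
  by rewrite tterm_add mwt_pt2 mul0r addr0.
have [|b _ hb] := @seq_has_min R [seq - `|c u0 - c v| | v <- msupp f].
  by case: (msupp f) uf.
have hb' v : v \in msupp f -> b <= - `|c u0 - c v|.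
  by move=> vf; apply: hb; apply/mapP; exists v.
exists b => x xb; split=> //.
have [u [umf umax]] := maxterm_exists (pt2 x y) f0; exists u; first by split.
apply/eqP; rewrite -leqn0 leqNgt; apply/negP => upos.
have := umax _ uf; rewrite !tE u00 mulr0 addr0 leNgt => /negP; apply.
have h1 : 1 <= (u i0)%:R :> R by rewrite ler1n.
have h2 := hb' _ umf; have h3 := ler_norm (c u - c u0); rewrite distrC in h3.
have h4 := normr_ge0 (c u0 - c u).
have x0 : x < 0 by lra.
have : x * (u i0)%:R <= x by rewrite -[leRHS]mulr1 ler_nM2l.
lra.
Qed.

(* The slope of the tropical polynomial along a horizontal line is 0 at -oo and
   is then determined by the jumps. *)
Lemma isxlow_same f1 f2 y : f1 != 0 -> f2 != 0 ->
  (exists2 u : 'X_{1..2}, u \in msupp f1 & u i0 = 0%N) ->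
  (exists2 u : 'X_{1..2}, u \in msupp f2 & u i0 = 0%N) ->
  (forall x a1 b1 a2 b2, isxlow f1 (pt2 x y) a1 -> isxhigh f1 (pt2 x y) b1 ->
    isxlow f2 (pt2 x y) a2 -> isxhigh f2 (pt2 x y) b2 -> (b1 + a2 = b2 + a1)%N) ->
  forall x a, isxlow f1 (pt2 x y) a -> isxlow f2 (pt2 x y) a.
Proof.
move=> f10 f20 [u1 u1f u10] [u2 u2f u20] jump.
(* The set of good x contains a half-line towards -oo and is open and closed; otherwise the infimum
   of its complement would be neither good nor bad. *)
pose good x := exists a, isxlow f1 (pt2 x y) a /\ isxlow f2 (pt2 x y) a.
suff all : forall x, good x.
  by move=> x a ha; have [b [h1 h2]] := all x; rewrite (isxlow_uniq ha h1).
move=> x0; have nearg x : exists2 e : R, 0 < e & forall z, `|z - x| < e -> good z <-> good x.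
  have [a1 ha1] := isxlow_exists (pt2 x y) f10.
  have [a2 ha2] := isxlow_exists (pt2 x y) f20.
  have [b1 hb1] := isxhigh_exists (pt2 x y) f10.
  have [b2 hb2] := isxhigh_exists (pt2 x y) f20.
  have J := jump _ _ _ _ _ ha1 hb1 ha2 hb2.
  have [e1 e10 he1] := near_slopes ha1 hb1.
  have [e2 e20 he2] := near_slopes ha2 hb2.
  have goodE : good x <-> a1 = a2.
    split=> [[a [h1 h2]]|e]; last by exists a1; split; rewrite // e.
    by rewrite (isxlow_uniq ha1 h1) (isxlow_uniq ha2 h2).
  exists (Num.min e1 e2); first by rewrite lt_min e10.
  move=> z; have [-> //|zx] := eqVneq z x; rewrite lt_min => /andP[ze1 ze2].
  rewrite goodE; have [lzx|lxz] := ltP z x.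
    have hz : z = x - `|z - x| by rewrite ltr0_norm ?subr_lt0//; ring.
    have hp : 0 < `|z - x| by rewrite normr_gt0 subr_eq0.
    have [h1 _] := he1 _ (introT andP (conj hp ze1)).
    have [h2 _] := he2 _ (introT andP (conj hp ze2)).
    rewrite -hz in h1 h2; split=> [[a [h3 h4]]|e]; last by exists a1; split; rewrite // e.
    by rewrite (isxlow_uniq h1 h3) (isxlow_uniq h2 h4).
  have hz : z = x + `|z - x| by rewrite ger0_norm ?subr_ge0//; ring.
  have hp : 0 < `|z - x| by rewrite normr_gt0 subr_eq0.
  have [_ h1] := he1 _ (introT andP (conj hp ze1)).
  have [_ h2] := he2 _ (introT andP (conj hp ze2)).
  rewrite -hz in h1 h2; split=> [[a [h3 h4]]|e].
    by move: J (isxlow_uniq h1 h3) (isxlow_uniq h2 h4); clear; lia.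
  have b12 : b1 = b2 by move: J e; clear; lia.
  by exists b1; split; rewrite // b12.
apply: contrapT => bad.
pose E := [set z | ~ good z].
have [B1 hB1] := isxlow_left y u1f u10.
have [B2 hB2] := isxlow_left y u2f u20.
have lbE : lbound E (Num.min B1 B2).
  move=> z /= nz; rewrite leNgt; apply/negP; rewrite lt_min => /andP[z1 z2].
  by apply: nz; exists 0%N; split; [exact: hB1|exact: hB2].
have iE : has_inf E by split; [exists x0|exists (Num.min B1 B2)].
have [e e0 he] := nearg (inf E).
have [gE|bE] := pselect (good (inf E)).
  have [z Ez zi] := inf_adherent e0 iE.
  apply: (Ez); apply/he => //.
  have := ge_inf iE.2 Ez => iz; rewrite ger0_norm ?subr_ge0//; lra.
have : E (inf E - e / 2).
  move=> /he; apply: contra_not bE; apply.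
  by rewrite addrAC subrr add0r normrN gtr0_norm; lra.
by move=> /(ge_inf iE.2); lra.
Qed.

Lemma avoid_seq (s : seq R) (y e : R) : 0 < e -> exists2 y', `|y' - y| < e & y' \notin s.
Proof.
move=> e0; pose t := e :: [seq d <- [seq `|x - y| | x <- s] | 0 < d].
have [|d dt hd] := @seq_has_min R t; first by [].
have d0 : 0 < d by move: dt; rewrite inE mem_filter => /orP[/eqP ->//|/andP[]].
have de : d <= e by apply: hd; rewrite inE eqxx.
have yy : `|y + d / 2 - y| = d / 2 by rewrite addrAC subrr add0r gtr0_norm// divr_gt0.
exists (y + d / 2); first by rewrite yy; lra.
apply/negP => ys; suff /hd : d / 2 \in t by lra.
rewrite inE mem_filter divr_gt0//=; apply/orP; right.
by apply/mapP; exists (y + d / 2); rewrite ?yy.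
Qed.

(** The excluded heights are those of horizontal edges ([s1]: ties of two terms with equal
    x-exponent) and of vertices ([s2]: ties of three non-collinear exponents). Each such tie
    determines y by a linear equation, in the second case by Cramer's rule. *)
Lemma generic_collin f : exists s : seq R, forall x y, y \notin s ->
  forall u v, maxterm (pt2 x y) f u -> maxterm (pt2 x y) f v -> u != v ->
  u i0 != v i0 /\ forall z : 'X_{1..2}, maxterm (pt2 x y) f z ->
    ((z i0)%:R - (v i0)%:R) * ((u i1)%:R - (v i1)%:R) =
    ((z i1)%:R - (v i1)%:R) * ((u i0)%:R - (v i0)%:R) :> R.
Proof.
pose c v := gp_val (f@_v).
pose r (u : 'X_{1..2}) i : R := (u i)%:R.
pose s1 := [seq (c u - c v) / (r u i1 - r v i1) | u <- msupp f, v <- msupp f].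
pose N u v z := (c u - c v) * (r z i0 - r v i0) - (c z - c v) * (r u i0 - r v i0).
pose D u v z := (r u i1 - r v i1) * (r z i0 - r v i0) - (r z i1 - r v i1) * (r u i0 - r v i0).
pose s2 := [seq N uv.1 uv.2 z / D uv.1 uv.2 z |
  uv <- [seq (u, v) | u <- msupp f, v <- msupp f], z <- msupp f].
exists (s1 ++ s2) => x y; rewrite mem_cat negb_or => /andP[ys1 ys2] u v mu mv uv.
have tie z z' : maxterm (pt2 x y) f z -> maxterm (pt2 x y) f z' ->
    x * (r z i0 - r z' i0) + y * (r z i1 - r z' i1) = c z - c z'.
  move=> mz mz'; have := maxterm_eq mz mz'; rewrite !ttermE !mwt_pt2 /c /r.
  by move: (gp_val _) (gp_val _) => a b; lra.
split.
  apply: contraNneq ys1 => u0; apply/allpairsP; exists (u, v).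
  split; [exact: mu.1|exact: mv.1|] => /=.
  have u1 : r u i1 - r v i1 != 0.
    rewrite subr_eq0 eqr_nat; apply: contra_neq uv => u1.
    exact: mnm2P.
  apply: (mulIf u1); rewrite divfK// -(tie _ _ mu mv).
  by rewrite /r u0 subrr mulr0 add0r.
move=> z mz; apply/eqP; rewrite -subr_eq0; apply/negPn/negP => D0.
move/negP: ys2; apply; apply/allpairsP; exists ((u, v), z).
split; [|exact: mz.1|] => /=.
  by apply/allpairsP; exists (u, v); split; [exact: mu.1|exact: mv.1|].
have D0' : D u v z != 0.
  by apply: contraNneq D0 => D0'; apply/eqP; rewrite -D0' /D /r; ring.
apply: (mulIf D0'); rewrite divfK// /N -(tie _ _ mu mv) -(tie _ _ mz mv) /D.
move: (r u i0) (r u i1) (r v i0) (r v i1) (r z i0) (r z i1) => u0 u1 v0 v1 z0 z1.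
by ring.
Qed.

End Slopes.

(** * Lengths at principal primes and sums of multiplicities *)

Section Lengths.
Variables (R : realType) (A : comNzRingType).
Implicit Types (P Q J U : set A) (a b s pi : A).

Lemma prime_idealMn P s s' : is_prime_ideal P -> ~ P s -> ~ P s' -> ~ P (s * s').
Proof. by move=> [_ _ h] Ps Ps' /h[]. Qed.

(* In A_P / Q A_P the maximal ideal is generated by pi, which is nilpotent of
   order m: the ideals are the powers of (pi). *)
Lemma local_length_eq P Q pi m : is_prime_ideal P -> is_ideal Q -> P pi ->
  (forall a, P a -> exists s b q, [/\ ~ P s, Q q & s * a = b * pi + q]) ->
  (exists2 s, ~ P s & Q (s * pi ^+ m)) ->
  (forall s j, (j < m)%N -> ~ P s -> ~ Q (s * pi ^+ j)) ->
  local_length R P Q = m%:R%:E.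
Proof.
move=> hP [Q0 QD QM] Ppi pigen [s0 s0P s0Q] pim.
have [[P0 PD PM] P1 Pprime] := hP.
(* The chain that attains the length: J_i is the contraction to A of the ideal generated by pi^(m-i)
   and Q in A_P. *)
pose J i : set A := [set a | exists s b q,
  [/\ ~ P s, Q q & s * a = b * pi ^+ (m - i) + q]].
apply/eqP; rewrite eq_le; apply/andP; split; last first.
  apply: ereal_sup_ubound; exists m => //; exists J; split=> [i im|i im].
    split; first split.
    - exists 1, 0, 0; split=> //; by rewrite !(mulr0, mul0r) addr0.
    - move=> a b [s [c [q [hs hq e]]]] [s' [c' [q' [hs' hq' e']]]].
      exists (s * s'), (s' * c + s * c'), (s' * q + s * q'); split.
      + exact: prime_idealMn.
      + by apply: QD; exact: QM.
      + transitivity (s' * (s * a) + s * (s' * b)); first by ring.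
        by rewrite e e'; ring.
    - move=> c a [s [b [q [hs hq e]]]]; exists s, (c * b), (c * q); split=> //.
        exact: QM.
      by rewrite mulrCA e; ring.
    - by move=> a Qa; exists 1, 0, a; rewrite mul1r mul0r add0r.
    - move=> s a hs [s' [b [q [hs' hq e]]]]; exists (s' * s), b, q.
      by rewrite -mulrA; split=> //; exact: prime_idealMn.
  have mi : (m - i = (m - i.+1).+1)%N by lia.
  split=> [a [s [b [q [hs hq e]]]]|]; last first.
    move=> sub; have : J i.+1 (pi ^+ (m - i.+1)).
      by exists 1, 1, 0; rewrite addr0.
    move=> /sub[s [b [q [hs hq e]]]].
    apply: (pim (s - b * pi) (m - i.+1)%N); first by lia.
      by move=> h; apply: hs; rewrite -(subrK (b * pi) s); apply: PD => //; exact: PM.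
    suff -> : (s - b * pi) * pi ^+ (m - i.+1) = q by [].
    by rewrite mulrBl e mi exprS; ring.
  exists s, (b * pi), q; split=> //; by rewrite e mi exprS; ring.
apply: ge_ereal_sup => _ [M [I [hI Iinc]] <-]; rewrite lee_fin ler_nat.
have satm i : (i <= M)%N -> I i (pi ^+ m).
  by move=> /hI[hid Qi sat]; apply: (sat s0) => //; exact: Qi.
(* The least e with pi^e in I_i is at most m for i = 0 and drops strictly along the chain, so a
   chain has at most m steps. *)
have claim i : (i <= M)%N -> exists2 e, (e + i <= m)%N &
    I i (pi ^+ e) /\ forall j, (j < e)%N -> ~ I i (pi ^+ j).
  elim: i => [|i IH] iM.
    have ex : exists e, `[< I 0%N (pi ^+ e) >] by exists m; apply/asboolP; exact: satm.
    have [e /asboolP he hmin] := ex_minnP ex; exists e.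
      by rewrite addn0; apply: hmin; apply/asboolP; exact: satm.
    by split=> // j je hj; have := hmin j (asboolT hj); rewrite leqNgt je.
  have [e em [he hlow]] := IH (ltnW iM).
  have [[I0 ID IM] Qi sat] := hI _ (ltnW iM).
  have [[I'0 I'D I'M] Qi' sat'] := hI _ iM.
  have [sub nsub] := Iinc _ iM.
  have ex : exists e, `[< I i.+1 (pi ^+ e) >] by exists m; apply/asboolP; exact: satm.
  have [e' /asboolP he' hmin] := ex_minnP ex; exists e'; last first.
    by split=> // j je hj; have := hmin j (asboolT hj); rewrite leqNgt je.
  suff : (e' < e)%N by lia.
  rewrite ltn_neqAle hmin ?andbT; last by apply/asboolP; exact: sub.
  apply/eqP => ee; apply: nsub => a Ia.
  (* If the exponent did not drop, every element of I_(i+1) would be divisible by pi^e modulo Q: a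
     cofactor outside P, a unit of A_P, would put pi^j with j < e into I_(i+1). *)
  have step j : (j <= e)%N -> exists s b q, [/\ ~ P s, Q q & s * a = b * pi ^+ j + q].
    elim: j => [|j IHj] je.
      by exists 1, a, 0; rewrite mul1r mulr1 addr0.
    have [s [b [q [hs hq eq1]]]] := IHj (ltnW je).
    have [Pb|nPb] := pselect (P b).
      have [s' [b' [q' [hs' hq' eq2]]]] := pigen _ Pb.
      exists (s' * s), b', (q' * pi ^+ j + s' * q); split.
      - exact: prime_idealMn.
      - by apply: QD; [rewrite mulrC; exact: QM|exact: QM].
      - by rewrite -mulrA eq1 mulrDr mulrA eq2 exprS; ring.
    exfalso; have : (e' <= j)%N.
      apply: hmin; apply/asboolP; apply: (sat' b) => //.
      have -> : b * pi ^+ j = s * a + (- 1) * q by rewrite eq1; ring.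
      by apply: I'D; [exact: I'M|apply: I'M; exact: Qi'].
    by rewrite ee leqNgt je.
  have [s [b [q [hs hq eq1]]]] := step _ (leqnn e).
  apply: (sat s) => //; rewrite eq1.
  by apply: ID; [exact: IM|exact: Qi].
by have [e em _] := claim M (leqnn M); lia.
Qed.

(** The primes of the localization of A at U. The set U is a parameter because, seen from the plane,
    the third coordinate of space is a function such as x + e and has to be inverted too. *)
Definition tprime U P := is_prime_ideal P /\ forall x, U x -> ~ P x.

Definition tminprime U Q P := [/\ tprime U P, Q `<=` P &
  forall P', tprime U P' -> Q `<=` P' -> P' `<=` P -> P' = P].

Definition gmult U Q : \bar R := \esum_(P in tminprime U Q) local_length R P Q.

Lemma prime_prod P (I : eqType) (rs : seq I) (F : I -> A) (m : I -> nat) :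
  is_prime_ideal P -> P (\prod_(r <- rs) F r ^+ m r) ->
  exists2 r, r \in rs & P (F r).
Proof.
move=> [[P0 PD PM] P1 Pprime]; elim: rs => [|r rs IH]; first by rewrite big_nil.
rewrite big_cons => /Pprime[|/IH[r' r'rs h]]; last first.
  by exists r'; rewrite // inE r'rs orbT.
elim: (m r) => [|j IHj]; first by rewrite expr0.
by rewrite exprS => /Pprime[h|/IHj//]; exists r; rewrite // inE eqxx.
Qed.

(** Elements s outside all these primes are units of the localization. There Q contains the product
    of the pi_r^(m_r), each [Pr r] is generated by pi_r modulo Q, and the last hypothesis excludes
    smaller exponents. Hence the [Pr r] are the minimal primes, of lengths m_r. *)
Lemma gmult_eq U Q (I : choiceType) (rs : seq I) (Pr : I -> set A) (pi : I -> A)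
    (m : I -> nat) : is_ideal Q -> uniq rs ->
  (forall r, r \in rs -> [/\ tprime U (Pr r), Q `<=` Pr r, Pr r (pi r) & (0 < m r)%N]) ->
  (forall r r', r \in rs -> r' \in rs -> r != r' -> ~ Pr r (pi r')) ->
  (forall r a, r \in rs -> Pr r a -> exists s b q,
     [/\ forall P, tprime U P -> ~ P s, Q q & s * a = b * pi r + q]) ->
  (exists2 s, forall P, tprime U P -> ~ P s & Q (s * \prod_(r <- rs) pi r ^+ m r)) ->
  (forall r s j, r \in rs -> (j < m r)%N -> ~ Pr r s -> ~ Q (s * pi r ^+ j)) ->
  gmult U Q = (\sum_(r <- rs) m r)%:R%:E.
Proof.
move=> hQ urs hPr hneq hgen [s0 s0P s0Q] hlow.
have Pinj r r' : r \in rs -> r' \in rs -> Pr r `<=` Pr r' -> r = r'.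
  move=> rrs r'rs sub; apply/eqP/negPn/negP => rr'.
  have [_ _ h _] := hPr _ rrs.
  by apply: (hneq r' r) => //; [rewrite eq_sym|exact: sub].
have dom P : tprime U P -> Q `<=` P -> exists2 r, r \in rs & Pr r `<=` P.
  move=> tP QP; have [[[P0 PD PM] P1 Pprime] _] := tP.
  have := QP _ s0Q => /Pprime[/s0P//|/(prime_prod tP.1)[r rrs Pp]].
  exists r => // a /(hgen _ _ rrs)[s [b [q [hs hq e]]]].
  have : P (s * a) by rewrite e; apply: PD; [exact: PM|exact: QP].
  by move=> /Pprime[/hs//|].
have bij : set_bij [set` rs] (tminprime U Q) Pr.
  split=> [r /= rrs|r r' /set_mem rrs /set_mem r'rs e|P [tP QP Pmin]].
  - have [tr Qr _ _] := hPr _ rrs; split=> // P' tP' QP' sub.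
    have [r' r'rs sub'] := dom _ tP' QP'.
    have rr : r' = r by apply: Pinj => //; exact: subset_trans sub' sub.
    by apply/seteqP; split=> //; rewrite -rr.
  - by apply: Pinj => //; rewrite e.
  - have [r rrs sub] := dom _ tP QP; exists r => //.
    by have [tr Qr _ _] := hPr _ rrs; exact: Pmin.
have len r : r \in rs -> local_length R (Pr r) Q = (m r)%:R%:E.
  move=> rrs; have [tr Qr Ppi mpos] := hPr _ rrs.
  have [hpr hU] := tr.
  apply: (@local_length_eq _ _ (pi r)) => //.
  - move=> a /(hgen _ _ rrs)[s [b [q [hs hq e]]]]; exists s, b, q; split=> //.
    exact: hs.
  - exists (s0 * \prod_(r' <- rs | r' != r) pi r' ^+ m r').
      apply: prime_idealMn => //; first exact: s0P.
      rewrite -big_filter => /(prime_prod hpr)[r'].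
      by rewrite mem_filter => /andP[r'r r'rs]; apply: hneq; rewrite // eq_sym.
    move: s0Q; rewrite (bigD1_seq r)//=; congr Q; ring.
  - by move=> s j jm; exact: hlow.
rewrite /gmult (reindex_esum _ _ _ _ bij) esum_fset; last 2 first.
- exact: finite_seq.
- by move=> r /set_mem rrs; rewrite len// lee_fin.
rewrite -fsbig_seq// big_seq (eq_bigr (fun r => (m r)%:R%:E)).
  by rewrite sumEFin -natr_sum -big_seq.
by move=> r /len.
Qed.

End Lengths.

(** * Invariance of lengths and multiplicities under surjections *)

Section Transfer.
Variables (R : realType) (A B : comNzRingType) (phi : {rmorphism A -> B}).
Hypothesis phi_surj : forall b, exists a, phi a = b.

Let preim_inj (J J' : set B) : phi @^-1` J = phi @^-1` J' -> J = J'.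
Proof.
move=> e; apply/seteqP; split=> b; have [a <-] := phi_surj b => h.
  by have : (phi @^-1` J) a by []; rewrite e.
by have : (phi @^-1` J') a by []; rewrite -e.
Qed.

Let preim_sub (J J' : set B) : phi @^-1` J `<=` phi @^-1` J' <-> J `<=` J'.
Proof.
split=> [h b|h a /h//]; have [a <-] := phi_surj b => hb.
exact: h.
Qed.

Let preim_ideal (J : set B) : is_ideal (phi @^-1` J) <-> is_ideal J.
Proof.
split=> -[h0 hD hM]; split; rewrite /preimage/=.
- by have := h0; rewrite /preimage/= rmorph0.
- move=> a b; have [[a' <-] [b' <-]] := (phi_surj a, phi_surj b) => ha hb.
  by have := hD a' b' ha hb; rewrite /preimage/= rmorphD.
- move=> c a; have [[a' <-] [c' <-]] := (phi_surj a, phi_surj c) => ha.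
  by have := hM c' a' ha; rewrite /preimage/= rmorphM.
- by rewrite rmorph0.
- by move=> a b ha hb; rewrite rmorphD; exact: hD.
- by move=> c a ha; rewrite rmorphM; exact: hM.
Qed.

Let preim_prime (P : set B) : is_prime_ideal (phi @^-1` P) <-> is_prime_ideal P.
Proof.
split=> -[/preim_ideal hI h1 hM]; split=> //.
- by move=> h; apply: h1; rewrite /preimage/= rmorph1.
- move=> a b; have [[a' <-] [b' <-]] := (phi_surj a, phi_surj b) => h.
  by apply: hM; rewrite /preimage/= rmorphM.
- by rewrite /preimage/= rmorph1.
- by move=> a b; rewrite /preimage/= rmorphM; exact: hM.
Qed.

Let preim_sat (P J : set B) : saturated (phi @^-1` P) (phi @^-1` J) <-> saturated P J.
Proof.
split=> h s a; last by rewrite /preimage/= rmorphM; exact: h.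
have [[a' <-] [s' <-]] := (phi_surj a, phi_surj s) => hs hsa.
by apply: (h s' a') => //; rewrite /preimage/= rmorphM.
Qed.

(* The ideals of A containing the kernel of phi are preimages. *)
Let preim_image (Q : set B) (J : set A) : is_ideal Q -> is_ideal J ->
  phi @^-1` Q `<=` J -> phi @^-1` (phi @` J) = J.
Proof.
move=> [Q0 _ _] [J0 JD JM] QJ; apply/seteqP; split=> [a [a' Ja' e]|a Ja]; last by exists a.
rewrite -(subrK a' a); apply: JD => //; apply: QJ.
by rewrite /preimage/= rmorphB e subrr.
Qed.

Lemma local_length_preim (P Q : set B) : is_ideal Q ->
  local_length R (phi @^-1` P) (phi @^-1` Q) = local_length R P Q.
Proof.
move=> hQ; congr ereal_sup; apply/seteqP; split=> _ [m [J [hJ Jinc]] <-]; exists m => //.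
  have JE i : (i <= m)%N -> phi @^-1` (phi @` J i) = J i.
    by move=> /hJ[hI QI _]; exact: preim_image hI QI.
  exists (fun i => phi @` J i); split=> [i im|i im].
    have := hJ _ im; rewrite -(JE _ im) => -[/preim_ideal h1 /preim_sub h2 /preim_sat h3].
    by rewrite (JE _ im).
  have := Jinc _ im; rewrite -(JE i (ltnW im)) -(JE i.+1 im) => -[h1 h2].
  rewrite (JE i (ltnW im)) (JE i.+1 im).
  split; first exact/preim_sub.
  by move=> h; apply: h2; exact/preim_sub.
exists (fun i => phi @^-1` J i); split=> [i im|i im].
  have [h1 h2 h3] := hJ _ im.
  by split; [exact/preim_ideal|exact/preim_sub|exact/preim_sat].
have [h1 h2] := Jinc _ im; split; first exact/preim_sub.
by move=> h; apply: h2; exact/preim_sub.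
Qed.

(** Preimages identify the ideals containing Q with those containing its preimage and respect
    primality and saturation; avoiding U upstairs is avoiding its image downstairs. *)
Lemma gmult_preim (U : set A) (Q : set B) : is_ideal Q ->
  gmult R U (phi @^-1` Q) = gmult R (phi @` U) Q.
Proof.
move=> hQ.
have tE (P : set B) : tprime U (phi @^-1` P) <-> tprime (phi @` U) P.
  split=> -[/preim_prime hP hU]; split=> //.
    by move=> _ [x Ux <-]; exact: hU.
  by move=> x Ux; apply: hU; exists x.
have lift (P' : set A) : tprime U P' -> phi @^-1` Q `<=` P' ->
    exists2 P : set B, P' = phi @^-1` P & tprime (phi @` U) P.
  move=> tP' QP'; exists (phi @` P').
    by rewrite (preim_image hQ)//; case: tP' => -[].
  by apply/tE; rewrite (preim_image hQ)//; case: tP' => -[].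
rewrite /gmult; rewrite (reindex_esum (tminprime (phi @` U) Q) (tminprime U (phi @^-1` Q)) (fun P => phi @^-1` P)).
  by apply: eq_esum => P _; rewrite local_length_preim.
split=> [P [tP QP Pmin]|P P' _ _|P' [tP' QP' Pmin]]; first 2 last.
- have [P e tP] := lift _ tP' QP'; subst P'; exists P => //; split=> //.
    exact/preim_sub.
  move=> P2 tP2 QP2 sub; apply: preim_inj; apply: Pmin; first exact/tE.
    exact/preim_sub.
  exact/preim_sub.
- split; [exact/tE|exact/preim_sub|].
  move=> P' tP' QP'; have [P2 e tP2] := lift _ tP' QP'; subst P' => sub.
  congr (_ @^-1` _); apply: Pmin => //; last exact/preim_sub.
  exact/preim_sub.
- exact: preim_inj.
Qed.

End Transfer.

(** * Polynomials supported on a segment split into binomials *)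

Section CollinearFactorization.
Variable k : closedFieldType.
Local Notation M2 := {mpoly k[2]}.

Definition mon2 (i j : nat) : 'X_{1..2} := [multinom (if e == i0 then i else j) | e < 2].

Lemma mon20 i j : mon2 i j i0 = i. Proof. by rewrite mnmE. Qed.
Lemma mon21 i j : mon2 i j i1 = j. Proof. by rewrite mnmE. Qed.

Lemma mon2D i j i' j' : (mon2 i j + mon2 i' j')%MM = mon2 (i + i') (j + j').
Proof. by apply: mnm2P; rewrite mnmDE ?mon20 ?mon21. Qed.

Lemma mon2Mn i j n : (mon2 i j *+ n)%MM = mon2 (i * n) (j * n).
Proof. by apply: mnm2P; rewrite mulmnE ?mon20 ?mon21. Qed.

(** The homogenization of P in degree n, evaluated at (A, B). *)
Definition hompol (A B : M2) n (P : {poly k}) : M2 :=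
  \sum_(j < n.+1) P`_j *: (A ^+ j * B ^+ (n - j)).

Lemma hompolM (A B : M2) n (P : {poly k}) z : (size P <= n.+1)%N ->
  hompol A B n.+1 (P * ('X - z%:P)) = hompol A B n P * (A - z *: B).
Proof.
move=> sP; have coefE' j : (P * ('X - z%:P))`_j = (if j == 0 then 0 else P`_j.-1) - z * P`_j.
  by rewrite mulrBr coefB coefMX coefMC mulrC.
rewrite /hompol; under eq_bigr do rewrite coefE' scalerBl.
rewrite sumrB mulrBr; congr (_ - _).
  rewrite big_ord_recl/= scale0r add0r mulr_suml; apply: eq_bigr => j _.
  by rewrite /bump/= add1n subSS exprS -scalerAl; congr (_ *: _); ring.
rewrite big_ord_recr/= (nth_default _ sP) mulr0 scale0r addr0 mulr_suml.
apply: eq_bigr => j _; rewrite subSn; last by rewrite -ltnS.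
by rewrite exprS -!scalerAl -scalerAr scalerA [z * _]mulrC; congr (_ *: _); ring.
Qed.

Lemma hompol_prod (A B : M2) (rs : seq k) :
  hompol A B (size rs) (\prod_(z <- rs) ('X - z%:P)) = \prod_(z <- rs) (A - z *: B).
Proof.
elim: rs => [|z rs IH].
  by rewrite !big_nil /hompol big_ord_recl big_ord0 coef1/= scale1r mulr1 addr0.
rewrite !big_cons mulrC [RHS]mulrC -IH -hompolM//.
by rewrite size_prod_XsubC.
Qed.

Lemma hompolZ (A B : M2) n c (P : {poly k}) : hompol A B n (c *: P) = c *: hompol A B n P.
Proof.
by rewrite /hompol scaler_sumr; apply: eq_bigr => j _; rewrite coefZ scalerA.
Qed.

Section Line.
Variables (q : M2) (p cp cm a m : nat).
Hypothesis p0 : (0 < p)%N.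
Hypothesis line : forall u v : 'X_{1..2}, u \in msupp q -> v \in msupp q ->
  ((u i0)%:Z - (v i0)%:Z) * (cp%:Z - cm%:Z) = ((u i1)%:Z - (v i1)%:Z) * p%:Z.
Hypothesis cpm : cp = 0%N \/ cm = 0%N.
Hypothesis coprime_pc : coprime p (cp + cm).
Variables (ul uh : 'X_{1..2}).
Hypotheses (ulq : ul \in msupp q) (uhq : uh \in msupp q).
Hypotheses (ula : ul i0 = a) (uhb : uh i0 = (a + p * m)%N).
Hypothesis bounds : forall u : 'X_{1..2}, u \in msupp q -> (a <= u i0 <= a + p * m)%N.

Let S := mon2 a (ul i1 - cm * m).
Let mA := mon2 p cp.
Let mB := mon2 0 cm.
Let A : M2 := 'X_[mA].
Let B : M2 := 'X_[mB].
Let h := \poly_(j < m.+1) q@_(S + mA *+ j + mB *+ (m - j))%MM.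

(** Makes the truncated subtraction in [S] exact: for cp = 0 the y-exponent drops by cm m from [ul]
    to [uh]. *)
Let cmm : (cm * m <= ul i1)%N.
Proof.
have := line uhq ulq; rewrite uhb ula.
have [cp0|cm0] := cpm; last by rewrite cm0.
rewrite cp0; have pp : 0 < p%:Z by lia.
move=> e; have : (uh i1)%:Z - (ul i1)%:Z = - (m%:Z * cm%:Z).
  by apply: (mulIf (lt0r_neq0 pp)); rewrite -e; lia.
lia.
Qed.

Let expo j : (j <= m)%N -> (S + mA *+ j + mB *+ (m - j))%MM =
  mon2 (a + p * j) (ul i1 - cm * m + cp * j + cm * (m - j)).
Proof. by move=> _; rewrite !mon2Mn !mon2D mul0n addn0. Qed.

Let on_line u : u \in msupp q -> exists2 j, (j <= m)%N & u = (S + mA *+ j + mB *+ (m - j))%MM.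
Proof.
move=> uq; have /andP[au ub] := bounds uq.
have e := line uq ulq; rewrite ula in e.
have pc : coprimez p%:Z (cp%:Z - cm%:Z).
  rewrite coprimezE; have [cp0|cm0] := cpm.
    by move: coprime_pc; rewrite cp0 add0r abszN add0n.
  by move: coprime_pc; rewrite cm0 subr0 addn0.
have : (p%:Z %| ((u i0)%:Z - a%:Z))%Z.
  rewrite -(Gauss_dvdzl _ pc) e; exact: dvdz_mull.
move=> /dvdzP[d de].
have pp : 0 < p%:Z by lia.
have d0 : 0 <= d by rewrite -(pmulr_lge0 _ pp) -de; lia.
have [j jd] : exists j : nat, d = j%:Z by exists `|d|%N; rewrite gez0_abs.
subst d.
have uj : u i0 = (a + p * j)%N by lia.
have jm : (j <= m)%N by rewrite -(leq_pmul2l p0) -(leq_add2l a) -uj.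
have u1 : (u i1)%:Z - (ul i1)%:Z = j%:Z * (cp%:Z - cm%:Z).
  apply: (mulIf (lt0r_neq0 pp)); rewrite -e de; ring.
exists j => //; rewrite expo//; apply: mnm2P; rewrite ?mon20 ?mon21//.
have := cmm; have := mulnBr cm m j.
have [cp0|cm0] := cpm; [rewrite cp0 in u1 *|rewrite cm0 in u1 *]; nia.
Qed.

Let qE : q = 'X_[S] * hompol A B m h.
Proof.
rewrite /hompol mulr_sumr; apply/mpolyP => v.
have termE (j : 'I_m.+1) : 'X_[S] * (h`_j *: (A ^+ j * B ^+ (m - j))) =
    q@_(S + mA *+ j + mB *+ (m - j))%MM *: 'X_[S + mA *+ j + mB *+ (m - j)] :> M2.
  by rewrite coef_poly ltn_ord -scalerAr !mpolyXn -!mpolyXD addmA.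
under eq_bigr do rewrite termE.
rewrite raddf_sum/=; under eq_bigr do rewrite mcoeffZ mcoeffX.
have [vq|vq] := boolP (v \in msupp q).
  have [j jm ve] := on_line vq.
  rewrite (bigD1 (Ordinal (jm : (j < m.+1)%N)))//= -ve eqxx mulr1 big1 ?addr0// => i ij.
  case: eqP => [e|_]; last by rewrite mulr0.
  move: e; rewrite ve expo -1?ltnS// expo// => /(congr1 (fun u : 'X_{1..2} => u i0)).
  rewrite !mon20 => /addnI/eqP; rewrite eqn_pmul2l// => /eqP e.
  by move: ij; rewrite -val_eqE/= e eqxx.
rewrite memN_msupp_eq0// big1// => j _; case: eqP => [e|_]; last by rewrite mulr0.
by rewrite e memN_msupp_eq0// mul0r.
Qed.

(** The step (p, cp - cm) along the segment is split into its positive and negative parts to keep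
    exponents natural, and it is primitive, so all exponents are reached by integral multiples. Thus
    q is a monomial times the homogenization of [h] at (x^p y^cp, y^cm), and [h] splits over k; its
    roots are nonzero as both ends of the segment occur in q. *)
Lemma collinear_factor : exists rs (c : k), [/\ size rs = m, c != 0,
  forall z, z \in rs -> z != 0,
  q = c *: 'X_[S] * \prod_(z <- rs) (A - z *: B) &
  h = c *: \prod_(z <- rs) ('X - z%:P)].
Proof.
have hm : h`_m != 0.
  have [j jm e] := on_line uhq; have jm' : j = m.
    move: uhb; rewrite e expo// mon20 => /addnI/eqP; rewrite eqn_pmul2l// => /eqP//.
  by rewrite coef_poly ltnSn; move: e; rewrite jm' => <-; rewrite -mcoeff_msupp.
have h0 : h`_0 != 0.
  have [j jm e] := on_line ulq; have j0 : j = 0%N.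
    move: ula; rewrite e expo// mon20 -[RHS]addn0 => /addnI/eqP.
    by rewrite muln_eq0 (gtn_eqF p0) => /eqP.
  by rewrite coef_poly/=; move: e; rewrite j0 => <-; rewrite -mcoeff_msupp.
have sh : size h = m.+1.
  apply/eqP; rewrite eqn_leq size_poly/=; rewrite ltnNge; apply/negP => /leq_sizeP/(_ m (leqnn _)).
  by move/eqP; rewrite (negPf hm).
have [rs hE] := closed_field_poly_normal h.
have hn0 : h != 0 by rewrite -size_poly_gt0 sh.
have lh : lead_coef h != 0 by rewrite lead_coef_eq0.
have srs : size rs = m.
  by move: sh; rewrite hE size_scale// size_prod_XsubC => -[].
exists rs, (lead_coef h); split=> //.
  move=> z zrs; apply: contraNneq h0 => z0.
  rewrite hE -horner_coef0 hornerZ mulf_eq0; apply/orP; right.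
  by rewrite -/(root _ _) root_prod_XsubC -z0.
transitivity ('X_[S] * hompol A B m (lead_coef h *: \prod_(z <- rs) ('X - z%:P))).
  by rewrite {1}qE -hE.
by rewrite hompolZ -srs hompol_prod -scalerAr -scalerAl.
Qed.

End Line.

End CollinearFactorization.

(** * Primes of binomials and multiplicities of products of binomials *)

Section CollinearMultiplicity.
Variable R : realType.
Local Notation k := R[i].
Local Notation M2 := {mpoly k[2]}.
Local Notation F := {fraction {poly k}}.
Local Notation tofrac := (@FracField.tofrac {poly k}).
Local Notation "x %:F" := (tofrac x).

Lemma mpolyX2E (u : 'X_{1..2}) : 'X_[u] = 'X_i0 ^+ u i0 * 'X_i1 ^+ u i1 :> M2.
Proof. by rewrite mpolyXE_id big_ord2. Qed.

Section Line.
Variables (p cp cm : nat).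
Hypothesis p0 : (0 < p)%N.
Hypothesis cpm : cp = 0%N \/ cm = 0%N.
Hypothesis coprime_pc : coprime p (cp + cm).

Let A : M2 := 'X_[mon2 p cp].
Let B : M2 := 'X_[mon2 0 cm].
Definition linefactor (r : k) : M2 := A - r *: B.
Let T : F := ('X : {poly k})%:F.

Let T0 : T != 0. Proof. by rewrite /T tofrac_eq0 polyX_eq0. Qed.

Definition root_of (r : k) : k := xget 0 [set e | e ^+ p = r].

Lemma root_ofE r : root_of r ^+ p = r.
Proof.
rewrite /root_of; case: xgetP => [e -> //|/(_ _) h]; exfalso.
have : size ('X^p - r%:P : {poly k}) != 1%N.
  by rewrite size_XnsubC// eqSS -lt0n.
by case/closed_rootP => e; rewrite /root !hornerE subr_eq0 => /eqP /h.
Qed.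

(* The generic point of the curve x^p y^cp = r y^cm. *)
Definition line_eval (r : k) : M2 -> F :=
  mmap (tofrac \o polyC) (fun i => if i == i0
    then ((root_of r)%:P)%:F * T ^+ cm / T ^+ cp else T ^+ p).

HB.instance Definition _ r := GRing.RMorphism.on (line_eval r).

(** A kernel of a map into a field, hence prime without an irreducibility argument for the
    binomial. *)
Definition line_prime (r : k) : set M2 := [set a | line_eval r a = 0].

Lemma line_evalX r : line_eval r 'X_i0 = ((root_of r)%:P)%:F * T ^+ cm / T ^+ cp.
Proof. by rewrite /line_eval mmapX mmap1U. Qed.

Lemma line_evalY r : line_eval r 'X_i1 = T ^+ p.
Proof. by rewrite /line_eval mmapX mmap1U. Qed.

Lemma line_evalZ r c a : line_eval r (c *: a) = (c%:P)%:F * line_eval r a.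
Proof. by rewrite /line_eval mmapZ. Qed.

Lemma line_evalA r : line_eval r A = (r%:P)%:F * T ^+ (cm * p).
Proof.
rewrite /A mpolyX2E mon20 mon21 rmorphM !rmorphXn/= line_evalX line_evalY.
rewrite !exprMn exprVn -!exprM [(p * cp)%N]mulnC mulfVK ?expf_neq0//.
by rewrite -rmorphXn/= -rmorphXn/= root_ofE.
Qed.

Lemma line_evalB r : line_eval r B = T ^+ (cm * p).
Proof.
rewrite /B mpolyX2E mon20 mon21 expr0 mul1r !rmorphXn/= line_evalY -exprM.
by rewrite mulnC.
Qed.

Lemma line_eval_factor r s : line_eval r (linefactor s) = ((r - s)%:P)%:F * T ^+ (cm * p).
Proof.
by rewrite rmorphB/= line_evalZ line_evalA line_evalB -mulrBl polyCB rmorphB.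
Qed.

Lemma line_prime_factor r s : line_prime r (linefactor s) <-> r = s.
Proof.
rewrite /line_prime/= line_eval_factor; split=> [/eqP|->]; last first.
  by rewrite subrr polyC0 rmorph0 mul0r.
by rewrite mulf_eq0 expf_eq0 (negPf T0) andbF orbF tofrac_eq0 polyC_eq0 subr_eq0 => /eqP.
Qed.

Lemma line_prime_ideal r : is_ideal (line_prime r).
Proof.
rewrite /line_prime; split=> /=; first by rewrite rmorph0.
  by move=> a b ha hb; rewrite rmorphD/= ha hb addr0.
by move=> c a ha; rewrite rmorphM/= ha mulr0.
Qed.

Lemma line_prime_prime r : is_prime_ideal (line_prime r).
Proof.
split; first exact: line_prime_ideal.
  by rewrite /line_prime/= rmorph1 => /eqP; rewrite oner_eq0.
move=> a b; rewrite /line_prime/= rmorphM/= => /eqP.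
by rewrite mulf_eq0 => /orP[]/eqP; [left|right].
Qed.

Lemma line_primeX r : r != 0 -> ~ line_prime r 'X_i0.
Proof.
move=> r0; rewrite /line_prime/= line_evalX => /eqP.
rewrite !mulf_eq0 invr_eq0 !expf_eq0 (negPf T0) !andbF !orbF tofrac_eq0 polyC_eq0.
by move=> /eqP e; move/eqP: r0; apply; rewrite -(root_ofE r) e expr0n gtn_eqF.
Qed.

Lemma line_primeY r : ~ line_prime r 'X_i1.
Proof.
by rewrite /line_prime/= line_evalY => /eqP; rewrite expf_eq0 (negPf T0) andbF.
Qed.

Definition lowdeg (a : M2) := forall u, u \in msupp a -> (u i0 < p)%N.

Lemma lowdegD a b : lowdeg a -> lowdeg b -> lowdeg (a + b).
Proof.
by move=> ha hb u /msuppD_le; rewrite mem_cat => /orP[/ha|/hb].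
Qed.

Lemma lowdegZ c a : lowdeg a -> lowdeg (c *: a).
Proof. by move=> ha u /msuppZ_le /ha. Qed.

Lemma lowdegMY a n : lowdeg a -> lowdeg ('X_i1 ^+ n * a).
Proof.
move=> ha u; rewrite mulrC mpolyXn (perm_mem (msuppMX _ _)) => /mapP[v /ha va ->].
by rewrite mnmDE mulmnE mnm1E.
Qed.

(** Division with remainder in x by x^p y^cp - r y^cm; the powers of y compensate for its leading
    coefficient y^cp. *)
Lemma line_division r a : exists N b d, lowdeg d /\
  'X_i1 ^+ N * a = b * linefactor r + d.
Proof.
elim/mpolyind: a => [|c u a _ _ [N [b [d [hd e]]]]].
  by exists 0%N, 0, 0; split; [move=> u; rewrite msupp0|rewrite mulr0 mul0r addr0].
suff [N' [b' [d' [hd' e']]]] : exists N b d, lowdeg d /\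
    'X_i1 ^+ N * 'X_[u] = b * linefactor r + d.
  exists (N + N')%N, (c *: ('X_i1 ^+ N * b') + 'X_i1 ^+ N' * b),
    (c *: ('X_i1 ^+ N * d') + 'X_i1 ^+ N' * d); split.
    by apply: lowdegD; [apply: lowdegZ|]; exact: lowdegMY.
  transitivity (c *: ('X_i1 ^+ N * ('X_i1 ^+ N' * 'X_[u])) + 'X_i1 ^+ N' * ('X_i1 ^+ N * a)).
    by rewrite exprD mulrDr -scalerAr !mulrA ['X_i1 ^+ N' * 'X_i1 ^+ N]mulrC.
  rewrite e e'; move: (linefactor r) => f.
  by rewrite !mulrDr !scalerDr mulrDl -scalerAl !mulrA addrACA.
have [n] := ubnP (u i0); elim: n u => // n IH u un.
have [up|pu] := ltnP (u i0) p.
  exists 0%N, 0, 'X_[u]; rewrite mul1r mul0r add0r; split=> // v.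
  by rewrite msuppX inE => /eqP ->.
(* One division step trades x^p y^cp for r y^cm. *)
pose v := mon2 (u i0 - p) (u i1 + cm).
have [|N1 [b1 [d1 [hd1 e1]]]] := IH v.
  by rewrite mon20; lia.
exists (N1 + cp)%N, ('X_i1 ^+ N1 * 'X_[mon2 (u i0 - p) (u i1)] + r *: b1), (r *: d1).
split; first exact: lowdegZ.
transitivity ('X_i1 ^+ N1 * ('X_[mon2 (u i0 - p) (u i1)] * A)).
  rewrite -mpolyXD exprD -mulrA; congr (_ * _).
  rewrite mpolyXn -mpolyXD; congr 'X_[_]; apply: mnm2P; rewrite !mnmDE !mulmnE !mnm1E ?mon20 ?mon21/=; lia.
have -> : A = linefactor r + r *: B by rewrite /linefactor subrK.
have vE : 'X_[mon2 (u i0 - p) (u i1)] * B = 'X_[v] :> M2.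
  by rewrite -mpolyXD; congr 'X_[_]; rewrite mon2D addn0.
rewrite mulrDr -scalerAr vE mulrDr -scalerAr e1 scalerDr mulrDl -scalerAl.
by rewrite !mulrA addrA.
Qed.

(** As p is coprime to the slope, monomials x^i y^j with i < p go to nonzero multiples of distinct
    powers of T; a remainder vanishing at the generic point is therefore 0. *)
Lemma line_prime_lowdeg r d : r != 0 -> lowdeg d -> line_prime r d -> d = 0.
Proof.
move=> r0 hd; rewrite /line_prime/= => ld.
have rho0 : root_of r != 0.
  by apply: contraNneq r0 => e; rewrite -(root_ofE r) e expr0n gtn_eqF.
(* The exponent of T in the image of the monomial u, after multiplication by T^(cp p) to clear
   denominators. *)
pose e (u : 'X_{1..2}) := (cp * (p - u i0) + cm * u i0 + p * u i1)%N.
have : T ^+ (cp * p) * line_eval r d =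
    (\sum_(u <- msupp d) (d@_u * root_of r ^+ u i0) *: 'X^(e u))%:F.
  rewrite /line_eval /mmap mulr_sumr rmorph_sum !big_seq; apply: eq_bigr => u ud.
  have up := hd _ ud.
  have cE : (cp * p = cp * (p - u i0) + cp * u i0)%N by rewrite -mulnDr subnK// ltnW.
  rewrite /mmap1 big_ord2/= -mul_polyC rmorphM/= rmorphXn/= polyCM rmorphM/=.
  rewrite polyC_exp rmorphXn/= -/T !exprMn exprVn -!exprM cE /e !exprD.
  have aux (E : fieldType) (x1 x2 x3 x4 x5 x6 : E) : x2 != 0 ->
      x1 * x2 * (x3 * (x4 * x5 / x2 * x6)) = x3 * x4 * (x1 * x5 * x6).
    by move=> x20; field.
  by apply: aux; rewrite expf_neq0.
rewrite ld mulr0 => /esym/eqP; rewrite tofrac_eq0 => /eqP P0.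
apply/eqP; rewrite -msupp_eq0; case E : (msupp d) => [//|v s]; exfalso.
have vd : v \in msupp d by rewrite E inE eqxx.
have inj u : u \in msupp d -> e u = e v -> u = v.
  move=> ud euv; have up := hd _ ud; have vp := hd _ vd.
  have key : ((u i1)%:Z - (v i1)%:Z) * p%:Z = ((u i0)%:Z - (v i0)%:Z) * (cp%:Z - cm%:Z).
    by move: euv; rewrite /e; case: cpm => ->; nia.
  have pc : coprimez p%:Z (cp%:Z - cm%:Z).
    rewrite coprimezE; have [cp0|cm0] := cpm.
      by move: coprime_pc; rewrite cp0 add0r abszN add0n.
    by move: coprime_pc; rewrite cm0 subr0 addn0.
  have : (p%:Z %| ((u i0)%:Z - (v i0)%:Z))%Z.
    by rewrite -(Gauss_dvdzl _ pc) -key; exact: dvdz_mull.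
  move=> /dvdzP[z ze].
  have u0 : u i0 = v i0.
    move: up vp ze; move: (u i0) (v i0) => x y xp yp; clear -xp yp.
    have [z0|z0|->] := ltgtP z 0; last by rewrite mul0r; lia.
      have : z * p%:Z <= (- 1) * p%:Z by apply: ler_wpM2r => //; lia.
      lia.
    have : 1 * p%:Z <= z * p%:Z by apply: ler_wpM2r => //; lia.
    lia.
  apply: mnm2P => //; move: key; rewrite u0 subrr mul0r => /eqP.
  by rewrite mulf_eq0; lia.
have := congr1 (fun P : {poly k} => P`_(e v)) P0.
rewrite coef0 coef_sum; under eq_bigr do rewrite coefZ coefXn.
rewrite (bigD1_seq v) ?msupp_uniq//= eqxx mulr1 big_seq_cond big1 => [|u /andP[ud uv]].
  rewrite addr0 => /eqP; rewrite mulf_eq0 expf_eq0 (negPf rho0) andbF orbF.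
  by rewrite mcoeff_eq0 vd.
by case: eqP => [/esym/(inj _ ud) uv'|_]; rewrite ?mulr0//; rewrite uv' eqxx in uv.
Qed.

Lemma line_prime_gen r a : r != 0 -> line_prime r a ->
  exists N b, 'X_i1 ^+ N * a = b * linefactor r.
Proof.
move=> r0 ha; have [N [b [d [hd e]]]] := line_division r a.
exists N, b; rewrite e (line_prime_lowdeg r0 hd) ?addr0//.
have [I0 ID IM] := line_prime_ideal r.
have -> : d = 'X_i1 ^+ N * a + (- b) * linefactor r by rewrite e; ring.
by apply: ID; apply: IM => //; apply/line_prime_factor.
Qed.

Lemma linefactor_neq0 r : linefactor r != 0.
Proof.
apply/eqP => /(congr1 (line_eval (r + 1))); rewrite line_eval_factor rmorph0.
rewrite addrC addKr polyC1 rmorph1 mul1r => /eqP.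
by rewrite expf_eq0 (negPf T0) andbF.
Qed.

Lemma tprime_expn (U : set M2) P x n : tprime U P -> U x -> ~ P (x ^+ n).
Proof.
move=> [[[P0 PD PM] P1 Pprime] hU] Ux; elim: n => [|n IH]; first by rewrite expr0.
by rewrite exprS => /Pprime[/(hU _ Ux)|/IH].
Qed.

(** Factors whose root fails G are inverted by U and drop out. Grouping the others by equal roots
    gives the exponents for [gmult_eq]. *)
Lemma gmult_line (U : set M2) (G : pred k) (rs : seq k) (S : 'X_{1..2}) (c : k) :
  c != 0 -> (forall z, z \in rs -> z != 0) -> U 'X_i0 -> U 'X_i1 ->
  (forall z x, z \in rs -> G z -> U x -> ~ line_prime z x) ->
  (forall z, z \in rs -> ~~ G z -> U (linefactor z)) ->
  gmult R U (ideal_gen [set c *: 'X_[S] * \prod_(z <- rs) linefactor z]) =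
    (count G rs)%:R%:E.
Proof.
move=> c0 rs0 UX UY hG hB; set q := c *: _ * _.
pose ds := undup [seq z <- rs | G z].
pose m z := count_mem z [seq z <- rs | G z].
have dsP z : z \in ds = (z \in rs) && G z.
  by rewrite mem_undup mem_filter andbC.
have prodE : \prod_(z <- rs) linefactor z =
    (\prod_(z <- rs | ~~ G z) linefactor z) * \prod_(z <- ds) linefactor z ^+ m z.
  rewrite (bigID G)/= mulrC; congr (_ * _); rewrite -big_filter.
  by rewrite -prodr_undup_exp_count.
have qE : q = (c *: 'X_[S] * \prod_(z <- rs | ~~ G z) linefactor z) *
    \prod_(z <- ds) linefactor z ^+ m z by rewrite /q prodE mulrA.
have sumE : (\sum_(z <- ds) m z = count G rs)%N.
  rewrite -size_filter /ds /m; set t := [seq z <- rs | G z]; rewrite -sum1_size.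
  have <- := big_undup_iterop_count addn t xpredT (fun=> 1%N).
  apply: eq_bigr => z _; case: (count_mem z _) => [//|n].
  by rewrite iteropS iter_addn mul1n addn1.
rewrite -sumE; apply: (@gmult_eq R _ U _ _ ds line_prime linefactor m).
- exact: ideal_gen_ideal.
- exact: undup_uniq.
- move=> z; rewrite dsP => /andP[zrs Gz]; split.
  + by split=> [|x Ux]; [exact: line_prime_prime|exact: hG].
  + apply: ideal_gen_min; first exact: line_prime_ideal.
    have [I0 ID IM] := line_prime_ideal z.
    move=> _ ->; rewrite /q (big_rem z)//= [linefactor z * _]mulrC mulrA.
    by apply: IM; apply/line_prime_factor.
  + exact/line_prime_factor.
  + by rewrite -has_count has_pred1 mem_filter Gz.
- by move=> z z' _ _ zz' /line_prime_factor e; rewrite e eqxx in zz'.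
- move=> z a; rewrite dsP => /andP[zrs Gz] /(line_prime_gen (rs0 _ zrs))[N [b e]].
  exists ('X_i1 ^+ N), b, 0; rewrite addr0; split=> //.
    by move=> P tP; apply: tprime_expn tP UY.
  by have [] := ideal_gen_ideal [set q].
- exists (c *: 'X_[S] * \prod_(z <- rs | ~~ G z) linefactor z); last first.
    by rewrite -qE; exact: sub_ideal_gen.
  move=> P tP; have [[PI P1 Pprime] hU] := tP; have [P0 PD PM] := PI.
  move=> /Pprime[|].
    rewrite -mul_mpolyC => /Pprime[h|].
      by apply: P1; rewrite -mpolyC1 -(mulVf c0) mpolyCM; exact: PM.
    by rewrite mpolyX2E => /Pprime[]; exact: tprime_expn tP _.
  rewrite big_seq_cond; elim/big_rec: _ => [//|z x /andP[zrs nGz] IH].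
  by move=> /Pprime[|//]; apply: hU; exact: hB.
- move=> z s j; rewrite dsP => /andP[zrs Gz] jm hs /ideal_gen1P[b e].
  apply: hs; have zds : z \in ds by rewrite dsP zrs.
  have := e; rewrite qE (bigD1_seq z) ?undup_uniq//=.
  rewrite -(subnKC (ltnW jm)) exprD.
  set X := c *: _ * _; set Y := \prod_(_ <- _ | _) _; move=> e'.
  have sE : s = (b * X * Y * linefactor z ^+ (m z - j).-1) * linefactor z.
    have nz : linefactor z ^+ j != 0 by rewrite expf_neq0// linefactor_neq0.
    apply: (mulIf nz); rewrite e'.
    have -> : (m z - j = (m z - j).-1.+1)%N by lia.
    by rewrite exprS/=; ring.
  have [I0 ID IM] := line_prime_ideal z.
  by rewrite sE; apply: IM; apply/line_prime_factor.
Qed.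

End Line.

End CollinearMultiplicity.

(** * Multiplicities of plane tropical curves and the lowest exponent they determine *)

Section PlaneMultiplicities.
Variable R : realType.
Local Notation K := (gpuiseux R).
Local Notation k := R[i].
Implicit Types (f : {mpoly K[2]}) (w : 'rV[R]_2).

Lemma trop_multE n (I : set {mpoly K[n]}) (w : 'rV[R]_n) :
  trop_mult I w = gmult R (range (fun i : 'I_n => 'X_i : {mpoly k[n]})) (init_ideal w I).
Proof.
rewrite /trop_mult /gmult; congr esum.
have tE (P : set {mpoly k[n]}) : torus_prime P <-> tprime (range (fun i => 'X_i)) P.
  split=> -[hP h]; split=> //; first by move=> _ [i _ <-].
  by move=> i; apply: h; exists i.
apply/seteqP; split=> P [/tE h1 h2 h3]; split=> // P' /tE; exact: h3.
Qed.

Lemma collin_int f w (p cp cm : nat) : collin f w p%:R (cp%:R - cm%:R) ->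
  forall u v : 'X_{1..2}, u \in msupp (init_form w f) -> v \in msupp (init_form w f) ->
  ((u i0)%:Z - (v i0)%:Z) * (cp%:Z - cm%:Z) = ((u i1)%:Z - (v i1)%:Z) * p%:Z.
Proof.
move=> h u v /maxtermP mu /maxtermP mv; apply: (@intr_inj R).
by rewrite !(rmorphM, rmorphB)/=; exact: h.
Qed.

Lemma gcd_dvd_of_line (p cp cm : nat) (x y : int) : cp = 0%N \/ cm = 0%N ->
  coprime p (cp + cm) -> x * (cp%:Z - cm%:Z) = y * p%:Z -> (p%:Z %| x)%Z.
Proof.
move=> cpm cop e.
have pc : coprimez p%:Z (cp%:Z - cm%:Z).
  rewrite coprimezE; have [cp0|cm0] := cpm.
    by move: cop; rewrite cp0 add0r abszN add0n.
  by move: cop; rewrite cm0 subr0 addn0.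
by rewrite -(Gauss_dvdzl _ pc) e; exact: dvdz_mull.
Qed.

Section Eval.
Variables (f : {mpoly K[2]}) (w : 'rV[R]_2) (p cp cm a b : nat).
Hypothesis p0 : (0 < p)%N.
Hypothesis cpm : cp = 0%N \/ cm = 0%N.
Hypothesis coprime_pc : coprime p (cp + cm).
Hypothesis col : collin f w p%:R (cp%:R - cm%:R).
Hypotheses (la : isxlow f w a) (hb : isxhigh f w b).

Let le_ab : (a <= b)%N.
Proof. by have [[u mu <-] _] := la; have [_ /(_ _ mu)] := hb. Qed.

Lemma collin_dvd : exists m, b = (a + p * m)%N.
Proof.
have [[u mu ua] _] := la; have [[v mv vb] _] := hb.
have := collin_int col (introT (maxtermP _ _ _) mv) (introT (maxtermP _ _ _) mu).
rewrite ua vb => /(gcd_dvd_of_line cpm coprime_pc)/dvdzP[z ze].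
exists `|z|%N; have z0 : 0 <= z.
  have pp : 0 < p%:Z by lia.
  rewrite -(pmulr_lge0 _ pp) -ze; lia.
by lia.
Qed.

Lemma init_form_factor m : b = (a + p * m)%N -> exists (rs : seq k) (c : k) S, [/\ size rs = m, c != 0,
  forall z, z \in rs -> z != 0,
  init_form w f = c *: 'X_[S] * \prod_(z <- rs) linefactor p cp cm z &
  forall j, (j <= m)%N -> (c *: \prod_(z <- rs) ('X - z%:P))`_j =
    (init_form w f)@_(S + mon2 p cp *+ j + mon2 0 cm *+ (m - j))%MM] /\
  exists2 u, maxterm w f u & S = mon2 a (u i1 - cm * m).
Proof.
move=> bE; have [[u mu ua] hu] := la; have [[v mv vb] hv] := hb.
have [|rs [c [h1 h2 h3 h4 h5]]] := @collinear_factor k (init_form w f) p cp cm a m p0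
  (collin_int col) cpm coprime_pc u v (introT (maxtermP _ _ _) mu)
  (introT (maxtermP _ _ _) mv) ua (etrans vb bE).
  by move=> x /maxtermP mx; rewrite hu// -bE hv.
exists rs, c, (mon2 a (u i1 - cm * m)); split; last by exists u.
by split=> // j jm; rewrite -h5 coef_poly ltnS jm.
Qed.

(** m is the lattice length of the dual Newton segment. All m binomials count, since with nonzero
    roots their primes contain no variable. *)
Lemma trop_mult_collin m : b = (a + p * m)%N ->
  trop_mult (ideal_gen [set f]) w = m%:R%:E.
Proof.
move=> /init_form_factor[rs [c [S [[h1 h2 h3 h4 _] _]]]].
rewrite trop_multE init_ideal_principal h4.
rewrite (gmult_line p0 cpm coprime_pc (G := xpredT))//.
  by rewrite count_predT h1.
move=> z _ zrs _ [i _ <-]; move: i; apply: ord2P.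
  by apply: line_primeX => //; exact: h3.
exact: line_primeY.
Qed.

End Eval.

Lemma linefactorX (z : k) : linefactor 1 0 0 z = 'X_i0 - z%:MP.
Proof.
rewrite /linefactor; have -> : mon2 1 0 = U_(i0)%MM.
  by apply: mnm2P; rewrite ?mon20 ?mon21 mnm1E.
have -> : mon2 0 0 = 0%MM by apply: mnm2P; rewrite ?mon20 ?mon21 mnm0E.
by rewrite mpolyX0 -mul_mpolyC mulr1.
Qed.

(** The case p = 1, cp = cm = 0, with binomials x - z. Inverting x + e as well, the initial part of
    the third coordinate on the line, discards exactly the roots z = -e. *)
Lemma mult_yconst f w b a d (e : k) : yconst (init_form w f) b ->
  isxlow f w a -> isxhigh f w d -> exists (rs : seq k) (c : k),
  [/\ c != 0, forall z, z \in rs -> z != 0, (a + size rs = d)%N,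
    xpoly (init_form w f) = c *: \prod_(z <- rs) ('X - z%:P) * 'X^a &
    trop_mult (ideal_gen [set f]) w = (size rs)%:R%:E] /\
    gmult R [set x | [\/ x = 'X_i0, x = 'X_i1 | x = 'X_i0 + e%:MP]]
      (ideal_gen [set init_form w f]) = (count (predC1 (- e)) rs)%:R%:E.
Proof.
move=> hb la hd.
have col : collin f w 1%:R (0%:R - 0%:R) by rewrite subrr; exact: yconst_collin hb.
have cop : coprime 1 (0 + 0) by [].
have [m dE] := collin_dvd (ltnSn 0) (or_introl erefl) cop col la hd.
have [rs [c [S [[h1 h2 h3 h4 h5] [u mu SE]]]]] :=
  init_form_factor (ltnSn 0) (or_introl erefl) cop col la hd dE.
have ub : u i1 = b by apply: hb; exact/maxtermP.
exists rs, c; split; first split=> //.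
- by rewrite dE h1 mul1n.
- have q0 i : ~ (a <= i <= d)%N -> (init_form w f)@_(mon2 i b) = 0.
    move=> nai; apply/eqP; rewrite mcoeff_eq0; apply/negP => /maxtermP mv.
    by apply: nai; have := la.2 _ mv; have := hd.2 _ mv; rewrite mon20 => -> ->.
  have xE i : (xpoly (init_form w f))`_i = (init_form w f)@_(mon2 i b).
    by rewrite -(coef_xpoly hb (mon21 i b)) mon20.
  have szp : (size (c *: \prod_(z <- rs) ('X - z%:P)) <= m.+1)%N.
    by rewrite size_scale// size_prod_XsubC h1.
  apply/polyP => i; rewrite xE coefMXn; case: ltnP => [ia|ai].
    by rewrite q0// => /andP[]; rewrite leqNgt ia.
  have [im|mi] := leqP (i - a) m; last first.
    by rewrite nth_default ?(leq_trans szp)// q0//; rewrite dE; lia.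
  rewrite h5// SE ub !mon2Mn !mon2D; congr (_@_(mon2 _ _)); lia.
- by rewrite (trop_mult_collin (ltnSn 0) (or_introl erefl) cop col la hd dE) h1.
rewrite h4 (gmult_line (ltnSn 0) (or_introl erefl) cop (G := predC1 (- e)))//.
- by apply: Or31.
- by apply: Or32.
- move=> z x zrs /= ze [->|->|->].
  + by apply: line_primeX => //; exact: h3.
  + exact: line_primeY.
  + suff -> : 'X_i0 + e%:MP = linefactor 1 0 0 (- e).
      by move=> /(line_prime_factor 0 0 (ltnSn 0) z (- e))/eqP; rewrite (negPf ze).
    by rewrite linefactorX mpolyCN opprK.
- move=> z _ /=; rewrite negbK => /eqP ->; apply: Or33.
  by rewrite linefactorX mpolyCN opprK.
Qed.

(** The difference u - v divided by its content. [Qp] and [Qm] are the positive and negative parts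
    of its second component; by truncated subtraction one of them is 0. *)
Lemma collin_primitive f w u v : maxterm w f u -> maxterm w f v -> u i0 != v i0 ->
  (forall z : 'X_{1..2}, maxterm w f z ->
    ((z i0)%:R - (v i0)%:R) * ((u i1)%:R - (v i1)%:R) =
    ((z i1)%:R - (v i1)%:R) * ((u i0)%:R - (v i0)%:R) :> R) ->
  exists p cp cm, [/\ (0 < p)%N, cp = 0%N \/ cm = 0%N, coprime p (cp + cm) &
    collin f w p%:R (cp%:R - cm%:R)].
Proof.
wlog uv : u v / (v i0 < u i0)%N.
  move=> hwlog mu mv; rewrite neq_ltn => /orP[vu|uv] hz; last first.
    by apply: (hwlog u v) => //; rewrite gtn_eqF.
  apply: (hwlog v u) => //; first by rewrite gtn_eqF.
  by move=> z /hz; lra.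
move=> mu mv _ hz.
pose P := (u i0 - v i0)%N; pose Qp := (u i1 - v i1)%N; pose Qm := (v i1 - u i1)%N.
pose g := gcdn P (Qp + Qm).
have g0 : (0 < g)%N by rewrite gcdn_gt0 /P subn_gt0 uv.
have gP : (g %| P)%N by exact: dvdn_gcdl.
have gQ : (g %| Qp + Qm)%N by exact: dvdn_gcdr.
have QQ : Qp = 0%N \/ Qm = 0%N by rewrite /Qp /Qm; lia.
have gQp : (g %| Qp)%N by case: QQ gQ => -> //; rewrite addn0.
have gQm : (g %| Qm)%N by case: QQ gQ => ->; rewrite ?dvdn0.
exists (P %/ g)%N, (Qp %/ g)%N, (Qm %/ g)%N; split.
- by rewrite divn_gt0// dvdn_leq// /P subn_gt0.
- by case: QQ => ->; rewrite div0n; [left|right].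
- by rewrite -divnDl// /coprime -(eqn_pmul2r g0) mul1n muln_gcdl !divnK.
move=> x y mx my; have gR : g%:R != 0 :> R by rewrite pnatr_eq0 -lt0n.
have divR n : (g %| n)%N -> (n %/ g)%:R = n%:R / g%:R :> R.
  by move=> gn; apply: (mulIf gR); rewrite divfK// -natrM divnK.
rewrite !divR// -mulrBl !mulrA; congr (_ / _).
have -> : P%:R = (u i0)%:R - (v i0)%:R :> R by rewrite natrB// ltnW.
have -> : Qp%:R - Qm%:R = (u i1)%:R - (v i1)%:R :> R.
  rewrite /Qp /Qm; have [h|/ltnW h] := leqP (v i1) (u i1).
    by rewrite (natrB _ h) (eqP (h : (_ - _ == 0)%N)) subr0.
  by rewrite (natrB _ h) (eqP (h : (_ - _ == 0)%N)) sub0r opprB.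
have := hz _ mx; have := hz _ my; lra.
Qed.

Lemma collin_locally_line f w p q : f != 0 -> Trop (ideal_gen [set f]) w ->
  p != 0 -> collin f w p q -> locally_line (Trop (ideal_gen [set f])) w.
Proof.
move=> f0 Cw p0 col; have [e e0 he] := collin_near f0 Cw p0 col.
exists (pt2 (- q) p).
  by apply: contraNneq p0 => /rowP/(_ i1); rewrite pt21 mxE => ->.
apply/near_closeP; exists e => // u cu.
have [|+ _] := he (u - w); first by move=> i; have := cu i; rewrite !mxE.
have -> : w + (u - w) = u by rewrite addrC subrK.
move=> ->; split=> [h|[s ->]]; last by rewrite !mxE/=; ring.
exists ((u 0 i1 - w 0 i1) / p); apply/rowP; apply: ord2P; rewrite !mxE/=.
  have h' : u 0 i0 - w 0 i0 = - (q * (u 0 i1 - w 0 i1)) / p.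
    by apply: (mulIf p0); rewrite divfK//; move: h; rewrite !mxE; lra.
  by rewrite -[LHS](subrK (w 0 i0)) h'; ring.
by rewrite divfK// addrC subrK.
Qed.

(** A small step along the line of the first curve stays on the second one, whose local equation
    then gives the proportionality. *)
Lemma collin_same_direction f1 f2 w p1 q1 p2 q2 : f1 != 0 -> f2 != 0 ->
  Trop (ideal_gen [set f1]) w -> Trop (ideal_gen [set f1]) = Trop (ideal_gen [set f2]) ->
  p1 != 0 -> p2 != 0 -> collin f1 w p1 q1 -> collin f2 w p2 q2 -> p1 * q2 = p2 * q1.
Proof.
move=> f10 f20 C1 C12 p10 p20 col1 col2; have C2 := C1; rewrite C12 in C2.
have [e1 e10 he1] := collin_near f10 C1 p10 col1.
have [e2 e20 he2] := collin_near f20 C2 p20 col2.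
pose M := 1 + `|q1| + `|p1|.
have M0 : 0 < M by rewrite /M; have := normr_ge0 q1; have := normr_ge0 p1; lra.
pose t := Num.min e1 e2 / M.
have t0 : 0 < t by rewrite divr_gt0// lt_min e10.
pose d := pt2 (- (t * q1)) (t * p1).
have tM : t * M = Num.min e1 e2 by rewrite /t divfK// gt_eqF.
have dl i : `|d 0 i| < Num.min e1 e2.
  rewrite -tM; move: i; apply: ord2P; rewrite ?pt20 ?pt21 ?normrN normrM gtr0_norm// ltr_pM2l// /M.
    have := normr_ge0 p1; lra.
  have := normr_ge0 q1; lra.
have [|h1 _] := he1 d; first by move=> i; have := dl i; rewrite lt_min => /andP[].
have [|h2 _] := he2 d; first by move=> i; have := dl i; rewrite lt_min => /andP[].
have : p2 * d 0 i0 + q2 * d 0 i1 = 0.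
  by apply/h2; rewrite -C12; apply/h1; rewrite pt20 pt21; ring.
rewrite pt20 pt21 => h; apply: (mulfI (lt0r_neq0 t0)); lra.
Qed.

(** At a generic height the slope jumps at a crossing by p times the multiplicity, where p comes
    from the primitive normal of the edge and thus from the set alone; off the curve there is no
    jump. This is the input of [isxlow_same]. *)
Lemma isxlow_determined f1 f2 w b1 b2 a : f1 != 0 -> f2 != 0 ->
  same_weighted_curve (ideal_gen [set f1]) (ideal_gen [set f2]) ->
  (exists2 u : 'X_{1..2}, u \in msupp f1 & u i0 = 0%N) ->
  (exists2 u : 'X_{1..2}, u \in msupp f2 & u i0 = 0%N) ->
  Trop (ideal_gen [set f1]) w ->
  yconst (init_form w f1) b1 -> yconst (init_form w f2) b2 ->
  isxlow f1 w a -> isxlow f2 w a.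
Proof.
move=> f10 f20 [C12 mult12] z1 z2 C1 y1 y2; have C2 := C1; rewrite C12 in C2.
have [e1 e10 he1] := yconst_near f10 C1 y1.
have [e2 e20 he2] := yconst_near f20 C2 y2.
have [s1 hs1] := generic_collin f1; have [s2 hs2] := generic_collin f2.
have e0 : 0 < Num.min e1 e2 by rewrite lt_min e10.
(* The height is generic for both polynomials, yet so close to w that the maximal terms at (w_0, y)
   are still those at w. *)
have [y ye] := avoid_seq (s1 ++ s2) (w 0 i1) e0.
rewrite mem_cat negb_or => /andP[ys1 ys2].
move: ye; rewrite lt_min => /andP[ye1 ye2].
have cl e : 0 < e -> `|y - w 0 i1| < e -> close e w (pt2 (w 0 i0) y).
  by move=> ep yel; apply: ord2P; rewrite ?pt20 ?pt21 ?subrr ?normr0.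
have [_ /(_ (pt20 _ _)) M1] := he1 _ (cl _ e10 ye1).
have [_ /(_ (pt20 _ _)) M2] := he2 _ (cl _ e20 ye2).
suff all x a' : isxlow f1 (pt2 x y) a' -> isxlow f2 (pt2 x y) a'.
  move=> [[u mu ua] hu]; have [|[v mv va] hv] := all (w 0 i0) a.
    by split; [exists u => //; exact/M1|move=> v /M1; exact: hu].
  by split; [exists v => //; exact/M2|move=> x /M2; exact: hv].
apply: isxlow_same => // {}x a1 d1 a2 d2 l1 h1 l2 h2.
have triv f a0 d0 : f != 0 -> ~ Trop (ideal_gen [set f]) (pt2 x y) ->
    isxlow f (pt2 x y) a0 -> isxhigh f (pt2 x y) d0 -> a0 = d0.
  move=> f0 nC [[u mu <-] _] [[v mv <-] _].
  have [-> //|uv] := eqVneq u v.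
  by exfalso; apply: nC; exact: two_terms_trop mu mv uv.
have [C1'|nC] := pselect (Trop (ideal_gen [set f1]) (pt2 x y)); last first.
  rewrite (triv _ _ _ f10 nC l1 h1).
  by rewrite C12 in nC; rewrite (triv _ _ _ f20 nC l2 h2) addnC.
have C2' := C1'; rewrite C12 in C2'.
have [u1 [v1 [mu1 mv1 uv1]]] := trop_two_terms f10 C1'.
have [u2 [v2 [mu2 mv2 uv2]]] := trop_two_terms f20 C2'.
have [n1 g1] := hs1 _ _ ys1 _ _ mu1 mv1 uv1.
have [n2 g2] := hs2 _ _ ys2 _ _ mu2 mv2 uv2.
have [p1 [cp1 [cm1 [p10 cpm1 cop1 col1]]]] := collin_primitive mu1 mv1 n1 g1.
have [p2 [cp2 [cm2 [p20 cpm2 cop2 col2]]]] := collin_primitive mu2 mv2 n2 g2.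
have p1R : p1%:R != 0 :> R by rewrite pnatr_eq0 -lt0n.
have p2R : p2%:R != 0 :> R by rewrite pnatr_eq0 -lt0n.
have dir := collin_same_direction f10 f20 C1' C12 p1R p2R col1 col2.
have dirZ : p1%:Z * (cp2%:Z - cm2%:Z) = p2%:Z * (cp1%:Z - cm1%:Z).
  by apply: (@intr_inj R); rewrite !(rmorphM, rmorphB)/=; exact: dir.
(* Both directions are primitive and proportional, so p1 and p2 divide each other. *)
have p12 : p1 = p2.
  have d12 : (p1%:Z %| p2%:Z)%Z.
    by apply: (gcd_dvd_of_line cpm1 cop1); rewrite -dirZ mulrC.
  have d21 : (p2%:Z %| p1%:Z)%Z.
    by apply: (gcd_dvd_of_line cpm2 cop2); rewrite dirZ mulrC.
  by apply/eqP; rewrite eqn_dvd; apply/andP; split.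
have [m1 dE1] := collin_dvd p10 cpm1 cop1 col1 l1 h1.
have [m2 dE2] := collin_dvd p20 cpm2 cop2 col2 l2 h2.
have := mult12 _ C1' (collin_locally_line f10 C1' p1R col1).
rewrite (trop_mult_collin p10 cpm1 cop1 col1 l1 h1 dE1).
rewrite (trop_mult_collin p20 cpm2 cop2 col2 l2 h2 dE2) => -[/eqP].
rewrite eqr_nat => /eqP m12.
by rewrite dE1 dE2 p12 m12 addnAC [(a1 + a2)%N]addnC addnAC.
Qed.

End PlaneMultiplicities.

(** * The tropical graph of x + c over a plane curve *)

Section ShearedCurve.
Variable R : realType.
Local Notation K := (gpuiseux R).
Local Notation k := R[i].
Implicit Types (f g : {mpoly K[2]}) (w : 'rV[R]_2).

Lemma gp_valD_lt (a b : K) : a != 0 -> b != 0 -> gp_val a < gp_val b ->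
  [/\ a + b != 0, gp_val (a + b) = gp_val a & gp_lead (a + b) = gp_lead a].
Proof.
move=> /gp_val_spec[a1 a2] /gp_val_spec[b1 b2] ab.
have e : gcoef (a + b) (gp_val a) = gcoef a (gp_val a).
  by rewrite gcoefD (vge_coef0 b2 ab) addr0.
have v : gp_val (a + b) = gp_val a.
  apply: gp_val_eq; first by rewrite e.
  by apply: vgeD => //; exact: (vgeW (ltW ab) b2).
by split; rewrite /gp_lead ?v//; apply: contra_notN a1 => /eqP ab0; rewrite -e ab0 gcoef0.
Qed.

Lemma gp_valD_lead (a b : K) : a != 0 -> b != 0 -> gp_val a = gp_val b ->
  gp_lead a + gp_lead b != 0 -> a + b != 0 /\ gp_val (a + b) = gp_val a.
Proof.
move=> /gp_val_spec[a1 a2] /gp_val_spec[b1 b2] ab; rewrite /gp_lead -ab => s.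
have e : gcoef (a + b) (gp_val a) <> 0 by rewrite gcoefD; exact/eqP.
split; first by apply: contra_notN e => /eqP ->.
by apply: gp_val_eq => //; apply: vgeD => //; rewrite ab.
Qed.

Lemma gp_valD_ge (a b : K) : a != 0 -> b != 0 -> a + b != 0 -> gp_val a = gp_val b ->
  gp_val a <= gp_val (a + b) /\
  (gp_val (a + b) = gp_val a -> gp_lead a + gp_lead b != 0).
Proof.
move=> /gp_val_spec[a1 a2] /gp_val_spec[b1 b2] /gp_val_spec[c1 c2] ab; split.
  by have := vgeD a2 (eq_ind_r (fun v => vge v b) b2 ab); move=> /(_ _ c1).
move=> e; apply/eqP => s; apply: c1; rewrite e gcoefD -s /gp_lead -ab//.
Qed.

Definition vec2 (x y : K) (i : 'I_2) : K := if i == i0 then x else y.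

Lemma curve_tropP f (X Y : R) : Trop (ideal_gen [set f]) (pt2 X Y) <->
  exists x y : K, [/\ x != 0, y != 0, f.@[vec2 x y] = 0, X = - gp_val x & Y = - gp_val y].
Proof.
split=> [/TropP[p [p0 fp wp]]|[x [y [x0 y0 fxy Xx Yy]]]].
  exists (p i0), (p i1); split=> //.
  - by rewrite -fp; apply: meval_eq; apply: ord2P.
  - by rewrite -(wp i0) pt20.
  - by rewrite -(wp i1) pt21.
apply/TropP; exists (vec2 x y); split=> //; first exact: ord2P.
by apply: ord2P; rewrite ?pt20 ?pt21.
Qed.

(** The polynomial f and the shift c are free because the same statements serve g with c over the
    (X, Y)-plane and tilde g with -c over the (Z, Y)-plane. *)
Definition sheared f (c : K) (X Y Z : R) := exists x y z : K,
  [/\ [/\ x != 0, y != 0 & z != 0], f.@[vec2 x y] = 0, z = x + c &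
     [/\ X = - gp_val x, Y = - gp_val y & Z = - gp_val z]].

Section Shear.
Variables (f : {mpoly K[2]}) (c : K) (l : R).
Hypothesis f0 : f != 0.
Hypotheses (c0 : c != 0) (cl : gp_val c = - l).
Let C := Trop (ideal_gen [set f]).

Lemma sheared_mod X Y Z : sheared f c X Y Z ->
  [/\ X < l -> Z = l, l < X -> Z = X & X = l -> Z <= l].
Proof.
move=> [x [y [z [[x0 y0 z0] _ zE [-> _ ->]]]]]; split=> h.
- have vxc : gp_val c < gp_val x by rewrite cl; lra.
  by have [_ v _] := gp_valD_lt c0 x0 vxc; rewrite zE addrC v cl opprK.
- have vxc : gp_val x < gp_val c by rewrite cl; lra.
  by have [_ v _] := gp_valD_lt x0 c0 vxc; rewrite zE v.
- have xc : gp_val x = gp_val c by rewrite cl; lra.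
  rewrite zE in z0 *; have [+ _] := gp_valD_ge x0 c0 z0 xc; lra.
Qed.

Lemma sheared_curve X Y Z : sheared f c X Y Z -> C (pt2 X Y).
Proof.
by move=> [x [y [z [[x0 y0 z0] fxy _ [hX hY _]]]]]; apply/curve_tropP; exists x, y.
Qed.

Lemma curve_sheared X Y : C (pt2 X Y) -> X != l -> sheared f c X Y (Num.max X l).
Proof.
move=> /curve_tropP[x [y [x0 y0 fxy hX hY]]] Xl; exists x, y, (x + c).
have [Xltl|lltX|e] := ltgtP X l; last by rewrite e eqxx in Xl.
- have vxc : gp_val c < gp_val x by rewrite cl; lra.
  have [n v _] := gp_valD_lt c0 x0 vxc; rewrite addrC.
  by split=> //; split=> //; rewrite v cl opprK.
- have vxc : gp_val x < gp_val c by rewrite cl; lra.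
  by have [n v _] := gp_valD_lt x0 c0 vxc; split=> //; split=> //; rewrite v.
Qed.

Lemma lift_sheared Y x y : x != 0 -> y != 0 -> f.@[vec2 x y] = 0 -> gp_val x = - l ->
  Y = - gp_val y -> gp_lead x != - gp_lead c -> sheared f c l Y l.
Proof.
move=> x0 y0 fxy xl hY lx; exists x, y, (x + c).
have xc : gp_val x = gp_val c by rewrite cl.
have [|n v] := gp_valD_lead x0 c0 xc.
  by apply: contraNneq lx => /eqP; rewrite addr_eq0 => /eqP ->.
by split=> //; split=> //; rewrite ?v xl opprK.
Qed.

Lemma vec2_zero_over X Y p : zero_over f (pt2 X Y) p ->
  [/\ p i0 != 0, p i1 != 0, f.@[vec2 (p i0) (p i1)] = 0, gp_val (p i0) = - X &
    Y = - gp_val (p i1)].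
Proof.
move=> [p0 fp wp]; split=> //.
- by rewrite -fp; apply: meval_eq; apply: ord2P.
- by have := wp i0; rewrite pt20 => ->; rewrite opprK.
- by have := wp i1; rewrite pt21.
Qed.

Lemma not_locvert_sheared Y : C (pt2 l Y) -> ~ locvert C (pt2 l Y) -> sheared f c l Y l.
Proof.
move=> Cl nv; have [u mu] := maxterm_exists (pt2 l Y) f0.
have [hb|/existsNP[v /not_implyP[/maxtermP mv /eqP vu]]] :=
    pselect (yconst (init_form (pt2 l Y) f) (u i1)).
  by exfalso; apply: nv; exact: yconst_locvert Cl hb.
have [p /vec2_zero_over[h1 h2 h3 h4 h5] lp] := lift_avoiding f0 (- gp_lead c) mv mu vu.
exact: (lift_sheared h1 h2 h3 h4 h5 lp).
Qed.

(** Over a vertical point the leading coefficients of x are exactly the nonzero roots of [xpoly],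
    and x + c keeps valuation -l exactly when leading terms do not cancel. *)
Lemma sheared_rootP Y b : yconst (init_form (pt2 l Y) f) b ->
  sheared f c l Y l <->
  exists2 r, r != 0 & root (xpoly (init_form (pt2 l Y) f)) r /\ r != - gp_lead c.
Proof.
move=> hb; split=> [[x [y [z [[x0 y0 z0] fxy zE [hX hY hZ]]]]]|[r r0 [rr rc]]].
  exists (gp_lead x); first exact: gp_lead_neq0.
  split.
    apply: (@zero_over_xroot R f (pt2 l Y) b (vec2 x y)) => //.
    split=> //; first exact: ord2P.
    by apply: ord2P; rewrite ?pt20 ?pt21.
  have xc : gp_val x = gp_val c by rewrite cl hX opprK.
  rewrite zE in z0 hZ; have [_ h] := gp_valD_ge x0 c0 z0 xc.
  have : gp_lead x + gp_lead c != 0 by apply: h; lra.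
  by apply: contraNneq => ->; rewrite addNr.
have [p /vec2_zero_over[h1 h2 h3 h4 h5] lp] := lift_xroot f0 hb r0 rr.
by apply: (lift_sheared h1 h2 h3 h4 h5); rewrite lp.
Qed.

Lemma init_form_same w w' : (forall u, maxterm w' f u <-> maxterm w f u) ->
  init_form w' f = init_form w f.
Proof.
move=> h; apply/mpolyP => u.
have E v : (init_form v f)@_u = if u \in msupp (init_form v f) then gp_lead f@_u else 0.
  have [uq|uq] := boolP (_ \in _); last exact: memN_msupp_eq0.
  by move: uq; rewrite mcoeff_msupp mcoeff_init_form; case: ifP => //; rewrite eqxx.
rewrite !E; suff -> : (u \in msupp (init_form w' f)) = (u \in msupp (init_form w f)) by [].
by apply/maxtermP/maxtermP; apply h.
Qed.

(** The initial form is constant along a vertical edge, and with it the criterion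
    [sheared_rootP]. *)
Lemma sheared_near Y : sheared f c l Y l -> locvert C (pt2 l Y) ->
  exists2 e : R, 0 < e & forall Y', `|Y' - Y| < e -> sheared f c l Y' l.
Proof.
move=> sh lv; have Cl := sheared_curve sh.
have [b hb] := locvert_yconst f0 lv.
have [e e0 he] := yconst_near f0 Cl hb; exists e => // Y' YY'.
have [|_ /(_ _)] := he (pt2 l Y').
  by apply: ord2P; rewrite ?pt20 ?pt21 ?subrr ?normr0.
rewrite !pt20 => /(_ erefl) /init_form_same E.
by apply/(@sheared_rootP Y' b); rewrite E//; apply/(sheared_rootP hb).
Qed.

End Shear.

End ShearedCurve.

(** * Substitution along graphs over a coordinate plane *)

Section PolynomialSubstitution.
Variable A : comNzRingType.

Lemma comp_XU m n (s : m.-tuple {mpoly A[n]}) e : 'X_e \mPo s = tnth s e.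
Proof. by rewrite comp_mpolyXU -tnth_nth. Qed.

Lemma mpoly_subring n (S : set {mpoly A[n]}) :
  (forall a b, S a -> S b -> S (a + b)) -> (forall a b, S a -> S b -> S (a * b)) ->
  (forall c, S c%:MP) -> (forall i, S 'X_i) -> forall a, S a.
Proof.
move=> hD hM hC hX; elim/mpolyind => [|c u a _ _ IH]; first by rewrite -mpolyC0.
apply: hD => //; rewrite -mul_mpolyC; apply: (hM) => //.
rewrite mpolyXE_id; elim/big_ind: _ => [|a1 a2|i _]; [by rewrite -mpolyC1|exact: hM|].
by elim: (u i) => [|m IHm]; rewrite ?expr0 -?mpolyC1// exprS; exact: hM.
Qed.

Lemma comp_mpoly_eq m n p (s : m.-tuple {mpoly A[n]}) (t : n.-tuple {mpoly A[p]})
    (r : m.-tuple {mpoly A[p]}) : (forall e, tnth s e \mPo t = tnth r e) ->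
  forall a, (a \mPo s) \mPo t = a \mPo r.
Proof.
move=> h; apply: mpoly_subring => [a b ha hb|a b ha hb|c|e].
- by rewrite !rmorphD/= ha hb.
- by rewrite !rmorphM/= ha hb.
- by rewrite !comp_mpolyC.
- by rewrite !comp_XU.
Qed.

Lemma comp_mpoly_idE n (s : n.-tuple {mpoly A[n]}) : (forall e, tnth s e = 'X_e) ->
  forall a, a \mPo s = a.
Proof.
move=> h; apply: mpoly_subring => [a b ha hb|a b ha hb|c|e].
- by rewrite rmorphD/= ha hb.
- by rewrite rmorphM/= ha hb.
- by rewrite comp_mpolyC.
- by rewrite comp_XU.
Qed.

Lemma ord3P (P : 'I_3 -> Prop) : P iX -> P iY -> P iZ -> forall e, P e.
Proof.
move=> h0 h1 h2 [[|[|[|//]]] he].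
- by have -> : Ordinal he = iX by exact: val_inj.
- by have -> : Ordinal he = iY by exact: val_inj.
- by have -> : Ordinal he = iZ by exact: val_inj.
Qed.

(* Coordinate i of the space becomes the first coordinate of the plane, Y the
   second, and the third one is the function t of them. *)
Definition graph_tuple (i : 'I_3) (t : {mpoly A[2]}) : 3.-tuple {mpoly A[2]} :=
  [tuple (if e == i then 'X_i0 else if e == iY then 'X_i1 else t) | e < 3].

Definition base_tuple (i : 'I_3) : 2.-tuple {mpoly A[3]} :=
  [tuple (if e == i0 then 'X_i else 'X_iY) | e < 2].

Section Graph.
Variables (i m : 'I_3).
Hypothesis him : (i, m) = (iX, iZ) \/ (i, m) = (iZ, iX).
Variable t : {mpoly A[2]}.

Lemma graph_i : tnth (graph_tuple i t) i = 'X_i0.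
Proof. by rewrite tnth_mktuple eqxx. Qed.

Lemma graph_Y : tnth (graph_tuple i t) iY = 'X_i1.
Proof. by rewrite tnth_mktuple; case: him => -[-> _]. Qed.

Lemma graph_m : tnth (graph_tuple i t) m = t.
Proof. by rewrite tnth_mktuple; case: him => -[-> ->]. Qed.

Lemma graphP (P : 'I_3 -> Prop) : P i -> P iY -> P m -> forall e, P e.
Proof. by case: him => -[-> ->] h1 h2 h3; exact: ord3P. Qed.

Lemma base_i0 : tnth (base_tuple i) i0 = 'X_i.
Proof. by rewrite tnth_mktuple. Qed.

Lemma base_i1 : tnth (base_tuple i) i1 = 'X_iY.
Proof. by rewrite tnth_mktuple. Qed.

Lemma base_graph a : (a \mPo base_tuple i) \mPo graph_tuple i t = a.
Proof.
rewrite (@comp_mpoly_eq _ _ _ _ _ [tuple 'X_e | e < 2]); last first.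
  by apply: ord2P; rewrite tnth_mktuple ?base_i0 ?base_i1 comp_XU ?graph_i ?graph_Y.
by apply: comp_mpoly_idE => e; rewrite tnth_mktuple.
Qed.

(** Modulo J the coordinate m is the function t of the other two; the elements for which the
    congruence holds form a subring containing constants and variables. *)
Lemma graph_kernel (J : set {mpoly A[3]}) : is_ideal J ->
  J ('X_m - (t \mPo base_tuple i)) ->
  forall a, J (a - ((a \mPo graph_tuple i t) \mPo base_tuple i)).
Proof.
move=> [J0 JD JM] Jm; apply: mpoly_subring => [a b ha hb|a b ha hb|c|].
- by rewrite !rmorphD/= opprD addrACA; exact: JD.
- set a' := (a \mPo _) \mPo _ in ha; set b' := (b \mPo _) \mPo _ in hb.
  rewrite !rmorphM/= -/a' -/b'.
  have -> : a * b - a' * b' = a * (b - b') + b' * (a - a') by ring.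
  by apply: JD; exact: JM.
- by rewrite !comp_mpolyC subrr.
apply: graphP; rewrite comp_XU ?graph_i ?graph_Y ?graph_m ?comp_XU ?base_i0 ?base_i1 ?subrr//.
Qed.

End Graph.

End PolynomialSubstitution.

(** * Initial ideals and multiplicities of a graph *)

Section InitialIdeal.
Variable R : realType.
Local Notation K := (gpuiseux R).
Local Notation k := R[i].

Lemma wtopX_if n (w : 'rV[R]_n) M i :
  wtop w M ('X_i : {mpoly K[n]}) = if w 0 i == M then 'X_i else 0.
Proof.
case: (w 0 i =P M) => [<-|wM]; first exact: wtopX.
apply/mpolyP => u; rewrite mcoeff_wtop mcoeffX.
rewrite mcoeff0; case: eqP => [<-|_]; last exact: gcoef0.
by rewrite mwtU gcoef1 subr_eq0; case: eqP.
Qed.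

Lemma wleX_le n (w : 'rV[R]_n) M i : w 0 i <= M -> wle w M ('X_i : {mpoly K[n]}).
Proof.
move=> wM u; apply: (@vgeW R (mwt w u - w 0 i)); last exact: wleX.
by rewrite lerD2l lerN2.
Qed.

Section Graph.
Variables (i m : 'I_3).
Hypothesis him : (i, m) = (iX, iZ) \/ (i, m) = (iZ, iX).
Variables (f : {mpoly K[2]}) (t : {mpoly K[2]}) (w : 'rV[R]_3) (lam : {mpoly k[2]}).
Hypothesis f0 : f != 0.
Let w2 := pt2 (w 0 i) (w 0 iY).
Hypotheses (tle : wle w2 (w 0 m) t) (ttop : wtop w2 (w 0 m) t = lam).
Let I : set {mpoly K[3]} := [set F | exists b, F \mPo graph_tuple i t = b * f].
Local Notation phi := (comp_mpoly (graph_tuple i lam)).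

(** [lam] is what the coordinate m degenerates to. The initial ideal contains both X_m - lam and the
    initial form of f pulled back from the plane, which gives one inclusion; substituting the graph
    into initial forms gives the other. The bound [tle] fails on the cell Z < l over the (X,
    Y)-plane, so that cell is seen from the (Z, Y)-plane. *)
Lemma init_ideal_graph :
  init_ideal w I = phi @^-1` (init_ideal w2 (ideal_gen [set f])).
Proof.
have sle e : wle w2 (w 0 e) (tnth (graph_tuple i t) e).
  move: e; apply: (graphP him); rewrite ?(graph_i _ t) ?(graph_Y him) ?(graph_m him)//.
    by rewrite -[w 0 i](pt20 _ (w 0 iY)); exact: wleX.
  by rewrite -[w 0 iY](pt21 (w 0 i)); exact: wleX.
have stop e : wtop w2 (w 0 e) (tnth (graph_tuple i t) e) = tnth (graph_tuple i lam) e.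
  move: e; apply: (graphP him); rewrite ?(graph_i _ t) ?(graph_i _ lam) ?(graph_Y him) ?(graph_m him)//.
    by rewrite -[w 0 i](pt20 _ (w 0 iY)); exact: wtopX.
  by rewrite -[w 0 iY](pt21 (w 0 i)); exact: wtopX.
have ble e : wle w (w2 0 e) (tnth (base_tuple K i) e).
  by move: e; apply: ord2P; rewrite ?base_i0 ?base_i1 ?pt20 ?pt21; exact: wleX.
have btop e : wtop w (w2 0 e) (tnth (base_tuple K i) e) = tnth (base_tuple k i) e.
  by move: e; apply: ord2P; rewrite ?base_i0 ?base_i1 ?pt20 ?pt21; exact: wtopX.
have [Q0 QD QM] : is_ideal (init_ideal w2 (ideal_gen [set f])) by exact: ideal_gen_ideal.
have init0 F : I F -> init_ideal w I (init_form w F).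
  by move=> IF; apply: sub_ideal_gen; exists F.
have initM M F : I F -> wle w M F -> wtop w M F != 0 -> init_ideal w I (wtop w M F).
  move=> IF hF; have [->|->] := wtop_init_form hF; first by rewrite eqxx.
  by move=> _; exact: init0.
apply/seteqP; split.
  apply: ideal_gen_min.
    split; rewrite /preimage/=; first by rewrite comp_mpoly0; exact: Q0.
      by move=> a b ha hb; rewrite comp_mpolyD; exact: QD.
    by move=> c a ha; rewrite rmorphM; exact: QM.
  move=> _ [F [b Fb] <-]; rewrite /preimage/=.
  have [->|F0] := eqVneq F 0; first by rewrite init_form0 comp_mpoly0; exact: Q0.
  have [u mu] := maxterm_exists w F0.
  have hM := wle_maxterm mu; rewrite -(wtop_maxterm mu).
  have [gle gtop] := subst_mpoly hM sle stop.
  rewrite -gtop; have [->|->] := wtop_init_form gle; first exact: Q0.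
  by apply: sub_ideal_gen; exists (F \mPo graph_tuple i t) => //; apply/ideal_gen1P; exists b.
have [J0 JD JM] : is_ideal (init_ideal w I) by exact: ideal_gen_ideal.
have lift a : init_ideal w2 (ideal_gen [set f]) a -> init_ideal w I (a \mPo base_tuple k i).
  rewrite init_ideal_principal => /ideal_gen1P[b ->]; rewrite rmorphM; apply: JM => /=.
  have [u mu] := maxterm_exists w2 f0.
  have [fle ftop] := subst_mpoly (wle_maxterm mu) ble btop.
  rewrite -(wtop_maxterm mu) -ftop; apply: initM => //.
    by exists 1; rewrite (base_graph him) mul1r.
  rewrite ftop (wtop_maxterm mu); apply: contraNneq (init_form_neq0 w2 f0) => e.
  by rewrite -(base_graph him lam (init_form w2 f)) e rmorph0.
have Jm : init_ideal w I ('X_m - (lam \mPo base_tuple k i)).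
  have [gle gtop] := subst_mpoly tle ble btop.
  pose G := 'X_m - (t \mPo base_tuple K i).
  have Gle : wle w (w 0 m) G.
    apply: wleD; first exact: wleX.
    by move=> u; rewrite mcoeffN; apply: vgeN; exact: gle.
  have Gtop : wtop w (w 0 m) G = 'X_m - (lam \mPo base_tuple k i).
    apply/mpolyP => u; rewrite mcoeffB -ttop -gtop -(wtopX w m) !mcoeff_wtop.
    by rewrite mcoeffB gcoefD gcoefN.
  rewrite -Gtop; apply: initM => //.
    by exists 0; rewrite mul0r rmorphB/= (base_graph him) comp_XU (graph_m him) subrr.
  rewrite Gtop subr_eq0; apply/eqP => e.
  have := congr1 (comp_mpoly (graph_tuple i (lam + 1))) e.
  rewrite (base_graph him) comp_XU (graph_m him) => /eqP.
  by rewrite -subr_eq0 addrC addKr oner_eq0.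
move=> a; rewrite /preimage/= => ha.
have := graph_kernel him (ideal_gen_ideal _) Jm a.
move=> /JD /(_ (lift _ ha)); rewrite subrK; exact.
Qed.

Lemma phi_surj b : exists a, phi a = b.
Proof. by exists (b \mPo base_tuple k i); rewrite (base_graph him). Qed.

(** The three variables of space are sent to x, y and lam, so these are the functions to be inverted
    in the plane. *)
Lemma trop_mult_graph : trop_mult I w =
  gmult R [set x | [\/ x = 'X_i0, x = 'X_i1 | x = lam]] (init_ideal w2 (ideal_gen [set f])).
Proof.
rewrite trop_multE init_ideal_graph gmult_preim; last exact: ideal_gen_ideal.
  congr gmult; apply/seteqP; split=> x.
    move=> [_ [e _ <-] <-] /=; rewrite comp_XU; move: e; apply: (graphP him).
    - by rewrite graph_i; apply: Or31.
    - by rewrite (graph_Y him); apply: Or32.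
    - by rewrite (graph_m him); apply: Or33.
  case=> ->.
  - by exists 'X_i; [exists i|rewrite /= comp_XU graph_i].
  - by exists 'X_iY; [exists iY|rewrite /= comp_XU (graph_Y him)].
  - by exists 'X_m; [exists m|rewrite /= comp_XU (graph_m him)].
exact: phi_surj.
Qed.

End Graph.

End InitialIdeal.

(** * The re-embedding ideal: its two charts and its multiplicities *)

Section Reembedded.
Variable R : realType.
Local Notation K := (gpuiseux R).
Local Notation k := R[i].
Variables (g : {mpoly K[2]}) (l : rat) (zeta : K).
Let L : R := ratr l.
Let c : K := shift_term l zeta.
Let gt := tilde l zeta g.
Hypothesis g_irr : irreducible_elt g.
Hypotheses (z0 : zeta != 0) (zv : gp_val zeta = 0).

Let hXZ : (iX, iZ) = (iX, iZ) \/ (iX, iZ) = (iZ, iX). Proof. by left. Qed.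
Let hZX : (iZ, iX) = (iX, iZ) \/ (iZ, iX) = (iZ, iX). Proof. by right. Qed.

Let one0 : (1 : k) != 0. Proof. exact: oner_neq0. Qed.

Lemma shift_neq0 : c != 0.
Proof. by rewrite mulf_neq0// gp_mono_neq0. Qed.

Lemma shift_val : gp_val c = - L.
Proof. by rewrite gp_valM ?gp_mono_neq0// zv add0r gp_val_mono. Qed.

Let s1 : 2.-tuple {mpoly K[2]} := [tuple 'X_i0 - c%:MP; 'X_i1].
Let s2 : 2.-tuple {mpoly K[2]} := [tuple 'X_i0 + c%:MP; 'X_i1].

Let s12 a : (a \mPo s1) \mPo s2 = a.
Proof.
rewrite (@comp_mpoly_eq _ _ _ _ _ _ [tuple 'X_e | e < 2]); last first.
  apply: ord2P; rewrite tnth_mktuple [tnth _ _]/= ?comp_XU//.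
  by rewrite rmorphB/= comp_XU comp_mpolyC [tnth _ _]/= addrK.
by apply: comp_mpoly_idE => e; rewrite tnth_mktuple.
Qed.

Lemma tilde_neq0 : gt != 0.
Proof.
have [g0 _ _] := g_irr; apply: contraNneq g0 => e.
by rewrite -(s12 g) -/gt [g \mPo s1]e rmorph0.
Qed.

Lemma tilde_eval x y : gt.@[vec2 x y] = g.@[vec2 (x - c) y].
Proof.
rewrite comp_mpoly_meval; apply: meval_eq; apply: ord2P => //=.
  by rewrite mevalB mevalXU mevalC.
by rewrite mevalXU.
Qed.

Lemma reembeddingE1 : reembedding l zeta g =
  [set F | exists b, F \mPo graph_tuple iX ('X_i0 + c%:MP) = b * g].
Proof.
have tE : [tuple 'X_iX; 'X_iY] = base_tuple K iX.
  by apply: eq_from_tnth; apply: ord2P; rewrite ?base_i0 ?base_i1.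
have cE : 'X_iX + c%:MP = ('X_i0 + c%:MP) \mPo base_tuple K iX.
  by rewrite rmorphD/= comp_XU comp_mpolyC base_i0.
rewrite /reembedding -/c tE cE; apply/seteqP; split.
  apply: ideal_gen_min.
    split; first by exists 0; rewrite comp_mpoly0 mul0r.
      move=> a b [a' ha] [b' hb]; exists (a' + b').
      by rewrite comp_mpolyD ha hb mulrDl.
    by move=> a b [b' hb]; exists ((a \mPo graph_tuple iX ('X_i0 + c%:MP)) * b');
      rewrite rmorphM/= hb mulrA.
  move=> _ [->|->]; first by exists 1; rewrite (base_graph hXZ) mul1r.
  by exists 0; rewrite comp_mpolyB comp_XU (graph_m hXZ) (base_graph hXZ) subrr mul0r.
move=> F [b Fb]; set J := ideal_gen _.
have hJ : is_ideal J by exact: ideal_gen_ideal.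
have [J0 JD JM] := hJ.
have := graph_kernel hXZ hJ (t := 'X_i0 + c%:MP) _ F; rewrite Fb => h.
rewrite -(subrK ((b * g) \mPo base_tuple K iX) F); apply: JD.
  by apply: h; apply: sub_ideal_gen; right.
by rewrite rmorphM/=; apply: JM; apply: sub_ideal_gen; left; exact: erefl.
Qed.

(** The same ideal seen from the (z, y)-plane; [s1] and [s2] are the inverse shears relating g and
    tilde g. *)
Lemma reembeddingE2 : reembedding l zeta g =
  [set F | exists b, F \mPo graph_tuple iZ ('X_i0 - c%:MP) = b * gt].
Proof.
have e1 F : (F \mPo graph_tuple iX ('X_i0 + c%:MP)) \mPo s1 =
    F \mPo graph_tuple iZ ('X_i0 - c%:MP).
  apply: comp_mpoly_eq; apply: ord3P.
  - by rewrite (graph_i iX) (graph_m hZX) comp_XU.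
  - by rewrite (graph_Y hXZ) (graph_Y hZX) comp_XU.
  - by rewrite (graph_m hXZ) (graph_i iZ) comp_mpolyD comp_XU comp_mpolyC [tnth _ _]/= subrK.
have e2 F : (F \mPo graph_tuple iZ ('X_i0 - c%:MP)) \mPo s2 =
    F \mPo graph_tuple iX ('X_i0 + c%:MP).
  apply: comp_mpoly_eq; apply: ord3P.
  - by rewrite (graph_i iX) (graph_m hZX) comp_mpolyB comp_XU comp_mpolyC [tnth _ _]/= addrK.
  - by rewrite (graph_Y hXZ) (graph_Y hZX) comp_XU.
  - by rewrite (graph_m hXZ) (graph_i iZ) comp_XU.
rewrite reembeddingE1; apply/seteqP; split=> F [b Fb].
  by exists (b \mPo s1); rewrite -e1 Fb rmorphM.
by exists (b \mPo s2); rewrite -e2 Fb rmorphM/= s12.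
Qed.

Lemma Trop_reembedding (w : 'rV[R]_3) : Trop (reembedding l zeta g) w <->
  sheared g c (w 0 iX) (w 0 iY) (w 0 iZ).
Proof.
split=> [[p [p0 pI ->]]|[x [y [z [[x0 y0 zn0] gxy zE [hX hY hZ]]]]]].
  exists (p iX), (p iY), (p iZ); rewrite !mxE; split=> //.
    have := pI (g \mPo [tuple 'X_iX; 'X_iY]); rewrite comp_mpoly_meval => <-.
      by apply: meval_eq; apply: ord2P => /=; rewrite mevalXU.
    by apply: sub_ideal_gen; left.
  have := pI ('X_iZ - ('X_iX + c%:MP)); rewrite mevalB mevalD !mevalXU mevalC.
  by move=> h; apply/eqP; rewrite -subr_eq0 h//; apply: sub_ideal_gen; right.
pose p (e : 'I_3) := if e == iX then x else if e == iY then y else z.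
exists p; split.
- by apply: ord3P.
- rewrite reembeddingE1 => F [b Fb].
  have := congr1 (meval (vec2 x y)) Fb; rewrite mevalM gxy mulr0 comp_mpoly_meval => <-.
  apply: meval_eq; apply: ord3P.
  + by rewrite (graph_i iX) mevalXU.
  + by rewrite (graph_Y hXZ) mevalXU.
  + by rewrite (graph_m hXZ) mevalD mevalXU mevalC.
- by apply/rowP; apply: ord3P; rewrite mxE.
Qed.

Lemma Trop_reembedding' (w : 'rV[R]_3) : Trop (reembedding l zeta g) w <->
  sheared gt (- c) (w 0 iZ) (w 0 iY) (w 0 iX).
Proof.
rewrite Trop_reembedding; split=> -[x [y [z [[x0 y0 zn0] gxy zE [hX hY hZ]]]]];
  exists z, y, x; split=> //.
- by rewrite tilde_eval zE addrK.
- by rewrite zE addrK.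
- by move: gxy; rewrite tilde_eval zE.
- by rewrite zE subrK.
Qed.

(* If z divided tilde g, then x + zeta t^(-l) would divide the irreducible g. *)
Lemma tilde_low v : Trop (principal gt) v ->
  exists2 u : 'X_{1..2}, u \in msupp gt & u i0 = 0%N.
Proof.
move=> /TropP[p [p0 gp _]]; apply: contrapT => no.
have pos u : u \in msupp gt -> (0 < u i0)%N.
  by move=> ug; rewrite lt0n; apply/eqP => u0; apply: no; exists u.
pose h := \sum_(u <- msupp gt) gt@_u *: 'X_[u - U_(i0)].
have gtE : gt = 'X_i0 * h.
  rewrite [LHS]mpolyE /h mulr_sumr !big_seq; apply: eq_bigr => u /pos u0.
  rewrite -scalerAr -mpolyXD; congr (_ *: 'X_[_]).
  by apply/mnmP => e; rewrite mnmDE mnmBE mnm1E; case: eqP => [<-|_]; lia.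
have hp : h.@[p] = 0.
  by move: gp; rewrite gtE mevalM mevalXU => /eqP; rewrite mulf_eq0 (negPf (p0 _)) => /eqP.
have gE : g = ('X_i0 + c%:MP) * (h \mPo s2).
  by rewrite -[LHS]s12 -/gt [g \mPo s1]gtE rmorphM/= comp_XU.
(* Non-units are recognized by a zero: (-c, 1) for the linear factor, and the sheared zero p of [h]
   for the cofactor. *)
have nounit (a : {mpoly K[2]}) q : a.@[q] = 0 -> a \isn't a GRing.unit.
  move=> aq; apply/negP => /mulVr/(congr1 (meval q)).
  by rewrite mevalM aq mulr0 meval1 => /esym/eqP; rewrite oner_eq0.
have [_ _ /(_ _ _ gE)[]] := g_irr; apply/negP.
  by apply: (nounit _ (vec2 (- c) 1)); rewrite mevalD mevalXU mevalC addNr.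
apply: (nounit _ (vec2 (p i0 - c) (p i1))); rewrite comp_mpoly_meval -hp.
by apply: meval_eq; apply: ord2P; rewrite /= ?mevalD mevalXU ?mevalC ?subrK.
Qed.

Lemma gmult_ext (A : comNzRingType) (U U' Q : set A) :
  (forall P, is_prime_ideal P -> (forall x, U x -> ~ P x) <-> (forall x, U' x -> ~ P x)) ->
  gmult R U Q = gmult R U' Q.
Proof.
move=> h; rewrite /gmult; congr esum.
have tE P : tprime U P <-> tprime U' P by split=> -[hP /(h _ hP)].
by apply/seteqP; split=> P [/tE h1 h2 h3]; split=> // P' /tE; exact: h3.
Qed.

Let vars : set {mpoly k[2]} := range (fun e : 'I_2 => 'X_e).

Lemma gmult_const (e : k) Q : e != 0 ->
  gmult R [set x : {mpoly k[2]} | [\/ x = 'X_i0, x = 'X_i1 | x = e%:MP]] Q = gmult R vars Q.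
Proof.
move=> e0; apply: gmult_ext => P [[P0 PD PM] P1 _]; split=> h x.
  move=> [i _ <-]; move: i; apply: ord2P; apply: h; [exact: Or31|exact: Or32].
case=> ->; [by apply: h; exists i0|by apply: h; exists i1|].
by move=> /(PM (e^-1)%:MP); rewrite -mpolyCM mulVf.
Qed.

Lemma gmult_dup Q :
  gmult R [set x : {mpoly k[2]} | [\/ x = 'X_i0, x = 'X_i1 | x = 'X_i0]] Q = gmult R vars Q.
Proof.
congr gmult; apply/seteqP; split=> x.
  by case=> ->; [exists i0|exists i1|exists i0].
by move=> [i _ <-]; move: i; apply: ord2P; [exact: Or31|exact: Or32].
Qed.

Let wleC_shift (w : 'rV[R]_2) M (d : K) : gp_val d = - L -> d != 0 -> L <= M -> wle w M d%:MP.
Proof.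
move=> dv d0 LM; apply: wleC; have [_ h] := gp_val_spec d0; rewrite dv in h.
by apply: (vgeW _ h); rewrite lerN2.
Qed.

Let wtopC_shift (w : 'rV[R]_2) M (d : K) : gp_val d = - L -> d != 0 -> L <= M ->
  wtop w M d%:MP = if M == L then (gp_lead d)%:MP else 0.
Proof.
move=> dv d0 LM; rewrite wtopC; have [_ h] := gp_val_spec d0; rewrite dv in h.
case: (M =P L) => [->|ML]; first by rewrite /gp_lead dv.
rewrite (vge_coef0 h) ?mpolyC0// ltrN2 lt_neqAle LM andbT eq_sym; exact/eqP.
Qed.

Let g0 : g != 0. Proof. by have [] := g_irr. Qed.

(** The third coordinate degenerates to a nonzero constant for X < l and to x for X > l; inverting
    it adds no condition in either case. *)
Lemma trop_mult_XY (w : 'rV[R]_3) : w 0 iX != L -> w 0 iZ = Num.max (w 0 iX) L ->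
  trop_mult (reembedding l zeta g) w = trop_mult (principal g) (projXY w).
Proof.
move=> XL Zm; set w2 := projXY w.
have LZ : L <= w 0 iZ by rewrite Zm le_max lexx orbT.
have XZ : w 0 iX <= w 0 iZ by rewrite Zm le_max lexx.
have tle : wle w2 (w 0 iZ) ('X_i0 + c%:MP).
  apply: wleD; last exact: wleC_shift shift_val shift_neq0 LZ.
  by apply: wleX_le; rewrite mxE.
have ttop : wtop w2 (w 0 iZ) ('X_i0 + c%:MP) =
    if w 0 iX < L then (gp_lead c)%:MP else 'X_i0.
  rewrite wtopD (wtopC_shift _ shift_val shift_neq0 LZ) wtopX_if mxE/= Zm.
  have [XltL|LleX] := ltP (w 0 iX) L; first by rewrite eqxx lt_eqF ?add0r.
  by rewrite eqxx (negPf XL) addr0.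
rewrite reembeddingE1 (trop_mult_graph hXZ g0 tle ttop) trop_multE.
case: ifP => _; [exact: gmult_const (gp_lead_neq0 shift_neq0)|exact: gmult_dup].
Qed.

(** On the open cell Z < X = l it is x = z - c that degenerates to a nonzero constant, whence the
    chart over the (z, y)-plane. *)
Lemma trop_mult_ZY (w : 'rV[R]_3) : w 0 iZ < L -> w 0 iX = L ->
  trop_mult (reembedding l zeta g) w = trop_mult (principal gt) (projZY w).
Proof.
move=> ZL XL; set w2 := projZY w.
have nv : gp_val (- c) = - L by rewrite gp_valN shift_val.
have n0 : - c != 0 by rewrite oppr_eq0 shift_neq0.
have LX : L <= w 0 iX by rewrite XL.
have tle : wle w2 (w 0 iX) ('X_i0 - c%:MP).
  rewrite -mpolyCN; apply: wleD; last exact: wleC_shift nv n0 LX.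
  by apply: wleX_le; rewrite mxE/= XL ltW.
have ttop : wtop w2 (w 0 iX) ('X_i0 - c%:MP) = (gp_lead (- c))%:MP.
  rewrite -mpolyCN wtopD (wtopC_shift _ nv n0 LX) wtopX_if mxE/= XL eqxx.
  by rewrite lt_eqF ?add0r.
rewrite reembeddingE2 (trop_mult_graph hZX tilde_neq0 tle ttop) trop_multE.
exact: gmult_const (gp_lead_neq0 n0).
Qed.

Lemma poly_eval_ext (P Q : {poly k}) : (forall x, P.[x] = Q.[x]) -> P = Q.
Proof.
move=> h; apply/eqP; rewrite -subr_eq0; apply/negPn/negP => /closed_nonrootP[x].
by rewrite /root hornerD hornerN h subrr eqxx.
Qed.

Lemma prod_shift_low (rs : seq k) (e : k) : exists2 r : {poly k}, r.[0] != 0 &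
  \prod_(z <- rs) ('X - (e + z)%:P) = 'X^(count_mem (- e) rs) * r.
Proof.
elim: rs => [|z rs [r r0 IH]].
  by exists 1; rewrite ?hornerC ?oner_neq0// big_nil expr0 mul1r.
rewrite big_cons IH /=; have [->|ze] := eqVneq z (- e).
  by exists r => //; rewrite subrr polyC0 subr0 exprS mulrA.
exists (('X - (e + z)%:P) * r); last by rewrite add0n mulrCA.
rewrite hornerM mulf_neq0// !hornerE oppr_eq0 addrC addr_eq0.
by [].
Qed.

(* On the line X = Z = l, with both plane curves locally vertical: d counts the
   roots of in(g) in x, a' of which are -zeta; the remaining n ones give points of
   the re-embedded curve. *)
Lemma line_multiplicity Y : locvert (Trop (principal g)) (pt2 L Y) ->
  locvert (Trop (principal gt)) (pt2 L Y) -> Trop (principal g) (pt2 L Y) ->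
  exists n a' d, [/\ (n + a' = d)%N, isxlow gt (pt2 L Y) a',
    trop_mult (principal g) (pt2 L Y) = d%:R%:E,
    sheared g c L Y L <-> (0 < n)%N &
    forall w : 'rV[R]_3, w 0 iX = L -> w 0 iZ = L -> w 0 iY = Y ->
      trop_mult (reembedding l zeta g) w = n%:R%:E].
Proof.
set w2 := pt2 L Y => lv lv' Cw.
have [b hb] := locvert_yconst g0 lv.
have [b' hb'] := locvert_yconst tilde_neq0 lv'.
have [a la] := isxlow_exists w2 g0; have [d hd] := isxhigh_exists w2 g0.
pose e := gp_lead c.
have [rs [cc [[cc0 rs0 _ xE multE] gE]]] := mult_yconst e hb la hd.
have e0 : e != 0 by exact: gp_lead_neq0 shift_neq0.
exists (count (predC1 (- e)) rs), (count_mem (- e) rs), (size rs); split.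
- by rewrite addnC; exact: count_predC.
- have nv : gp_val (- c) = - L by rewrite gp_valN shift_val.
  have n0 : - c != 0 by rewrite oppr_eq0 shift_neq0.
  pose s1' : 2.-tuple {mpoly k[2]} := [tuple 'X_i0 - e%:MP; 'X_i1].
  have sle j : wle w2 (w2 0 j) (tnth s1 j).
    move: j; apply: ord2P; last exact: wleX.
    rewrite (_ : tnth s1 i0 = 'X_i0 - c%:MP)// -mpolyCN; apply: wleD; first exact: wleX.
    by apply: (wleC_shift _ nv n0); rewrite pt20.
  have stop j : wtop w2 (w2 0 j) (tnth s1 j) = tnth s1' j.
    move: j; apply: ord2P; last exact: wtopX.
    rewrite (_ : tnth s1 i0 = 'X_i0 - c%:MP)// (_ : tnth s1' i0 = 'X_i0 - e%:MP)//.
    rewrite -mpolyCN wtopD wtopX (wtopC_shift _ nv n0) ?pt20// eqxx.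
    by rewrite gp_leadN mpolyCN.
  have [u mu] := maxterm_exists w2 g0.
  have [gle gtop] := subst_mpoly (wle_maxterm mu) sle stop.
  rewrite (wtop_maxterm mu) in gtop.
  have q0 : init_form w2 g \mPo s1' != 0.
    have /closed_nonrootP[x] := xpoly_neq0 hb (init_form_neq0 w2 g0).
    apply: contraNneq => q0; rewrite /root.
    have := congr1 (meval (fun j : 'I_2 => if j == i0 then x + e else 1)) q0.
    rewrite comp_mpoly_meval (meval_yconst _ hb) meval0 /= mevalB !mevalXU mevalC/=.
    by rewrite expr1n mulr1 addrK => ->.
  (* Both terms of the shear x = z - c have weight L, so the sheared initial form of g is a symbol
     of tilde g; being nonzero, it is its initial form. *)
  have iE : init_form w2 gt = init_form w2 g \mPo s1'.
    by have [h|<-//] := wtop_init_form gle; rewrite -gtop h eqxx in q0.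
  have xgt : xpoly (init_form w2 gt) = xpoly (init_form w2 g) \Po ('X - e%:P).
    apply: poly_eval_ext => x.
    have h1 := meval_yconst (fun j : 'I_2 => if j == i0 then x else 1) hb'.
    rewrite /= expr1n mulr1 in h1; rewrite -h1 iE comp_mpoly_meval.
    rewrite (meval_yconst _ hb)/= mevalB !mevalXU mevalC/= expr1n mulr1.
    by rewrite horner_comp !hornerE.
  have [r r0 rE] := prod_shift_low rs e.
  (* Everything not vanishing at 0, including the factor (X - e)^a that comes from X^a; so the root
     -e alone accounts for the power of X. *)
  pose r' := cc *: r * ('X - e%:P) ^+ a.
  have xlow : xpoly (init_form w2 gt) = 'X^(count_mem (- e) rs) * r'.
    rewrite xgt xE comp_polyM comp_polyZ comp_Xn_poly /r'.
    have -> : (\prod_(z <- rs) ('X - z%:P)) \Po ('X - e%:P) =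
        \prod_(z <- rs) ('X - (e + z)%:P).
      rewrite rmorph_prod; apply: eq_bigr => z _ /=.
      by rewrite comp_polyB comp_polyX comp_polyC polyCD opprD addrA.
    by rewrite rE -!scalerAl -scalerAr mulrA.
  have r'0 : r'`_0 != 0.
    rewrite -horner_coef0 hornerM hornerZ horner_exp !hornerE.
    by rewrite !mulf_neq0// expf_neq0// oppr_eq0.
  have coefl u' : maxterm w2 gt u' -> (xpoly (init_form w2 gt))`_(u' i0) != 0.
    by move=> /maxtermP mu'; rewrite (coef_xpoly hb') ?hb'// -mcoeff_msupp.
  split.
    exists (mon2 (count_mem (- e) rs) b'); last by rewrite mon20.
    apply/maxtermP; rewrite mcoeff_msupp -(coef_xpoly hb' (mon21 _ _)) mon20 xlow.
    by rewrite coefXnM ltnn subnn.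
  move=> u' /coefl; rewrite xlow coefXnM; case: ltnP => //.
  by rewrite eqxx.
- exact: multE.
- rewrite (sheared_rootP g0 shift_neq0 shift_val hb).
  have rootE x : x != 0 -> root (xpoly (init_form w2 g)) x = (x \in rs).
    move=> x0; rewrite xE rootM rootZ// root_prod_XsubC.
    by rewrite /root hornerXn expf_eq0 (negPf x0) andbF orbF.
  rewrite -has_count; split=> [[x x0 [rx xe]]|/hasP[x xrs xe]].
    by apply/hasP; exists x => //; rewrite -rootE.
  by exists x; [exact: rs0|rewrite rootE ?rs0].
- move=> w wX wZ wY.
  have LZ : L <= w 0 iZ by rewrite wZ.
  have w2E : pt2 (w 0 iX) (w 0 iY) = w2 by rewrite wX wY.
  have tle : wle (pt2 (w 0 iX) (w 0 iY)) (w 0 iZ) ('X_i0 + c%:MP).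
    apply: wleD; last exact: wleC_shift shift_val shift_neq0 LZ.
    by apply: wleX_le; rewrite pt20 wX wZ.
  have ttop : wtop (pt2 (w 0 iX) (w 0 iY)) (w 0 iZ) ('X_i0 + c%:MP) = 'X_i0 + e%:MP.
    rewrite wtopD (wtopC_shift _ shift_val shift_neq0 LZ) wtopX_if pt20 wX wZ.
    by rewrite !eqxx.
  by rewrite reembeddingE1 (trop_mult_graph hXZ g0 tle ttop) w2E init_ideal_principal.
Qed.

End Reembedded.

(** * Vertices of a curve in the modification, from its two plane projections *)

Section ModificationGeometry.
Variable R : realType.
Variables (T : set 'rV[R]_3) (C C' : set 'rV[R]_2) (L : R).

Definition pt3 (x y z : R) : 'rV[R]_3 :=
  \row_e (if e == iX then x else if e == iY then y else z).

Lemma pt3X x y z : pt3 x y z 0 iX = x. Proof. by rewrite mxE. Qed.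
Lemma pt3Y x y z : pt3 x y z 0 iY = y. Proof. by rewrite mxE. Qed.
Lemma pt3Z x y z : pt3 x y z 0 iZ = z. Proof. by rewrite mxE. Qed.
Let pt3E := (pt3X, pt3Y, pt3Z).

Lemma lineE n (w v : 'rV[R]_n) (s : R) e : (w + s *: v) 0 e = w 0 e + s * v 0 e.
Proof. by rewrite !mxE. Qed.

Lemma combE n (a b : 'rV[R]_n) (s t : R) e :
  (s *: a + t *: b) 0 e = s * a 0 e + t * b 0 e.
Proof. by rewrite !mxE. Qed.

Lemma rV3P (w w' : 'rV[R]_3) : w 0 iX = w' 0 iX -> w 0 iY = w' 0 iY ->
  w 0 iZ = w' 0 iZ -> w = w'.
Proof. by move=> h1 h2 h3; apply/rowP; exact: ord3P. Qed.

Lemma rV2P (w w' : 'rV[R]_2) : w 0 i0 = w' 0 i0 -> w 0 i1 = w' 0 i1 -> w = w'.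
Proof. by move=> h1 h2; apply/rowP; exact: ord2P. Qed.

Lemma projXYE w : projXY w = pt2 (w 0 iX) (w 0 iY) :> 'rV[R]_2. Proof. by []. Qed.
Lemma projZYE w : projZY w = pt2 (w 0 iZ) (w 0 iY) :> 'rV[R]_2. Proof. by []. Qed.

Lemma max_lip (x y : R) : `|Num.max x L - Num.max y L| <= `|x - y|.
Proof.
have := ler_norm (x - y); have := ler_norm (y - x); rewrite distrC => h1 h2.
rewrite ler_norml; have [hx|hx] := leP x L; have [hy|hy] := leP y L;
  rewrite ?subrr ?oppr_le0 ?normr_ge0//; apply/andP; split; lra.
Qed.

Hypothesis T_mod : T `<=` modification L.
Hypothesis T_XY : forall w : 'rV[R]_3, w 0 iX != L ->
  T w <-> w 0 iZ = Num.max (w 0 iX) L /\ C (projXY w).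
Hypothesis T_ZY : forall w : 'rV[R]_3, w 0 iZ != L ->
  T w <-> w 0 iX = Num.max (w 0 iZ) L /\ C' (projZY w).
Hypothesis T_line : forall Y, T (pt3 L Y L) -> C (pt2 L Y) /\ C' (pt2 L Y).
Hypothesis T_C : forall Y, C (pt2 L Y) -> ~ locvert C (pt2 L Y) -> T (pt3 L Y L).
Hypothesis T_C' : forall Y, C' (pt2 L Y) -> ~ locvert C' (pt2 L Y) -> T (pt3 L Y L).
Hypothesis T_near : forall Y, T (pt3 L Y L) -> locvert C (pt2 L Y) ->
  exists2 e : R, 0 < e & forall Y', `|Y' - Y| < e -> T (pt3 L Y' L).

Let on_line (w : 'rV[R]_3) : lineXZ L w -> w = pt3 L (w 0 iY) L.
Proof. by move=> [hX hZ]; apply: rV3P; rewrite ?pt3E. Qed.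

Let line_pt Y : lineXZ L (pt3 L Y L).
Proof. by split; rewrite pt3E. Qed.

Definition locL Y := exists2 e : R, 0 < e & forall u, close e (pt3 L Y L) u ->
  (T u <-> lineXZ L u).

Lemma locvert_locL Y : T (pt3 L Y L) -> locvert C (pt2 L Y) -> locvert C' (pt2 L Y) ->
  locL Y.
Proof.
move=> TY lv lv'; have [e1 e10 he1] := T_near TY lv.
have [e2 e20 he2] := lv; have [e3 e30 he3] := lv'.
exists (Num.min e1 (Num.min e2 e3)); first by rewrite !lt_min e10 e20.
move=> u hu; have {}hu i : [/\ `|u 0 i - pt3 L Y L 0 i| < e1,
    `|u 0 i - pt3 L Y L 0 i| < e2 & `|u 0 i - pt3 L Y L 0 i| < e3].
  by have := hu i; rewrite !lt_min => /andP[-> /andP[-> ->]].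
have [[uX uY] uZ] := (hu iX, hu iY, hu iZ); rewrite !pt3E in uX uY uZ.
split=> [Tu|uL].
  split; apply/eqP/negPn/negP => ne.
    have [_ Cu] := (T_XY ne).1 Tu.
    have /he2[/(_ Cu) h _] : close e2 (pt2 L Y) (projXY u).
      by apply: ord2P; rewrite projXYE ?pt20 ?pt21; [case: uX|case: uY].
    by rewrite projXYE !pt20 in h; rewrite h eqxx in ne.
  have [_ Cu] := (T_ZY ne).1 Tu.
  have /he3[/(_ Cu) h _] : close e3 (pt2 L Y) (projZY u).
    by apply: ord2P; rewrite projZYE ?pt20 ?pt21; [case: uZ|case: uY].
  by rewrite projZYE !pt20 in h; rewrite h eqxx in ne.
by rewrite (on_line uL); apply: he1; case: uY.
Qed.

(** A nearby point of C off the vertical line would lift to T with Z = max(X, l); the lift stays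
    close because max is 1-Lipschitz. The same holds for C' with X and Z exchanged. *)
Lemma locL_locvert Y : locL Y -> locvert C (pt2 L Y) /\ locvert C' (pt2 L Y).
Proof.
move=> [e e0 he].
have cl x y z : `|x - L| < e -> `|y - Y| < e -> `|z - L| < e ->
    close e (pt3 L Y L) (pt3 x y z).
  by move=> h1 h2 h3; apply: ord3P; rewrite !pt3E.
have maxc x : `|x - L| < e -> `|Num.max x L - L| < e.
  by apply: le_lt_trans; rewrite -{2}(maxxx L); exact: max_lip.
split; exists e => // v hv; have := hv i0; have := hv i1; rewrite ?pt20 ?pt21 => h1 h0;
    split=> [Cv|v0].
- apply/eqP/negPn/negP => ne.
  have /he[h _] := cl _ _ _ h0 h1 (maxc _ h0).
  have : T (pt3 (v 0 i0) (v 0 i1) (Num.max (v 0 i0) L)).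
    by apply/T_XY; rewrite !pt3E// projXYE !pt3E pt2_eta.
  by move=> /h[]; rewrite pt3E => e1; rewrite e1 eqxx in ne.
- have /he[_ h] := cl L (v 0 i1) L ltac:(by rewrite subrr normr0) h1 ltac:(by rewrite subrr normr0).
  by have [+ _] := T_line (h (line_pt _)); rewrite -v0 pt2_eta.
- apply/eqP/negPn/negP => ne.
  have /he[h _] := cl _ _ _ (maxc _ h0) h1 h0.
  have : T (pt3 (Num.max (v 0 i0) L) (v 0 i1) (v 0 i0)).
    by apply/T_ZY; rewrite !pt3E// projZYE !pt3E pt2_eta.
  by move=> /h[_]; rewrite pt3E => e1; rewrite e1 eqxx in ne.
- have /he[_ h] := cl L (v 0 i1) L ltac:(by rewrite subrr normr0) h1 ltac:(by rewrite subrr normr0).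
  by have [_] := T_line (h (line_pt _)); rewrite -v0 pt2_eta.
Qed.

Lemma locL_locally_line Y : locL Y -> locally_line T (pt3 L Y L).
Proof.
move=> [e e0 he]; exists (pt3 0 1 0).
  by apply/eqP => /rowP/(_ iY); rewrite pt3E mxE => /eqP; rewrite oner_eq0.
apply/near_closeP; exists e => // u /he ->; split=> [[uX uZ]|[s ->]].
  exists (u 0 iY - Y).
  by apply: rV3P; rewrite lineE !pt3E ?uX ?uZ ?mulr0 ?addr0// mulr1 addrC subrK.
by split; rewrite lineE !pt3E mulr0 addr0.
Qed.

Lemma small_multiple n (v : 'rV[R]_n) (e : R) : 0 < e ->
  exists2 s, 0 < s & forall i, `|s * v 0 i| < e.
Proof.
move=> e0; pose M := 1 + \sum_i `|v 0 i|.
have S0 : 0 <= \sum_i `|v 0 i| by apply: sumr_ge0.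
have M0 : 0 < M by rewrite /M; lra.
exists (e / M); first exact: divr_gt0.
move=> i; rewrite normrM gtr0_norm ?divr_gt0// -mulrA -[ltRHS]mulr1 ltr_pM2l//.
rewrite mulrC ltr_pdivrMr// mul1r /M (bigD1 i)//=.
have : 0 <= \sum_(j | j != i) `|v 0 j| by apply: sumr_ge0.
lra.
Qed.

(* No straight line crosses the line X = Z = l inside the modification. *)
Lemma locally_line_locL Y : T (pt3 L Y L) -> locally_line T (pt3 L Y L) -> locL Y.
Proof.
move=> TY [v v0 /near_closeP[e e0 he]].
have [s s0 hs] := small_multiple v e0.
have modif t : `|t| = s -> modification L (pt3 L Y L + t *: v).
  move=> ts; apply: T_mod; apply/he; last by exists t.
  by move=> i; rewrite !mxE addrAC subrr add0r normrM ts -(gtr0_norm s0) -normrM.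
have p1 : `|s| = s by rewrite gtr0_norm.
have p2 : `|- s| = s by rewrite normrN gtr0_norm.
have := modif _ p1; have := modif _ p2; rewrite /modification/= !mxE/= !mulNr.
have sX x : s * x = 0 -> x = 0.
  by move=> /eqP; rewrite mulf_eq0 (gt_eqF s0) => /eqP.
move=> m1 m2.
(* The two ends are symmetric about the point; each of the nine pairs of cells they may lie in
   leaves only zero displacements in X and Z. *)
have [aX aZ] : s * v 0 iX = 0 /\ s * v 0 iZ = 0.
  by case: m1 m2 => -[h1 h2] [] [h3 h4]; split; lra.
have vX := sX _ aX; have vZ := sX _ aZ.
have vY : v 0 iY != 0.
  by apply: contraNneq v0 => vY; apply/eqP; apply: rV3P; rewrite mxE.
exists e => // u /he ->; split=> [[t ->]|[uX uZ]].
  by split; rewrite lineE !pt3E ?vX ?vZ mulr0 addr0.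
exists ((u 0 iY - Y) / v 0 iY).
apply: rV3P; rewrite lineE !pt3E ?vX ?vZ ?mulr0 ?addr0//.
by rewrite divfK// addrC subrK.
Qed.

Lemma locally_lineP Y : T (pt3 L Y L) -> locally_line T (pt3 L Y L) <->
  locvert C (pt2 L Y) /\ locvert C' (pt2 L Y).
Proof.
move=> TY; split=> [/(locally_line_locL TY)/locL_locvert//|[h h']].
exact/locL_locally_line/locvert_locL.
Qed.

Lemma line_traceP w : line_trace C C' L w <->
  w = pt3 L (w 0 iY) L /\ C (pt2 L (w 0 iY)) /\ C' (pt2 L (w 0 iY)).
Proof.
split=> [[[h1 h2] [hX hZ]]|[wE [h1 h2]]]; last rewrite wE.
  by split; [exact: on_line|move: h1 h2; rewrite /preimage/= projXYE projZYE hX hZ].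
by split; last exact: line_pt; split; rewrite /preimage/= ?projXYE ?projZYE !pt3E.
Qed.

(** Turns the absence of a vertex and of an endpoint into verticality: a straight line containing a
    vertical segment is vertical. *)
Lemma locally_line_segment (D : set 'rV[R]_2) Y : locally_line D (pt2 L Y) ->
  (exists2 e : R, 0 < e & forall y, `|y - Y| < e -> D (pt2 L y)) ->
  locvert D (pt2 L Y).
Proof.
move=> [v v0 /near_closeP[e e0 he]] [e' e'0 he'].
have m0 : 0 < Num.min e e' by rewrite lt_min e0.
pose t := Num.min e e' / 2.
have t0 : 0 < t by rewrite divr_gt0.
have [te te'] : t < e /\ t < e'.
  have : t < Num.min e e' by rewrite /t; lra.
  by rewrite lt_min => /andP.
have : D (pt2 L (Y + t)) by apply: he'; rewrite addrAC subrr add0r gtr0_norm.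
have cl : close e (pt2 L Y) (pt2 L (Y + t)).
  by apply: ord2P; rewrite ?pt20 ?pt21 ?subrr ?normr0// addrAC subrr add0r gtr0_norm.
move=> /(he _ cl)[s /rowP hs].
have := hs i0; have := hs i1; rewrite !lineE !pt21 !pt20 => h1 h0.
have s0 : s != 0 by apply/eqP => s0; move: h1; rewrite s0 mul0r; lra.
have v00 : v 0 i0 = 0.
  have : s * v 0 i0 = 0 by lra.
  by move=> /eqP; rewrite mulf_eq0 (negPf s0) => /eqP.
have v1 : v 0 i1 != 0.
  by apply: contraNneq v0 => v1; apply/eqP; apply: rV2P; rewrite mxE.
exists e => // u /he ->; rewrite pt20; split=> [[r ->]|uL].
  by rewrite lineE pt20 v00 mulr0 addr0.
exists ((u 0 i1 - Y) / v 0 i1); apply: rV2P; rewrite lineE ?pt20 ?pt21.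
  by rewrite v00 mulr0 addr0.
by rewrite divfK// addrC subrK.
Qed.

Let lineseg_continuous : continuous (fun y : R => pt3 L y L).
Proof.
move=> y A /near_closeP[e e0 he]; apply/nbhs_ballP; exists e => //= y' hy'.
apply: he; apply: ord3P; rewrite !pt3E ?subrr ?normr0//.
by rewrite distrC; exact: hy'.
Qed.

(** The component is an interval in Y, so a point strictly between two of its points has a
    neighbourhood in the trace. Conversely, a segment of the trace about the point is connected and
    lies in its component. *)
Lemma trace_not_endpoint Y : let S := line_trace C C' L in S (pt3 L Y L) ->
  ~ endpoint (connected_component S (pt3 L Y L)) (pt3 L Y L) <->
  exists2 e : R, 0 < e & forall y, `|y - Y| < e -> S (pt3 L y L).
Proof.
move=> S SY; set D := connected_component S _.
have DY : D (pt3 L Y L) by exact: connected_component_refl.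
split=> [nend|[e e0 he] [_ hend]].
  apply: contrapT => nseg; apply: nend; split=> // a b Da Db ab [s /andP[s0 s1] wE].
  apply: nseg.
  have DL u : D u -> u = pt3 L (u 0 iY) L.
    by move=> /connected_component_sub/line_traceP[].
  have aE := DL _ Da; have bE := DL _ Db.
  have ab' : a 0 iY != b 0 iY by apply: contraNneq ab => ab; rewrite aE bE ab.
  have YE : Y = (1 - s) * a 0 iY + s * b 0 iY.
    by have /rowP/(_ iY) := wE; rewrite pt3E !mxE.
  pose I := (fun u : 'rV[R]_3 => u 0 iY) @` D.
  have cI : is_interval I.
    apply/connected_intervalP; apply: connected_continuous_connected.
      exact: component_connected.
    by apply: continuous_subspaceT => u; exact: coord_continuous.
  have inI y : Num.min (a 0 iY) (b 0 iY) <= y <= Num.max (a 0 iY) (b 0 iY) -> S (pt3 L y L).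
    move=> hy; have [u Du uy] : I y.
      apply: (cI (Num.min (a 0 iY) (b 0 iY)) (Num.max (a 0 iY) (b 0 iY))) => //.
        by rewrite minEle; case: ifP => _; [exists a|exists b].
      by rewrite maxEle; case: ifP => _; [exists b|exists a].
    by rewrite -uy -(DL _ Du); exact: connected_component_sub Du.
  (* The distance from Y to the nearer of the two points a and b. *)
  exists (Num.min s (1 - s) * `|a 0 iY - b 0 iY|).
    by rewrite mulr_gt0 ?normr_gt0 ?subr_eq0// lt_min s0 subr_gt0.
  move=> y hy; apply: inI.
  have ms : Num.min s (1 - s) <= s by rewrite ge_min lexx.
  have m1s : Num.min s (1 - s) <= 1 - s by rewrite ge_min lexx orbT.
  move: hy; rewrite ltr_norml => /andP[hy1 hy2].
  have n0 : 0 <= `|a 0 iY - b 0 iY| by [].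
  have q1 := ler_wpM2r n0 ms; have q2 := ler_wpM2r n0 m1s.
  rewrite YE in hy1 hy2.
  have [ab0|ba0] := leP (a 0 iY) (b 0 iY).
    rewrite ler0_norm ?subr_le0// in hy1 hy2 q1 q2.
    by apply/andP; split; nra.
  rewrite gtr0_norm ?subr_gt0// in hy1 hy2 q1 q2.
  by apply/andP; split; nra.
pose J : set R := [set y | `|y - Y| < e].
have cJ : connected ((fun y => pt3 L y L) @` J).
  apply: connected_continuous_connected.
    apply/connected_intervalP => x y; rewrite /J/= !ltr_norml => /andP[x1 x2] /andP[y1 y2].
    by move=> z /andP[z1 z2]; rewrite ltr_norml; apply/andP; split; lra.
  by apply: continuous_subspaceT => y; exact: lineseg_continuous.
have JD : (fun y => pt3 L y L) @` J `<=` D.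
  apply: connected_component_max => //; last by move=> _ [y hy <-]; exact: he.
  by exists Y => //; rewrite /J/= subrr normr0.
have e2 : e / 2 < e by lra.
have e20 : 0 < e / 2 by rewrite divr_gt0.
apply: (hend (pt3 L (Y - e / 2) L) (pt3 L (Y + e / 2) L)).
- by apply: JD; exists (Y - e / 2) => //; rewrite /J/= addrAC subrr add0r normrN gtr0_norm.
- by apply: JD; exists (Y + e / 2) => //; rewrite /J/= addrAC subrr add0r gtr0_norm.
- apply/eqP => /rowP/(_ iY); rewrite !pt3E; lra.
- exists (1 / 2); first by apply/andP; split; lra.
  by apply: rV3P; rewrite combE !pt3E; lra.
Qed.

(** Both sides say that C and C' are not both vertical at the point: for T by [locally_lineP], for
    the trace by [key]. At such a point of the trace, [T_C] or [T_C'] provides membership in T. *)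
Lemma vertices_on_line : vertices T `&` lineXZ L = trace_endpoints C C' L.
Proof.
set S := line_trace C C' L.
have SP Y : S (pt3 L Y L) <-> C (pt2 L Y) /\ C' (pt2 L Y).
  by rewrite /S line_traceP pt3E; split=> [[]|].
have key Y : S (pt3 L Y L) ->
    (endpoint (connected_component S (pt3 L Y L)) (pt3 L Y L) \/
     vertices C (pt2 L Y) \/ vertices C' (pt2 L Y)) <->
    ~ (locvert C (pt2 L Y) /\ locvert C' (pt2 L Y)).
  move=> SY; have [CY CY'] := (SP Y).1 SY; split.
    case=> [hend [[e1 e10 he1] [e2 e20 he2]]|[[_ nl]|[_ nl]] [h1 h2]].
    - suff : ~ endpoint (connected_component S (pt3 L Y L)) (pt3 L Y L) by [].
      apply/(trace_not_endpoint SY); exists (Num.min e1 e2); first by rewrite lt_min e10.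
      move=> y; rewrite lt_min => /andP[y1 y2]; apply/SP; split.
        by apply/he1; rewrite ?pt20//; apply: ord2P; rewrite ?pt20 ?pt21 ?subrr ?normr0.
      by apply/he2; rewrite ?pt20//; apply: ord2P; rewrite ?pt20 ?pt21 ?subrr ?normr0.
    - by apply: nl; exact: locvert_locally_line.
    - by apply: nl; exact: locvert_locally_line.
  move=> nlv; apply: contrapT => no; apply: nlv.
  have nend : ~ endpoint (connected_component S (pt3 L Y L)) (pt3 L Y L).
    by move=> h; apply: no; left.
  have [e e0 he] := (trace_not_endpoint SY).1 nend.
  have lC : locally_line C (pt2 L Y).
    by apply: contrapT => h; apply: no; right; left.
  have lC' : locally_line C' (pt2 L Y).
    by apply: contrapT => h; apply: no; right; right.
  split; apply: locally_line_segment => //; exists e => // y /he/SP[]//.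
apply/seteqP; split=> w.
  move=> [[Tw nl] wL]; rewrite (on_line wL) in Tw nl *.
  move: (w 0 iY) Tw nl => Y TY nl.
  have SY : S (pt3 L Y L) by apply/SP; exact: T_line.
  split=> //; rewrite -/S projXYE projZYE !pt3E.
  have : ~ (locvert C (pt2 L Y) /\ locvert C' (pt2 L Y)) by move=> h; apply: nl; exact/locally_lineP.
  by move=> /(key _ SY)[h|[h|h]]; [apply: Or31|apply: Or32|apply: Or33].
move=> [Sw hw]; have [wE _] := (line_traceP w).1 Sw.
rewrite -/S wE in Sw hw *; move: (w 0 iY) Sw hw => Y SY; rewrite projXYE projZYE !pt3E => hw.
have nlv : ~ (locvert C (pt2 L Y) /\ locvert C' (pt2 L Y)).
  by apply/(key _ SY); case: hw => h; [left|right; left|right; right].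
have [CY CY'] := (SP Y).1 SY.
have TY : T (pt3 L Y L).
  have [h|h] := pselect (locvert C (pt2 L Y)); last exact: T_C.
  by apply: T_C' => // h'; apply: nlv.
by split; [split=> // /(locally_lineP TY)|exact: line_pt].
Qed.

(** Away from L the curve is a graph over D, and a straight piece of it projects to a straight
    piece. Its direction does not project to 0, since a graph contains no segment parallel to the
    coordinate m. *)
Lemma graph_locally_line (D : set 'rV[R]_2) (i m : 'I_3) (w : 'rV[R]_3) :
  (i, m) = (iX, iZ) \/ (i, m) = (iZ, iX) -> w 0 i != L ->
  (forall u : 'rV[R]_3, u 0 i != L -> T u <-> u 0 m = Num.max (u 0 i) L /\ D (pt2 (u 0 i) (u 0 iY))) ->
  T w -> locally_line T w -> locally_line D (pt2 (w 0 i) (w 0 iY)).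
Proof.
move=> him wiL hT Tw [v v0 /near_closeP[e1 e10 he1]].
have allE (P : 'I_3 -> Prop) : P i -> P iY -> P m -> forall j, P j by exact: graphP.
have r3P (u u' : 'rV[R]_3) : u 0 i = u' 0 i -> u 0 iY = u' 0 iY -> u 0 m = u' 0 m -> u = u'.
  by move=> h1 h2 h3; apply/rowP; exact: allE.
pose e := Num.min e1 `|w 0 i - L|.
have e0 : 0 < e by rewrite lt_min e10 normr_gt0 subr_eq0.
have cl1 u : close e w u -> close e1 w u.
  by apply: closeW; rewrite ge_min lexx.
have cL x : `|x - w 0 i| < e -> x != L.
  move=> hx; apply/eqP => xL; move: hx; rewrite xL distrC ltNge => /negP; apply.
  by rewrite ge_min lexx orbT.
have hTw := (hT _ wiL).1 Tw.
pose v' := pt2 (v 0 i) (v 0 iY).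
have v'0 : v' != 0.
  apply/eqP => v'0; have vi : v 0 i = 0 by rewrite -(pt20 (v 0 i) (v 0 iY)) -/v' v'0 mxE.
  have vY : v 0 iY = 0 by rewrite -(pt21 (v 0 i) (v 0 iY)) -/v' v'0 mxE.
  have [s s0 hs] := small_multiple v e0.
  have Tu : T (w + s *: v).
    apply/he1; last by exists s.
    by apply: cl1 => j; rewrite !mxE addrAC subrr add0r.
  have ui : (w + s *: v) 0 i = w 0 i by rewrite !mxE vi mulr0 addr0.
  have uiL : (w + s *: v) 0 i != L by rewrite ui.
  have [+ _] := (hT _ uiL).1 Tu; rewrite ui -hTw.1 !mxE => h.
  have vm : v 0 m = 0.
    have : s * v 0 m = 0 by lra.
    by move=> /eqP; rewrite mulf_eq0 (gt_eqF s0) => /eqP.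
  by move/eqP: v0; apply; apply: r3P; rewrite mxE.
have [j vj] : exists j, v' 0 j != 0.
  apply: contrapT => /forallNP h; move/eqP: v'0; apply; apply/rowP => j.
  by rewrite [RHS]mxE; apply/eqP/negPn/negP; exact: h.
pose mu := `|v' 0 j|.
have mu0 : 0 < mu by rewrite normr_gt0.
pose N := 1 + `|v 0 m|.
have N0 : 0 < N by rewrite /N; have := normr_ge0 (v 0 m); lra.
(* With this radius, |s v'_j| < d gives |s| N < e, which bounds the displacement s v_m that the
   projection does not see. *)
pose d := Num.min e (e * mu / N).
have d0 : 0 < d by rewrite lt_min e0 divr_gt0// mulr_gt0.
have de : d <= e by rewrite ge_min lexx.
exists v' => //; apply/near_closeP; exists d => // u hu.
have h0 := hu i0; have h1 := hu i1; rewrite ?pt20 ?pt21 in h0 h1.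
have uL : u 0 i0 != L by apply: cL; exact: lt_le_trans h0 de.
split=> [Du|[s us]].
  have [U [Ui UY Um]] : exists U : 'rV[R]_3, [/\ U 0 i = u 0 i0, U 0 iY = u 0 i1 &
      U 0 m = Num.max (u 0 i0) L].
    exists (\row_q (if q == i then u 0 i0 else if q == iY then u 0 i1 else Num.max (u 0 i0) L)).
    by rewrite !mxE eqxx; case: him => -[-> ->].
  have TU : T U by apply/hT; rewrite Ui ?UY ?pt2_eta.
  have cU : close e w U.
    apply: allE; rewrite ?Ui ?UY ?Um.
    - exact: lt_le_trans h0 de.
    - exact: lt_le_trans h1 de.
    - by rewrite hTw.1; apply: le_lt_trans (max_lip _ _) _; exact: lt_le_trans h0 de.
  have [s Us] := (he1 _ (cl1 _ cU)).1 TU; exists s.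
  by apply: rV2P; rewrite lineE ?pt20 ?pt21 -?Ui -?UY Us !mxE.
have sv q : `|s * v' 0 q| < d.
  by have := hu q; rewrite us lineE addrAC subrr add0r.
have sm : `|s * v 0 m| < e.
  have h := sv j; rewrite normrM -/mu in h.
  have : `|s| * mu < e * mu / N by apply: lt_le_trans h _; rewrite ge_min lexx orbT.
  rewrite ltr_pdivlMr// mulrAC ltr_pM2r// normrM => h'.
  apply: le_lt_trans h'; apply: ler_wpM2l => //.
  by rewrite /N lerDr.
have cU : close e w (w + s *: v).
  apply: allE; rewrite !mxE addrAC subrr add0r.
  - by have := sv i0; rewrite pt20 => h; exact: lt_le_trans h de.
  - by have := sv i1; rewrite pt21 => h; exact: lt_le_trans h de.
  - exact: sm.
have TU : T (w + s *: v) by apply/(he1 _ (cl1 _ cU)); exists s.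
have Ui : (w + s *: v) 0 i = u 0 i0 by rewrite us !mxE.
have UY : (w + s *: v) 0 iY = u 0 i1 by rewrite us !mxE.
have UiL : (w + s *: v) 0 i != L by rewrite Ui.
by have [_] := (hT _ UiL).1 TU; rewrite Ui UY pt2_eta.
Qed.

End ModificationGeometry.

(** * The re-embedded curve is determined by the two plane curves *)

Section Assembly.
Variables (R : realType) (l : rat).
Local Notation K := (gpuiseux R).
Local Notation L := (ratr l : R).

Section OneCurve.
Variables (g : {mpoly K[2]}) (zeta : K).
Hypothesis g_irr : irreducible_elt g.
Hypotheses (z0 : zeta != 0) (zv : gp_val zeta = 0).
Let c := shift_term l zeta.
Let gt := tilde l zeta g.
Let T := Trop (reembedding l zeta g).
Let C := Trop (principal g).
Let C' := Trop (principal gt).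

Let g0 : g != 0. Proof. by have [] := g_irr. Qed.
Let gt0 : gt != 0. Proof. exact: tilde_neq0. Qed.
Let c0 : c != 0. Proof. exact: shift_neq0. Qed.
Let cv : gp_val c = - L. Proof. exact: shift_val. Qed.
Let c0' : - c != 0. Proof. by rewrite oppr_eq0. Qed.
Let cv' : gp_val (- c) = - L. Proof. by rewrite gp_valN. Qed.

Lemma reembedding_modification : T `<=` modification L.
Proof.
move=> w /Trop_reembedding/(sheared_mod c0 cv)[h1 h2 h3].
have [h|h|h] := ltgtP (w 0 iX) L.
- by apply: Or31; rewrite h1 ?ltW.
- by apply: Or32; rewrite h2 ?ltW.
- by apply: Or33; rewrite h h3.
Qed.

Lemma reembedding_XY (w : 'rV[R]_3) : w 0 iX != L ->
  T w <-> w 0 iZ = Num.max (w 0 iX) L /\ C (projXY w).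
Proof.
move=> XL; rewrite /T Trop_reembedding projXYE; split=> [h|[-> h]].
  split; last exact: sheared_curve h.
  have [h1 h2 _] := sheared_mod c0 cv h.
  by move: XL; case: ltgtP => // hX _; [exact: h1|exact: h2].
exact: curve_sheared.
Qed.

Lemma reembedding_ZY (w : 'rV[R]_3) : w 0 iZ != L ->
  T w <-> w 0 iX = Num.max (w 0 iZ) L /\ C' (projZY w).
Proof.
move=> ZL; rewrite /T Trop_reembedding' projZYE; split=> [h|[-> h]].
  split; last exact: sheared_curve h.
  have [h1 h2 _] := sheared_mod c0' cv' h.
  by move: ZL; case: ltgtP => // hX _; [exact: h1|exact: h2].
exact: curve_sheared.
Qed.

Lemma reembedding_pt3 Y : T (pt3 L Y L) <-> sheared g c L Y L.
Proof. by rewrite /T Trop_reembedding pt3X pt3Y pt3Z. Qed.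

Lemma reembedding_pt3' Y : T (pt3 L Y L) <-> sheared gt (- c) L Y L.
Proof. by rewrite /T Trop_reembedding' pt3X pt3Y pt3Z. Qed.

Lemma reembedding_line Y : T (pt3 L Y L) -> C (pt2 L Y) /\ C' (pt2 L Y).
Proof.
move=> TY; split; [have/reembedding_pt3 h := TY|have/reembedding_pt3' h := TY];
  exact: sheared_curve h.
Qed.

Lemma reembedding_not_locvert Y : C (pt2 L Y) -> ~ locvert C (pt2 L Y) -> T (pt3 L Y L).
Proof. by move=> CY h; apply/reembedding_pt3; exact: not_locvert_sheared. Qed.

Lemma reembedding_not_locvert' Y :
  C' (pt2 L Y) -> ~ locvert C' (pt2 L Y) -> T (pt3 L Y L).
Proof. by move=> CY h; apply/reembedding_pt3'; exact: not_locvert_sheared. Qed.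

Lemma reembedding_near Y : T (pt3 L Y L) -> locvert C (pt2 L Y) ->
  exists2 e : R, 0 < e & forall Y', `|Y' - Y| < e -> T (pt3 L Y' L).
Proof.
move=> /reembedding_pt3 h lv; have [e e0 he] := sheared_near g0 c0 cv h lv.
by exists e => // Y' /he h'; apply/reembedding_pt3.
Qed.

Lemma vertices_reembedding : vertices T `&` lineXZ L = trace_endpoints C C' L.
Proof.
apply: vertices_on_line; [exact: reembedding_modification|exact: reembedding_XY|
  exact: reembedding_ZY|exact: reembedding_line|exact: reembedding_not_locvert|
  exact: reembedding_not_locvert'|exact: reembedding_near].
Qed.

Lemma reembedding_locally_lineP Y : T (pt3 L Y L) -> locally_line T (pt3 L Y L) <->
  locvert C (pt2 L Y) /\ locvert C' (pt2 L Y).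
Proof.
apply: locally_lineP; [exact: reembedding_modification|exact: reembedding_XY|
  exact: reembedding_ZY|exact: reembedding_line|exact: reembedding_near].
Qed.

Lemma reembedding_locally_XY (w : 'rV[R]_3) : w 0 iX != L -> T w ->
  locally_line T w -> locally_line C (projXY w).
Proof.
move=> XL; rewrite projXYE.
apply: (graph_locally_line (D := C) (or_introl erefl) XL) => u.
by move=> /reembedding_XY; rewrite projXYE.
Qed.

Lemma reembedding_locally_ZY (w : 'rV[R]_3) : w 0 iZ != L -> T w ->
  locally_line T w -> locally_line C' (projZY w).
Proof.
move=> ZL; rewrite projZYE.
apply: (graph_locally_line (D := C') (or_intror erefl) ZL) => u.
by move=> /reembedding_ZY; rewrite projZYE.
Qed.

End OneCurve.

Section TwoCurves.
Variables (g1 g2 : {mpoly K[2]}) (zeta1 zeta2 : K).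
Hypotheses (irr1 : irreducible_elt g1) (irr2 : irreducible_elt g2).
Hypotheses (z10 : zeta1 != 0) (zv1 : gp_val zeta1 = 0).
Hypotheses (z20 : zeta2 != 0) (zv2 : gp_val zeta2 = 0).
Hypothesis same : same_weighted_curve (principal g1) (principal g2).
Hypothesis same' : same_weighted_curve (principal (tilde l zeta1 g1))
                                       (principal (tilde l zeta2 g2)).
Let T1 := Trop (reembedding l zeta1 g1).
Let T2 := Trop (reembedding l zeta2 g2).

Let eC : Trop (principal g1) = Trop (principal g2). Proof. by have [] := same. Qed.
Let eC' : Trop (principal (tilde l zeta1 g1)) = Trop (principal (tilde l zeta2 g2)).
Proof. by have [] := same'. Qed.

(** In n + a' = d, the number d is the multiplicity of the first curve and a' is fixed by
    [isxlow_determined]. So n agrees for the two data, and n decides both membership and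
    multiplicity. *)
Lemma line_multiplicity_same Y : locvert (Trop (principal g1)) (pt2 L Y) ->
  locvert (Trop (principal (tilde l zeta1 g1))) (pt2 L Y) ->
  Trop (principal g1) (pt2 L Y) -> Trop (principal (tilde l zeta1 g1)) (pt2 L Y) ->
  (T1 (pt3 L Y L) <-> T2 (pt3 L Y L)) /\
  trop_mult (reembedding l zeta1 g1) (pt3 L Y L) =
  trop_mult (reembedding l zeta2 g2) (pt3 L Y L).
Proof.
move=> lv lv' CY CY'.
have [n1 [a1 [d1 [e1 la1 m1 s1 t1]]]] := line_multiplicity irr1 z10 zv1 lv lv' CY.
have [b1 hb1] := locvert_yconst (tilde_neq0 l zeta1 irr1) lv'.
have := (lv, lv', CY); rewrite eC eC' => -[[lv2 lv2'] CY2].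
have [n2 [a2 [d2 [e2 la2 m2 s2 t2]]]] := line_multiplicity irr2 z20 zv2 lv2 lv2' CY2.
have [b2 hb2] := locvert_yconst (tilde_neq0 l zeta2 irr2) lv2'.
have CY2' : Trop (principal (tilde l zeta2 g2)) (pt2 L Y) by rewrite -eC'.
have da : d1 = d2.
  apply/eqP; rewrite -(eqr_nat R); apply/eqP.
  by have := same.2 _ CY (locvert_locally_line lv); rewrite m1 m2 => -[].
have aa : a1 = a2.
  apply: isxlow_uniq la2.
  apply: (isxlow_determined (tilde_neq0 l zeta1 irr1) (tilde_neq0 l zeta2 irr2) same' _ _ CY' hb1 hb2 la1).
    by have := tilde_low irr1 z10 CY'.
  by have := tilde_low irr2 z20 CY2'.
have nn : n1 = n2 by lia.
split; last by rewrite t1 ?t2 ?nn ?pt3X ?pt3Y ?pt3Z.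
rewrite nn in s1; apply: (iff_trans (reembedding_pt3 _ _ _)).
exact: (iff_trans s1 (iff_sym (iff_trans (reembedding_pt3 _ _ _) s2))).
Qed.

(** One inclusion suffices, the hypotheses being symmetric in the two data. *)
Lemma reembedding_sub : T1 `<=` T2.
Proof.
move=> w Tw; have [XL|XL] := eqVneq (w 0 iX) L; last first.
  have [h1 h2] := (reembedding_XY g1 z10 zv1 XL).1 Tw.
  apply: (reembedding_XY g2 z20 zv2 XL).2; split; first exact: h1.
  by rewrite -eC; exact: h2.
have [ZL|ZL] := eqVneq (w 0 iZ) L; last first.
  have [h1 h2] := (reembedding_ZY g1 z10 zv1 ZL).1 Tw.
  apply: (reembedding_ZY g2 z20 zv2 ZL).2; split; first exact: h1.
  by rewrite -eC'; exact: h2.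
have wE : w = pt3 L (w 0 iY) L by apply: rV3P; rewrite ?pt3X ?pt3Y ?pt3Z.
move: Tw; rewrite wE; move: (w 0 iY) => Y TY.
have [CY CY'] := reembedding_line TY.
have [lv|nlv] := pselect (locvert (Trop (principal g1)) (pt2 L Y)); last first.
  by apply: (reembedding_not_locvert irr2 z20 zv2); rewrite -eC; [exact: CY|exact: nlv].
have [lv'|nlv] := pselect (locvert (Trop (principal (tilde l zeta1 g1))) (pt2 L Y));
    last first.
  by apply: (reembedding_not_locvert' irr2 z20 zv2); rewrite -eC'; [exact: CY'|exact: nlv].
exact: (line_multiplicity_same lv lv' CY CY').1.1.
Qed.

Lemma reembedding_mult w : T1 w -> locally_line T1 w ->
  trop_mult (reembedding l zeta1 g1) w = trop_mult (reembedding l zeta2 g2) w.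
Proof.
move=> Tw lT; have [XL|XL] := eqVneq (w 0 iX) L; last first.
  have [Zm CX] := (reembedding_XY g1 z10 zv1 XL).1 Tw.
  rewrite (trop_mult_XY irr1 z10 zv1 XL Zm) (trop_mult_XY irr2 z20 zv2 XL Zm).
  exact: same.2 CX (reembedding_locally_XY z10 zv1 XL Tw lT).
have [ZL|ZL] := eqVneq (w 0 iZ) L; last first.
  have [Xm CX] := (reembedding_ZY g1 z10 zv1 ZL).1 Tw.
  have ZltL : w 0 iZ < L.
    have : w 0 iZ <= w 0 iX by rewrite Xm le_max lexx.
    by rewrite XL lt_neqAle ZL.
  rewrite (trop_mult_ZY irr1 z10 zv1 ZltL XL) (trop_mult_ZY irr2 z20 zv2 ZltL XL).
  exact: same'.2 CX (reembedding_locally_ZY z10 zv1 ZL Tw lT).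
have wE : w = pt3 L (w 0 iY) L by apply: rV3P; rewrite ?pt3X ?pt3Y ?pt3Z.
move: Tw lT; rewrite wE; move: (w 0 iY) => Y TY.
have [CY CY'] := reembedding_line TY.
move=> /(reembedding_locally_lineP irr1 z10 zv1 TY)[lv lv'].
exact: (line_multiplicity_same lv lv' CY CY').2.
Qed.

End TwoCurves.

End Assembly.

Theorem lemma2p2 (R : realType) (l : rat) :
  (forall (g1 g2 : {mpoly (gpuiseux R)[2]}) (zeta1 zeta2 : gpuiseux R),
     irreducible_elt g1 -> torus_curve g1 ->
     irreducible_elt g2 -> torus_curve g2 ->
     is_puiseux zeta1 -> zeta1 != 0 -> gp_val zeta1 = 0 ->
     is_puiseux zeta2 -> zeta2 != 0 -> gp_val zeta2 = 0 ->
     same_weighted_curve (principal g1) (principal g2) ->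
     same_weighted_curve (principal (tilde l zeta1 g1))
                         (principal (tilde l zeta2 g2)) ->
     same_weighted_curve (reembedding l zeta1 g1) (reembedding l zeta2 g2))
  /\
  (forall (g : {mpoly (gpuiseux R)[2]}) (zeta : gpuiseux R),
     irreducible_elt g -> torus_curve g ->
     is_puiseux zeta -> zeta != 0 -> gp_val zeta = 0 ->
     Trop (reembedding l zeta g) `<=` modification (ratr l : R) /\
     vertices (Trop (reembedding l zeta g)) `&` lineXZ (ratr l : R) =
     trace_endpoints (Trop (principal g)) (Trop (principal (tilde l zeta g)))
                     (ratr l : R)).
Proof.
split=> [g1 g2 zeta1 zeta2 irr1 _ irr2 _ _ z10 zv1 _ z20 zv2 same same'|
  g zeta irr _ _ z0 zv]; last first.
  by split; [exact: reembedding_modification|exact: vertices_reembedding].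
have sym n (I J : set {mpoly (gpuiseux R)[n]}) :
    same_weighted_curve I J -> same_weighted_curve J I.
  by move=> [IJ m]; split=> // w; rewrite -IJ => Tw lT; exact/esym/m.
split; last by move=> w; exact: reembedding_mult.
apply/seteqP; split.
  exact: (reembedding_sub irr1 irr2 z10 zv1 z20 zv2 same same').
exact: (reembedding_sub irr2 irr1 z20 zv2 z10 zv1 (sym _ _ _ same) (sym _ _ _ same')).
Qed.
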